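(* Let $R$ be a commutative unital ring in which $2$ is invertible and let $D$ be a diagram of a link $L$ in $\mathbb{RP}^3$. The object $CDKh'(D)$ is a chain complex, the chain homotopy equivalence class of which is an invariant of $L$.
   Context: Links and diagrams. A link is an oriented link in $\mathbb{RP}^3$. A diagram of a link is a tangle diagram in the disc $D^2$ with antipodal endpoints (on $\partial D^2$) identified. Two diagrams represent the same link if and only if they are related by a finite sequence of classical Reidemeister moves and two additional moves: R4, pushing a cap (an arc with no crossings) across the boundary circle of the disc, and R5, pushing a crossing across the boundary circle. Positive and negative crossings and their $0$- and $1$-resolutions are defined as in $S^3$ (the oriented resolution is the $0$-resolution at a positive crossing and the $1$-resolution at a negative crossing). A smoothing of $D$ is obtained by taking the $0$- or $1$-resolution at every crossing; it is a disjoint union of circles in $\mathbb{RP}^2$. The smoothings of a diagram with $n$ crossings form a cube $\{0,1\}^n$; an edge joins two smoothings differing at exactly one crossing, directed from the $0$- to the $1$-resolution, and the two smoothings cobound a pair of pants (merging or splitting circles) or a once-punctured Möbius band (one circle to one circle), together with cylinders. A face is a $4$-cycle of edges. Chain spaces. Put $\mathcal{A}=\langle v_+,v_-\rangle_R$ (free of rank 2), graded by $p(v_\pm)=\pm1$, extended additively over tensor products. Put $A^k=\mathcal{A}^{\otimes k}\oplus\mathcal{A}^{\otimes k}\{-1\}$, where $\{-1\}$ shifts the $p$-grading by $-1$, and $A=A^1$. The unshifted and shifted copies carry superscripts $u$ and $\ell$: $A=\langle v^u_+,v^u_-,v^\ell_+,v^\ell_-\rangle_R$. To a smoothing with $k$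 circles assign $A^k$, tensor factors corresponding to circles. The height of a smoothing is its number of $1$-resolutions minus the number $n_-$ of negative crossings of $D$; the chain space in homological degree $i$ is the direct sum of the modules assigned to smoothings of height $i$. Differential of $CDKh'(D)$. It is a matrix of maps, one for each edge: $m'$ or $\Delta'$ for a pair of pants, $\eta'$ for a once-punctured Möbius band. The maps $m':A^2\to A$, $\Delta':A\to A^2$ preserve superscripts (suppressed): $m'(v_{++})=v_+$, $m'(v_{+-})=m'(v_{-+})=v_-$, $m'(v_{--})=v_+$; $\Delta'(v_+)=v_{+-}+v_{-+}$, $\Delta'(v_-)=v_{--}+v_{++}$; acting on the factors of the circles involved and as the identity on the others. The map $\eta':A\to A$ is $\eta'(v^u_+)=v^\ell_+$, $\eta'(v^\ell_+)=2v^u_-$, $\eta'(v^u_-)=v^\ell_-$, $\eta'(v^\ell_-)=2v^u_+$; on $A^k$ it changes the superscript of the entire string and the subscript only of the factor of the circle involved. Signs are added to the entries by any convention such that each face contains an odd number of minus signs. *)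

(* Defs.v *)
From HB Require Import structures.
From Stdlib Require Import Relation_Operators.
From mathcomp Require Import all_boot all_order all_algebra.

Set Implicit Arguments.
Unset Strict Implicit.
Unset Printing Implicit Defensive.

Import GRing.Theory.

Local Open Scope ring_scope.

(** * Oriented link diagrams in the projective plane

    The disc is drawn as a rectangle, with half of the endpoints on its bottom
    side and half on its top side, and a tangle diagram in general position
    with respect to the height is read from bottom to top as a word of
    elementary slices.  A level is the left-to-right list of the orientations
    of the strands met by a horizontal line ([true] is upwards).

    - [Cup i b]: a local minimum, born between the strands [i-1] and [i]; its
      left branch has orientation [b].
    - [Cap i]: a local maximum, joining the strands [i] and [i+1].
    - [Cross i o]: the strands [i] and [i+1] cross; [o] says that the strand
      running from bottom left to top right is the over-strand. *)

Definition level := seq bool.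

Inductive slice :=
  | Cup of nat & bool
  | Cap of nat
  | Cross of nat & bool.

Definition is_cup (s : slice) : bool := if s is Cup _ _ then true else false.
Definition is_cap (s : slice) : bool := if s is Cap _ then true else false.
Definition is_cross (s : slice) : bool :=
  if s is Cross _ _ then true else false.

Definition pos (s : slice) : nat :=
  match s with Cup i _ => i | Cap i => i | Cross i _ => i end.

Definition over (s : slice) : bool := if s is Cross _ o then o else false.

(** Numbers of strands entering a slice from below and leaving it above,
    besides the vertical through strands. *)
Definition n_in (s : slice) : nat := if is_cup s then 0 else 2.
Definition n_out (s : slice) : nat := if is_cap s then 0 else 2.

Definition step (s : slice) (l : level) : option level :=
  match s with
  | Cup i b =>
      if (i <= size l)%N then Some (take i l ++ [:: b, ~~ b & drop i l])
      else None
  | Cap i =>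
      if drop i l is [:: x, y & r] then
        if x != y then Some (take i l ++ r) else None
      else None
  | Cross i _ =>
      if drop i l is [:: x, y & r] then Some (take i l ++ [:: y, x & r])
      else None
  end.

Definition run (w : seq slice) (l : level) : option level :=
  foldl (fun ol s => obind (step s) ol) (Some l) w.

(** The [i]-th endpoint of the top side, counted from the left, is antipodal
    to the [i]-th endpoint of the bottom side, counted from the right. *)
Record diagram := Diagram {
  bottom : level;
  word : seq slice;
  diagramP : run word bottom == Some (rev bottom)
}.

(** * Moves *)

Definition slice_shift (k : nat) (s : slice) : slice :=
  match s with
  | Cup i b => Cup (k + i) b
  | Cap i => Cap (k + i)
  | Cross i o => Cross (k + i) o
  end.

(** Moves supported in the interior of the disc.  The first five are the
    planar isotopies relating words that present isotopic tangle diagrams, the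
    last four are the classical Reidemeister moves. *)
Inductive local_move : seq slice -> seq slice -> Prop :=
  (* [t], at height above [s], lies to the right of [s] *)
  | lm_exchange s t : local_move
      [:: s; slice_shift (pos s + n_out s) t]
      [:: slice_shift (pos s + n_in s) t; s]
  | lm_zigzag_left i b : local_move [:: Cup i b; Cap i.+1] [::]
  | lm_zigzag_right i b : local_move [:: Cup i.+1 b; Cap i] [::]
  | lm_slide_cup i b o : local_move
      [:: Cup i b; Cross i.+1 o] [:: Cup i.+1 b; Cross i (~~ o)]
  | lm_slide_cap i o : local_move
      [:: Cross i.+1 o; Cap i] [:: Cross i (~~ o); Cap i.+1]
  | lm_R1_left i b o : local_move [:: Cup i b; Cross i.+1 o; Cap i] [::]
  | lm_R1_right i b o : local_move [:: Cup i.+1 b; Cross i o; Cap i.+1] [::]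
  | lm_R2 i o : local_move [:: Cross i o; Cross i (~~ o)] [::]
  (* the condition says that the three strands are at three heights *)
  | lm_R3 i o1 o2 o3 : ~~ ((o1 == o3) && (o1 != o2)) -> local_move
      [:: Cross i o1; Cross i.+1 o2; Cross i o3]
      [:: Cross i.+1 o3; Cross i o2; Cross i.+1 o1].

(** [antipode m s] is what the slice [s], acting on [m] strands, becomes once
    pushed across the boundary circle: in the ball, the antipodal map sends a
    neighbourhood of the bottom side to a neighbourhood of the top side by a
    half-turn about the vertical axis of the page.  It reverses left and right
    and exchanges front and back, so the field [o] of a crossing is kept. *)
Definition antipode (m : nat) (s : slice) : slice :=
  match s with
  | Cup i b => Cup (m - i) (~~ b)
  | Cap i => Cap (m - i - 2)
  | Cross i o => Cross (m - i - 2) o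
  end.

Inductive raw_move : level * seq slice -> level * seq slice -> Prop :=
  | rm_local l w1 u v w2 : local_move u v ->
      raw_move (l, w1 ++ u ++ w2) (l, w1 ++ v ++ w2)
  (* isotopy of the disc: an endpoint on the bottom left is rotated to the top
     left, and its antipode from the top right to the bottom right *)
  | rm_rotate x l w :
      raw_move (x :: l, w)
               (rcons l (~~ x),
                Cup 0 (~~ x) :: rcons (map (slice_shift 1) w)
                                      (Cap (size (x :: l))))
  | rm_R4 l l' s w : is_cup s || is_cap s -> step s l = Some l' ->
      raw_move (l, s :: w) (l', rcons w (antipode (size l) s))
  | rm_R5 l l' s w : is_cross s -> step s l = Some l' ->
      raw_move (l, s :: w) (l', rcons w (antipode (size l) s)).

Definition move (D D' : diagram) : Prop :=
  raw_move (bottom D, word D) (bottom D', word D').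

(** Two diagrams represent the same link in RP^3. *)
Definition same_link : diagram -> diagram -> Prop :=
  clos_refl_sym_trans diagram move.

(** * Crossings and smoothings *)

Section Cube.
Variable D : diagram.

Definition slice_at (t : nat) : slice := nth (Cap 0) (word D) t.

(** The level just below the slice [t]. *)
Definition level_at (t : nat) : level :=
  odflt [::] (run (take t (word D)) (bottom D)).

Lemma run_cat w1 w2 l : run (w1 ++ w2) l = obind (run w2) (run w1 l).
Proof.
rewrite /run foldl_cat; case: (foldl _ _ w1) => //=.
by elim: w2 => //= s w2.
Qed.

Lemma step_at t : (t < size (word D))%N ->
  step (slice_at t) (level_at t) = Some (level_at t.+1).
Proof.
move=> lt_t; have := diagramP D.
rewrite -[in run _](cat_take_drop t.+1 (word D)) run_cat.
rewrite /level_at (take_nth (Cap 0)) // -cats1 run_cat -/(slice_at t).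
case: (run (take t _) _) => //= l.
by rewrite /run /=; case: (step _ l).
Qed.

Definition crossing : finType :=
  {t : 'I_(size (word D)) | is_cross (slice_at t)}.

Definition crossing_slice (c : crossing) : slice := slice_at (val c).

Lemma crossing_bounds (c : crossing) :
  ((pos (crossing_slice c)).+1 < size (level_at (val c)))%N /\
  size (level_at (val c).+1) = size (level_at (val c)).
Proof.
rewrite /crossing_slice; case: c => t /= tX; have := step_at (ltn_ord t).
case: (slice_at t) tX => //= i o _.
case E: (drop i _) => [|x [|y r]] //= [<-].
have lt_i : (i.+1 < size (level_at t))%N.
  by rewrite -subn_gt0 subnS -size_drop E.
split=> //; rewrite -[in RHS](cat_take_drop i (level_at t)) E !size_cat.
by [].
Qed.

(** The two strands of a crossing are parallel if both point up or both point
    down.  The sign is given by the right-hand rule. *)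
Definition parallel (t : nat) : bool :=
  let l := level_at t in let p := pos (slice_at t) in
  nth true l p == nth true l p.+1.

Definition positive (t : nat) : bool := over (slice_at t) == parallel t.

Definition n_minus : nat := #|[set c : crossing | ~~ positive (val c)]|.

Definition smoothing : finType := {ffun crossing -> bool}.

(** The [r]-resolution is the oriented one if [r = 0] at a positive crossing
    and if [r = 1] at a negative one.  The oriented resolution consists of two
    vertical arcs if the strands are parallel, and otherwise of a cap below a
    cup; the other resolution is of the other type. *)
Definition oriented_res (t : nat) (r : bool) : bool := r == ~~ positive t.
Definition vertical_res (t : nat) (r : bool) : bool :=
  oriented_res t r == parallel t.

Definition resolution (a : smoothing) (t : 'I_(size (word D))) : bool :=
  oapp a false (insub t).

Definition height (a : smoothing) : int :=
  #|[set c | a c]|%:Z - n_minus%:Z.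

(** The intersections of the diagram with the horizontal levels.  A smoothing
    joins them by arcs, and its circles are the connected components. *)
Definition node : finType :=
  {t : 'I_(size (word D)).+1 & 'I_(size (level_at t))}.

Definition node_coord (u : node) : nat * nat :=
  (nat_of_ord (tag u), nat_of_ord (tagged u)).

(** The arcs of the slice [t], the crossings being smoothed vertically or
    horizontally according to [vert]. *)
Definition slice_arc (t : nat) (vert : bool) (u v : nat * nat) : bool :=
  let s := slice_at t in
  let p := pos s in
  let cap := is_cap s || is_cross s && ~~ vert in
  let cup := is_cup s || is_cross s && ~~ vert in
  [|| [&& u.1 == t, v.1 == t.+1 &
        [|| (u.2 < p)%N && (v.2 == u.2),
            (p + n_in s <= u.2)%N && (v.2 + n_in s == u.2 + n_out s)%N |
            [&& is_cross s, vert, v.2 == u.2 & u.2 \in [:: p; p.+1]]]],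
      [&& cap, u == (t, p) & v == (t, p.+1)] |
      [&& cup, u == (t.+1, p) & v == (t.+1, p.+1)]].

Definition boundary_arc (u v : nat * nat) : bool :=
  [&& u.1 == size (word D), v.1 == 0%N &
      (u.2 + v.2).+1 == size (bottom D)].

Definition arc (a : smoothing) (u v : node) : bool :=
  boundary_arc (node_coord u) (node_coord v) ||
  [exists t : 'I_(size (word D)), slice_arc t (vertical_res t (resolution a t))
                         (node_coord u) (node_coord v)].

Definition component (a : smoothing) (u : node) : {set node} :=
  [set v | connect (fun x y => arc a x y || arc a y x) u v].

Definition circles (a : smoothing) : {set {set node}} :=
  [set component a u | u : node].

Definition circle (a : smoothing) : finType :=
  {C : {set node} | C \in circles a}.

Lemma component_circle a u : component a u \in circles a.
Proof. exact: imset_f. Qed.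

Definition circle_of (a : smoothing) (u : node) : circle a :=
  exist _ (component a u) (component_circle a u).

(** The bottom left and top right corners of a crossing: whichever the
    resolution, they lie on distinct arcs of it, so the circles of a smoothing
    that run through the crossing are those of these two nodes. *)
Lemma sw_subproof (c : crossing) :
  (pos (crossing_slice c) <
   size (level_at (widen_ord (leqnSn _) (val c) : 'I_(size (word D)).+1)))%N.
Proof. by case: (crossing_bounds c) => /ltnW. Qed.

Lemma ne_subproof (c : crossing) :
  ((pos (crossing_slice c)).+1 <
   size (level_at (lift ord0 (val c) : 'I_(size (word D)).+1)))%N.
Proof. by rewrite lift0; case: (crossing_bounds c) => ? ->. Qed.

Definition sw (c : crossing) : node := existT _ _ (Ordinal (sw_subproof c)).
Definition ne (c : crossing) : node := existT _ _ (Ordinal (ne_subproof c)).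

(** An edge of the cube is a smoothing [a] with a crossing [c] such that
    [a c = 0]; it goes to [flip a c]. *)
Definition flip (a : smoothing) (c : crossing) : smoothing :=
  [ffun c' => if c' == c then ~~ a c' else a c'].

(** [e a c] tells whether the edge [(a, c)] carries a minus sign. *)
Definition sign_convention (e : smoothing -> crossing -> bool) : Prop :=
  forall (a : smoothing) (c c' : crossing), c != c' -> ~~ a c -> ~~ a c' ->
    e a c (+) e (flip a c) c' (+) e a c' (+) e (flip a c') c.

Lemma sign_convention_exists : exists e, sign_convention e.
Proof.
exists (fun (a : smoothing) (c : crossing) =>
  odd #|[set d | a d & (val d < val c)%N]|).
move=> a c c' neq_cc' ac ac'.
have flipE x y : ~~ a x ->
    odd #|[set d | flip a x d & (val d < val y)%N]| =
    (val x < val y)%N (+) odd #|[set d | a d & (val d < val y)%N]|.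
  move=> ax; rewrite (cardsD1 x) inE ffunE eqxx ax /= oddD oddb.
  congr (_ (+) odd _).
  apply: eq_card => d; rewrite !inE ffunE.
  by case: eqP => [->|//]; rewrite (negPf ax).
rewrite !flipE //.
have : val c != val c' by rewrite (inj_eq val_inj).
rewrite -(inj_eq val_inj) /= neq_ltn.
case: ltngtP => //= _ _; by do 2!case: (odd _).
Qed.

End Cube.

(** * The algebra

    [plus] and [minus] are the subscripts of v_+ and v_-; [upper] and [lower]
    are the superscripts of the unshifted and of the shifted copies. *)

Notation plus := true (only parsing).
Notation minus := false (only parsing).
Notation upper := true (only parsing).
Notation lower := false (only parsing).

Section Coefficients.
Variable R : comPzRingType.

(** Coefficient of v_z in m'(v_xy). *)
Definition m_coef (x y z : bool) : R :=
  match x, y, z with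
  | plus, plus, plus => 1
  | plus, minus, minus => 1
  | minus, plus, minus => 1
  | minus, minus, plus => 1
  | _, _, _ => 0
  end.

(** Coefficient of v_yz in Delta'(v_x). *)
Definition delta_coef (x y z : bool) : R :=
  match x, y, z with
  | plus, plus, minus => 1
  | plus, minus, plus => 1
  | minus, minus, minus => 1
  | minus, plus, plus => 1
  | _, _, _ => 0
  end.

(** Coefficient of v^q_y in eta'(v^p_x). *)
Definition eta_coef (p x q y : bool) : R :=
  match p, x, q, y with
  | upper, plus, lower, plus => 1
  | lower, plus, upper, minus => 2%:R
  | upper, minus, lower, minus => 1
  | lower, minus, upper, plus => 2%:R
  | _, _, _, _ => 0
  end.

End Coefficients.

(** * Cochain complexes and homotopy equivalence *)

(** A graded module with an endomorphism of degree one. *)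
Record precomplex (R : comPzRingType) := Precomplex {
  obj : int -> lmodType R;
  dif : forall i, {linear obj i -> obj (i + 1)}
}.

Section Homotopy.
Variable R : comPzRingType.

Definition is_complex (C : precomplex R) : Prop :=
  forall i (x : obj C i), dif C (i + 1) (dif C i x) = 0.

Definition chain_map (C E : precomplex R)
    (f : forall i, {linear obj C i -> obj E i}) : Prop :=
  forall i (x : obj C i), f (i + 1) (dif C i x) = dif E i (f i x).

(** As [i] ranges over all integers, so does the degree [i + 1]. *)
Definition homotopic (C E : precomplex R)
    (f g : forall i, obj C i -> obj E i) : Prop :=
  exists h : forall i, {linear obj C (i + 1) -> obj E i},
    forall i (x : obj C (i + 1)),
      f (i + 1) x - g (i + 1) x =
      dif E i (h i x) + h (i + 1) (dif C (i + 1) x).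

Definition homotopy_equivalent (C E : precomplex R) : Prop :=
  exists (f : forall i, {linear obj C i -> obj E i})
         (g : forall i, {linear obj E i -> obj C i}),
    [/\ chain_map f, chain_map g,
        @homotopic C C (fun i x => g i (f i x)) (fun i x => x) &
        @homotopic E E (fun i x => f i (g i x)) (fun i x => x)].

End Homotopy.

(** * The complex *)

Section CDKh.
Variables (R : comPzRingType) (D : diagram).

(** The basis of A^k attached to a smoothing: a superscript for the whole
    string and a subscript for each circle. *)
Definition string (a : smoothing D) : finType :=
  (bool * {ffun circle a -> bool})%type.

Definition state : finType := {a : smoothing D & string a}.

Definition superscript (x : state) : bool := (tagged x).1.
Definition subscript (x : state) (u : node D) : bool :=
  (tagged x).2 (circle_of (tag x) u).

(** [x] and [y] carry the same subscripts on the circles that do not run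
    through the crossing [c]. *)
Definition agree_away (c : crossing D) (x y : state) : bool :=
  [forall u, (circle_of (tag x) u != circle_of (tag x) (sw c)) ==>
             (circle_of (tag x) u != circle_of (tag x) (ne c)) ==>
             (subscript x u == subscript y u)].

(** The matrix entry from [x] to [y] of the map of the edge from [tag x] to
    [tag y] at [c]. *)
Definition edge_coef (c : crossing D) (x y : state) : R :=
  if ~~ agree_away c x y then 0
  else if circle_of (tag x) (sw c) != circle_of (tag x) (ne c) then
    (superscript x == superscript y)%:R *
    m_coef R (subscript x (sw c)) (subscript x (ne c)) (subscript y (sw c))
  else if circle_of (tag y) (sw c) != circle_of (tag y) (ne c) then
    (superscript x == superscript y)%:R *
    delta_coef R (subscript x (sw c)) (subscript y (sw c)) (subscript y (ne c))
  else eta_coef R (superscript x) (subscript x (sw c))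
                  (superscript y) (subscript y (sw c)).

Variable e : smoothing D -> crossing D -> bool.

Definition dif_coef (x y : state) : R :=
  \sum_(c | ~~ tag x c && (tag y == flip (tag x) c))
    (-1) ^+ e (tag x) c * edge_coef c x y.

Definition basis (i : int) : finType := {x : state | height (tag x) == i}.

Definition chains (i : int) : lmodType R := {ffun basis i -> R^o}.

Definition CDKh_dif (i : int) (f : chains i) : chains (i + 1) :=
  [ffun y => \sum_x dif_coef (val x) (val y) * f x].

Lemma CDKh_dif_linear i : linear (@CDKh_dif i).
Proof.
move=> k f g; apply/ffunP => y; rewrite !ffunE scaler_sumr -big_split /=.
apply: eq_bigr => x _; rewrite !ffunE mulrDr; congr (_ + _).
exact: mulrCA.
Qed.

HB.instance Definition _ i :=
  GRing.isLinear.Build R (chains i) (chains (i + 1)) _ (@CDKh_dif i)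
    (@CDKh_dif_linear i).

Definition CDKh' : precomplex R :=
  Precomplex (fun i => @CDKh_dif i : {linear chains i -> chains (i + 1)}).

End CDKh.

(* Main.v *)
From HB Require Import structures.
From mathcomp Require Import all_boot all_order all_algebra.
From mathcomp Require Import zify.
Require Import Defs.

(** Write v_+ = 1 and v_- = x. Then m' is the product of the algebra A =
    R[x]/(x^2 - 1), Delta' is the A-linear map sending 1 to x # 1 + 1 # x
    (with # for the tensor product), and eta' is the identity from the
    unshifted to the shifted copy and multiplication by 2x back. Since 2 is
    invertible, A splits as R x R along the two characters x = 1 and x = -1,
    so the module of a smoothing has a second basis, indexed by a superscript
    and a colouring of the circles by signs. In this basis every edge map
    preserves colours: it sends a colouring to the same colouring of the
    flipped smoothing if the circles through the crossing have the same colour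
    k, and to 0 otherwise, and the coefficient is a unit: 1 for a merge, 2k
    for a split, and 1 or 2k for a Moebius band, which also exchanges the
    superscripts ([edge_sumE], [intertwining]).

    So the complex splits into cubes, one direction for each crossing that the
    colouring leaves monochrome. It is a complex because the faces of these
    cubes commute before the signs are added ([edge_unitC]). If the two
    crossings of a face carry the same colour, the powers of 2k agree because
    their exponent is determined by the ends of a path ([weight_expE]); if
    they carry different colours, neither flip changes the type of the other
    edge, the only danger being a pair of Moebius bands. There a circle runs
    through each of the two crossings, and going straight through the crossing
    yields a closed curve which is one-sided ([virtual_curve_odd]); two
    one-sided curves in the projective plane intersect, so both crossings lie
    on one circle and have one colour after all ([no_two_mobius]).

    A cube with unit coefficients and at least one direction is contractible.
    Only the colourings without monochrome crossing survive, and the complex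
    is homotopy equivalent to the complex with zero differential that they
    span ([CDKh_complex_contraction]). Invariance thus amounts to counting
    these alternating colourings in each degree. An alternating colouring is a
    colouring of the strands of the diagram that changes sign whenever a
    strand passes a crossing: the smoothing can be read off, as the resolution
    at a crossing must join equal colours. Such colourings are propagated
    slice by slice along the word of the diagram, and both their number and
    their height are unchanged by each move ([colour_count_move]), by a finite
    check for the moves inside the disc and by the symmetry of the rules under
    a half-turn for those across the boundary circle. Hence the complexes of
    two diagrams of a link contract to complexes with zero differential and
    equal ranks ([card_alternating], [zero_complexes_equivalent]). *)

Set Implicit Arguments.
Unset Strict Implicit.
Unset Printing Implicit Defensive.

Import Order.TTheory GRing.Theory Num.Theory.
Local Open Scope ring_scope.

(** * Homotopy equivalences of complexes given by matrices *)

Section Transitivity.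
Variable R : comPzRingType.

Lemma homotopy_equivalent_trans (C E F : precomplex R) :
  homotopy_equivalent C E -> homotopy_equivalent E F ->
  homotopy_equivalent C F.
Proof.
move=> [f1 [g1 [cf1 cg1 [h1 H1] [k1 K1]]]] [f2 [g2 [cf2 cg2 [h2 H2] [k2 K2]]]].
exists (fun i => f2 i \o f1 i : {linear _ -> _}).
exists (fun i => g1 i \o g2 i : {linear _ -> _}).
split.
- by move=> i x /=; rewrite cf1 cf2.
- by move=> i x /=; rewrite cg2 cg1.
- exists (fun i => h1 i \+ (g1 i \o h2 i \o f1 (i + 1)) : {linear _ -> _}).
  move=> i x /=; rewrite -[LHS](subrKA (g1 (i + 1) (f1 (i + 1) x))).
  rewrite -linearB H2 H1 !linearD cg1 cf1 /= addrACA.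
  by congr (_ + _); exact: addrC.
- exists (fun i => k2 i \+ (f2 i \o k1 i \o g2 (i + 1)) : {linear _ -> _}).
  move=> i x /=; rewrite -[LHS](subrKA (f2 (i + 1) (g2 (i + 1) x))).
  rewrite -linearB K1 K2 !linearD cf2 cg2 /= addrACA.
  by congr (_ + _); exact: addrC.
Qed.

Lemma homotopy_equivalent_sym (C E : precomplex R) :
  homotopy_equivalent C E -> homotopy_equivalent E C.
Proof. by move=> [f [g [cf cg H K]]]; exists g, f; split. Qed.

End Transitivity.

Section MatrixComplexes.
Variable R : comPzRingType.

Definition graded_ffun (X : finType) (hX : X -> int) (i : int) : lmodType R :=
  {ffun {x : X | hX x == i} -> R^o}.

Section Block.
Variables (X Y : finType) (hX : X -> int) (hY : Y -> int) (F : X -> Y -> R).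

(** The two degrees are unrelated, so that composites in degrees such as [i +
    1 - 1] need no transport. *)
Definition block (i j : int) (f : graded_ffun hX i) : graded_ffun hY j :=
  [ffun y => \sum_x F (val x) (val y) * f x].

Lemma block_linear i j : linear (@block i j).
Proof.
move=> k f g; apply/ffunP => y; rewrite !ffunE scaler_sumr -big_split /=.
apply: eq_bigr => x _; rewrite !ffunE mulrDr; congr (_ + _).
exact: mulrCA.
Qed.

HB.instance Definition _ i j :=
  GRing.isLinear.Build R (graded_ffun hX i) (graded_ffun hY j) _ (@block i j)
    (@block_linear i j).

Definition blockl i j : {linear graded_ffun hX i -> graded_ffun hY j} :=
  @block i j.

End Block.

Definition degree (X Y : finType) (hX : X -> int) (hY : Y -> int) (n : int)
  (F : X -> Y -> R) := forall x y, hY y != hX x + n -> F x y = 0.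

(** [F x y] is the coefficient of [y] in the image of [x], so the map applied
    first stands on the left. *)
Definition matmul (X Y Z : finType) (F : X -> Y -> R) (G : Y -> Z -> R) x z : R :=
  \sum_y F x y * G y z.

(** Composition of blocks sums over the basis elements of one degree, the
    product of matrices over all of them; the others contribute 0 since [F] is
    homogeneous. *)
Lemma block_comp (X Y Z : finType) (hX : X -> int) (hY : Y -> int)
    (hZ : Z -> int) n (F : X -> Y -> R) (G : Y -> Z -> R) i j l f :
  degree hX hY n F -> j = i + n ->
  @block _ _ hY hZ G j l (@block _ _ hX hY F i j f) =
  @block _ _ hX hZ (matmul F G) i l f.
Proof.
move=> dF ->; apply/ffunP => z; rewrite !ffunE.
under eq_bigr do rewrite ffunE mulr_sumr.
rewrite exchange_big /=; apply: eq_bigr => x _.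
rewrite /matmul mulr_suml.
rewrite -(big_sub (fun y => hY y == i + n)
            (fun y => G y (val z) * (F (val x) y * f x))) /=.
rewrite big_mkcond /=; apply: eq_bigr => y _.
case: ifP => [_|/negbT hy]; first by rewrite mulrA [G _ _ * _]mulrC.
by rewrite dF ?mul0r // (eqP (valP x)).
Qed.

Arguments block_comp [X Y Z hX hY hZ n F G i j l f].

Lemma eq_block (X Y : finType) (hX : X -> int) (hY : Y -> int)
    (F G : X -> Y -> R) i j f :
  F =2 G -> @block _ _ hX hY F i j f = @block _ _ hX hY G i j f.
Proof.
by move=> eqFG; apply/ffunP => y; rewrite !ffunE; under eq_bigr do rewrite eqFG.
Qed.

Arguments eq_block [X Y hX hY F G i j f].

Lemma block1 (X : finType) (hX : X -> int) i (f : graded_ffun hX i) :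
  block hX (fun x y => (x == y)%:R) i f = f.
Proof.
apply/ffunP => y; rewrite !ffunE (bigD1 y) //= eqxx mul1r big1 ?addr0 // => x.
by move=> /negPf neq; rewrite (inj_eq val_inj) neq mul0r.
Qed.

Lemma blockD (X Y : finType) (hX : X -> int) (hY : Y -> int)
    (F G : X -> Y -> R) i j f :
  @block _ _ hX hY (fun x y => F x y + G x y) i j f =
  @block _ _ hX hY F i j f + @block _ _ hX hY G i j f.
Proof.
by apply/ffunP => y; rewrite !ffunE -big_split; apply: eq_bigr => x _; rewrite mulrDl.
Qed.

Section Matrices.
Variables (X Y : finType) (hX : X -> int) (hY : Y -> int).
Variables (M : X -> X -> R) (N : Y -> Y -> R).
Variable dX : forall i, {linear graded_ffun hX i -> graded_ffun hX (i + 1)}.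
Variable dY : forall i, {linear graded_ffun hY i -> graded_ffun hY (i + 1)}.
Hypothesis dXE : forall i f, dX i f = block hX M (i + 1) f.
Hypothesis dYE : forall i f, dY i f = block hY N (i + 1) f.
Hypothesis dM : degree hX hX 1 M.
Hypothesis dN : degree hY hY 1 N.

Lemma is_complex_matrix : (forall x y, matmul M M x y = 0) ->
  is_complex (Precomplex dX).
Proof.
move=> MM i f /=; rewrite !dXE (block_comp dM) // (eq_block MM).
by apply/ffunP => y; rewrite !ffunE big1 // => x _; rewrite mul0r.
Qed.

Variables (F : X -> Y -> R) (G : Y -> X -> R) (H : X -> X -> R) (K : Y -> Y -> R).
Hypothesis dF : degree hX hY 0 F.
Hypothesis dG : degree hY hX 0 G.
Hypothesis dH : degree hX hX (-1) H.
Hypothesis dK : degree hY hY (-1) K.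

(** Homogeneity cuts an identity between matrices into one identity in each
    degree, so chain homotopies can be checked on matrices indexed by the
    bases of all degrees together. *)
Lemma homotopy_equivalent_matrix :
  matmul M F =2 matmul F N -> matmul N G =2 matmul G M ->
  (forall x y, matmul F G x y = (x == y)%:R + (matmul H M x y + matmul M H x y)) ->
  (forall x y, matmul G F x y = (x == y)%:R + (matmul K N x y + matmul N K x y)) ->
  homotopy_equivalent (Precomplex dX) (Precomplex dY).
Proof.
move=> MF NG FG GF.
exists (fun i => blockl hX hY F i i), (fun i => blockl hY hX G i i).
split=> /=.
- move=> i f; rewrite /blockl /= dXE dYE (block_comp dM) //.
  by rewrite (block_comp dF) ?addr0 // (eq_block MF).
- move=> i f; rewrite /blockl /= dXE dYE (block_comp dN) //.
  by rewrite (block_comp dG) ?addr0 // (eq_block NG).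
- exists (fun i => blockl hX hX H (i + 1) i) => i f.
  rewrite /blockl /= !dXE (block_comp dF) ?addr0 //.
  rewrite (block_comp dH) ?addrK // (block_comp dM) //.
  by rewrite (eq_block FG) !blockD block1 [X in X - _]addrC (addrK (f :
    graded_ffun _ _)).
- exists (fun i => blockl hY hY K (i + 1) i) => i f.
  rewrite /blockl /= !dYE (block_comp dG) ?addr0 //.
  rewrite (block_comp dK) ?addrK // (block_comp dN) //.
  by rewrite (eq_block GF) !blockD block1 [X in X - _]addrC (addrK (f :
    graded_ffun _ _)).
Qed.

End Matrices.

End MatrixComplexes.

Section MatrixAlgebra.
Variable R : comPzRingType.

Lemma matmulA (X Y Z W : finType) (F : X -> Y -> R) (G : Y -> Z -> R) (H : Z ->
  W -> R) :
  matmul (matmul F G) H =2 matmul F (matmul G H).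
Proof.
move=> x w; rewrite /matmul.
under eq_bigr do rewrite mulr_suml.
rewrite exchange_big /=; apply: eq_bigr => y _.
by rewrite mulr_sumr; apply: eq_bigr => z _; rewrite mulrA.
Qed.

Lemma eq_matmul (X Y Z : finType) (F F' : X -> Y -> R) (G G' : Y -> Z -> R) :
  F =2 F' -> G =2 G' -> matmul F G =2 matmul F' G'.
Proof. by move=> eF eG x z; apply: eq_bigr => y _; rewrite eF eG. Qed.

Lemma matmul1l (X Y : finType) (F : X -> Y -> R) :
  matmul (fun x y => (x == y)%:R) F =2 F.
Proof.
move=> x y; rewrite /matmul (bigD1 x) //= eqxx mul1r big1 ?addr0 // => z.
by rewrite eq_sym => /negPf->; rewrite mul0r.
Qed.

Lemma matmul1r (X Y : finType) (F : X -> Y -> R) :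
  matmul F (fun x y => (x == y)%:R) =2 F.
Proof.
move=> x y; rewrite /matmul (bigD1 y) //= eqxx mulr1 big1 ?addr0 // => z.
by move=> /negPf->; rewrite mulr0.
Qed.

Lemma degree_matmul (X Y Z : finType) (hX : X -> int) (hY : Y -> int) (hZ : Z -> int)
    n m (F : X -> Y -> R) (G : Y -> Z -> R) :
  degree hX hY n F -> degree hY hZ m G -> degree hX hZ (n + m) (matmul F G).
Proof.
move=> dF dG x z hz; rewrite /matmul big1 // => y _.
have [hy|hy] := eqVneq (hY y) (hX x + n); last by rewrite dF ?mul0r.
by rewrite dG ?mulr0 // hy -addrA.
Qed.

Hypothesis two_invertible : exists half : R, 2%:R * half = 1.

Lemma eq_opp_0 (S : R) : S = - S -> S = 0.
Proof.
case: two_invertible => half H eqS; rewrite -[S]mul1r -H [_ * half]mulrC -mulrA.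
by rewrite mulr_natl mulr2n {2}eqS addrN mulr0.
Qed.

End MatrixAlgebra.

(** * Contraction of a union of cubes with unit coefficients *)

(** An abstract union of cubes. The set [X] is a basis, [set_at x] gives the
    coordinates of [x], and an edge leaves [x] in each direction [c] that is
    free at [x] and in which [x] has coordinate 0. As the free directions do
    not change along an edge, the component of [x] is a cube, whose dimension
    is the number of directions free at [x]. *)
Section Matching.
Variables (R : comPzRingType) (X C : finType).
Hypothesis two_invertible : exists half : R, 2%:R * half = 1.
Variables (set_at : X -> C -> bool) (free : C -> X -> bool) (next : C -> X -> X).
Variables (coef icoef : C -> X -> R).
Implicit Types (x y z : X) (c d : C).

Hypothesis set_next : forall c x, free c x -> ~~ set_at x c -> set_at (next c x) c.
Hypothesis set_next_neq : forall c d x, free c x -> d != c ->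
  set_at (next c x) d = set_at x d.
Hypothesis free_next : forall c d x, free c x -> free d (next c x) = free d x.
Hypothesis nextC : forall c d x, free c x -> free d x ->
  next d (next c x) = next c (next d x).
Hypothesis next_inj : forall c x y, free c x -> free c y ->
  ~~ set_at x c -> ~~ set_at y c -> next c x = next c y -> x = y.
Hypothesis next_surj : forall c x, free c x -> set_at x c ->
  exists x0, [/\ free c x0, ~~ set_at x0 c & next c x0 = x].
Hypothesis coef_inv : forall c x, coef c x * icoef c x = 1.
Hypothesis coefC : forall c d x, c != d -> free c x -> free d x ->
  ~~ set_at x c -> ~~ set_at x d ->
  coef c x * coef d (next c x) = - (coef d x * coef c (next d x)).

Definition matching_dif x z : R :=
  \sum_(c | ~~ set_at x c && free c x) (z == next c x)%:R * coef c x.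

Lemma matmul_matching (Y : finType) (F : X -> Y -> R) x (z : Y) :
  matmul matching_dif F x z =
  \sum_(c | ~~ set_at x c && free c x) coef c x * F (next c x) z.
Proof.
rewrite /matmul /matching_dif; under eq_bigr do rewrite mulr_suml.
rewrite exchange_big /=; apply: eq_bigr => c _.
rewrite (bigD1 (next c x)) //= eqxx mul1r big1 ?addr0 // => y /negPf->.
by rewrite !mul0r.
Qed.

(** Each two-step path turns a free direction [c] and then a free direction
    [d]; exchanging them gives the same end with the opposite coefficient, so
    the entry [S] satisfies [S = - S]. *)
Lemma matching_dif_square x z : matmul matching_dif matching_dif x z = 0.
Proof.
apply: eq_opp_0 => //; rewrite matmul_matching.
pose T c d : R := if [&& c != d, ~~ set_at x c, free c x, ~~ set_at x d & free d x]
  then (z == next d (next c x))%:R * (coef c x * coef d (next c x)) else 0.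
have -> : \sum_(c | ~~ set_at x c && free c x) coef c x * matching_dif (next c x) z =
    \sum_c \sum_d T c d.
  rewrite big_mkcond; apply: eq_bigr => c _; rewrite /matching_dif /T.
  case: ifP => [/andP[tc fc]|]; last first.
    by move=> nc; rewrite big1 // => d _; case: ifP => // /and5P[_ h1 h2];
      rewrite h1 h2 in nc.
  rewrite mulr_sumr big_mkcond /=; apply: eq_bigr => d _.
  rewrite free_next // tc fc /=.
  have [<-|neq] := eqVneq c d; first by rewrite set_next.
  rewrite set_next_neq 1?eq_sym //=.
  by case: ifP => // _; rewrite mulrCA.
(* the sum over (c, d) is the opposite of the sum over (d, c) *)
rewrite {1}exchange_big -sumrN; apply: eq_bigr => c _ /=.
rewrite -sumrN; apply: eq_bigr => d _; rewrite /T.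
case: (boolP [&& _, _, _, _ & _]) => [/and5P[n h1 h2 h3 h4]|h].
  by rewrite [c == d]eq_sym n h1 h2 h3 h4 /= nextC // coefC // mulrN.
rewrite ifF ?oppr0 //; apply: contraNF h => /and5P[n -> -> -> ->].
by rewrite [d == c]eq_sym n.
Qed.

(** The direction along which a cube is contracted. It depends on the cube
    only ([pivot_next]), because the free directions do. *)
Definition pivot x : option C := [pick c | free c x].

Lemma pivot_next c x : free c x -> pivot (next c x) = pivot x.
Proof. by move=> fc; apply: eq_pick => d; apply: free_next. Qed.

Lemma pivot_free c x : pivot x = Some c -> free c x.
Proof. by rewrite /pivot; case: pickP => // d fd [<-]. Qed.

Definition matching_hty x y : R :=
  if pivot y is Some c then (~~ set_at y c && (x == next c y))%:R * icoef c y
  else 0.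

Lemma matching_hty_neq0 x y : matching_hty x y = 0 \/ exists c,
  [/\ pivot x = Some c, pivot y = Some c, free c y, ~~ set_at y c & x = next c y].
Proof.
rewrite /matching_hty; case Ey: (pivot y) => [c|]; last by left.
case: (boolP (_ && _)) => [/andP[ty /eqP xy]|_]; last by left; rewrite mul0r.
have fy := pivot_free Ey.
by right; exists c; split=> //; rewrite xy pivot_next.
Qed.

Lemma matching_hty_next c x : pivot x = Some c -> ~~ set_at x c ->
  forall z, matching_hty (next c x) z = (x == z)%:R * icoef c x.
Proof.
move=> px tx z; have fx := pivot_free px.
have [<-|neq] := eqVneq x z; first by rewrite /matching_hty px tx eqxx.
have [->|[d [p1 p2 fz tz eqn]]] := matching_hty_neq0 (next c x) z;
  first by rewrite mul0r.
case/eqP: neq; move: p1; rewrite pivot_next // px => -[eq_cd].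
by subst d; apply: next_inj eqn.
Qed.

(** Going back along the pivot edge is a homotopy between the identity and the
    projection onto the elements without free direction: at either end of a
    pivot edge one composite contributes 1, and the remaining terms cancel
    since the faces anticommute. *)
Lemma matching_contraction x z :
  matmul matching_hty matching_dif x z + matmul matching_dif matching_hty x z =
    (x == z)%:R - (x == z)%:R * (pivot x == None)%:R.
Proof.
rewrite matmul_matching; case px: (pivot x) => [c0|]; last first.
  rewrite mulr1 subrr /matmul !big1 ?addr0 // => [c /andP[_ fc]|y _].
    by move: px; rewrite /pivot; case: pickP => // /(_ c); rewrite fc.
  by have [->|[d []]] := matching_hty_neq0 x y; rewrite ?mul0r // px.
rewrite mulr0 subr0; have fx := pivot_free px.
(* two cases: x is the end, or the origin, of its pivot edge *)
have [tx|tx] := boolP (set_at x c0); last first.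
  rewrite /matmul big1 => [|y _]; last first.
    have [->|[d []]] := matching_hty_neq0 x y;
      rewrite ?mul0r // px => -[<-] _ fy ty eq_x.
    by rewrite eq_x set_next in tx.
  rewrite add0r (bigD1 c0) ?tx //= matching_hty_next // mulrCA coef_inv mulr1.
  rewrite big1 ?addr0 // => c /andP[/andP[tc fc] neq].
  have [->|[d []]] := matching_hty_neq0 (next c x) z; first by rewrite mulr0.
  rewrite pivot_next // px => -[<-] _ fz tz eqn.
  by have := set_next fz tz; rewrite -eqn set_next_neq 1?eq_sym // (negPf tx).
(* x0 is the origin of the pivot edge that ends at x *)
have [x0 [fx0 tx0 defx]] := next_surj fx tx.
have px0 : pivot x0 = Some c0 by rewrite -px -defx pivot_next.
have -> : matmul matching_hty matching_dif x z = icoef c0 x0 * matching_dif x0 z.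
  rewrite /matmul (bigD1 x0) //= -{1}defx matching_hty_next // eqxx mul1r big1
    ?addr0 // => y neq.
  by rewrite -defx matching_hty_next // eq_sym (negPf neq) !mul0r.
rewrite /matching_dif (bigD1 c0) ?tx0 //= mulrDr defx mulrCA mulrC [icoef _ _ *
  coef _ _]mulrC.
rewrite coef_inv mul1r [z == x]eq_sym -addrA mulr_sumr.
rewrite [X in _ + (_ + X)](eq_bigl (fun c => (~~ set_at x0 c && free c x0) &&
  (c != c0))).
  rewrite -big_split big1 /= ?addr0 // => c /andP[/andP[tc fc] neq].
  have fc' : free c0 (next c x0) by rewrite free_next.
  have tc' : ~~ set_at (next c x0) c0 by rewrite set_next_neq 1?eq_sym.
  rewrite -defx nextC // matching_hty_next ?pivot_next // eq_sym.
  (* the two paths around the face of c and c0 at x0 cancel *)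
  have := coefC neq fc fx0 tc tx0 => eqC.
  case: eqP => _; last by rewrite !mul0r !mulr0 addr0.
  rewrite !mul1r.
  have -> : icoef c0 x0 * coef c x0 =
      (coef c x0 * coef c0 (next c x0)) * (icoef c0 x0 * icoef c0 (next c x0)).
    by rewrite mulrACA coef_inv mulr1 mulrC.
  by rewrite eqC mulNr mulrACA coef_inv mul1r addNr.
move=> c; have [->|neq] := eqVneq c c0; first by rewrite tx andbF.
by rewrite -defx set_next_neq // free_next // andbT.
Qed.

End Matching.

(** * Contraction after a change of basis *)

Section MatrixLinear.
Variable R : comPzRingType.

Lemma matmul0l (X Y Z : finType) (G : Y -> Z -> R) :
  matmul (fun (x : X) (y : Y) => 0) G =2 (fun x z => 0).
Proof. by move=> x z; rewrite /matmul big1 // => y _; rewrite mul0r. Qed.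

Lemma matmul0r (X Y Z : finType) (F : X -> Y -> R) :
  matmul F (fun (y : Y) (z : Z) => 0) =2 (fun x z => 0).
Proof. by move=> x z; rewrite /matmul big1 // => y _; rewrite mulr0. Qed.

Lemma matmulBl (X Y Z : finType) (F F' : X -> Y -> R) (G : Y -> Z -> R) x z :
  matmul (fun x y => F x y - F' x y) G x z = matmul F G x z - matmul F' G x z.
Proof. by rewrite /matmul -sumrB; apply: eq_bigr => y _; rewrite mulrBl. Qed.

Lemma matmulBr (X Y Z : finType) (F : X -> Y -> R) (G G' : Y -> Z -> R) x z :
  matmul F (fun x y => G x y - G' x y) x z = matmul F G x z - matmul F G' x z.
Proof. by rewrite /matmul -sumrB; apply: eq_bigr => y _; rewrite mulrBr. Qed.

Lemma matmulDl (X Y Z : finType) (F F' : X -> Y -> R) (G : Y -> Z -> R) x z :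
  matmul (fun x y => F x y + F' x y) G x z = matmul F G x z + matmul F' G x z.
Proof. by rewrite /matmul -big_split; apply: eq_bigr => y _; rewrite mulrDl. Qed.

Lemma matmulDr (X Y Z : finType) (F : X -> Y -> R) (G G' : Y -> Z -> R) x z :
  matmul F (fun x y => G x y + G' x y) x z = matmul F G x z + matmul F G' x z.
Proof. by rewrite /matmul -big_split; apply: eq_bigr => y _; rewrite mulrDr. Qed.

Lemma matmulNl (X Y Z : finType) (F : X -> Y -> R) (G : Y -> Z -> R) x z :
  matmul (fun x y => - F x y) G x z = - matmul F G x z.
Proof. by rewrite /matmul -sumrN; apply: eq_bigr => y _; rewrite mulNr. Qed.

Lemma matmulNr (X Y Z : finType) (F : X -> Y -> R) (G : Y -> Z -> R) x z :
  matmul F (fun x y => - G x y) x z = - matmul F G x z.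
Proof. by rewrite /matmul -sumrN; apply: eq_bigr => y _; rewrite mulrN. Qed.

End MatrixLinear.

(** [M] is the given differential, [dM] the differential in the new basis, [E]
    and [V] the mutually inverse changes of basis, and [hM] a contraction of
    [dM] onto the basis vectors that satisfy [survivor]. *)
Section ChangeOfBasis.
Variables (R : comPzRingType) (X : finType) (hX : X -> int) (survivor : pred X).
Variables (M E V dM hM : X -> X -> R).
Hypothesis EV : forall x y, matmul E V x y = (x == y)%:R.
Hypothesis VE : forall x y, matmul V E x y = (x == y)%:R.
Hypothesis ME : matmul M E =2 matmul E dM.
Hypothesis dM2 : forall x y, matmul dM dM x y = 0.
Hypothesis hdM : forall x y,
  matmul hM dM x y + matmul dM hM x y = (x == y)%:R - (x == y)%:R * (survivor x)%:R.
Hypothesis dM_survivor_l : forall x y, survivor x -> dM x y = 0.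
Hypothesis dM_survivor_r : forall x y, survivor y -> dM x y = 0.
Hypothesis degM : degree hX hX 1 M.
Hypothesis degE : degree hX hX 0 E.
Hypothesis degV : degree hX hX 0 V.
Hypothesis degh : degree hX hX (-1) hM.
Variable dX : forall i, {linear graded_ffun R hX i -> graded_ffun R hX (i + 1)}.
Hypothesis dXE : forall i f, dX i f = block hX M (i + 1) f.

Let G : finType := {x : X | survivor x}.
Let hG (g : G) : int := hX (val g).
Let N (g g' : G) : R := 0.

Lemma conj_inv_comm : matmul V M =2 matmul dM V.
Proof.
move=> x y.
have -> : matmul V M x y = matmul (matmul V M) (matmul E V) x y.
  by rewrite -[LHS](matmul1r (matmul V M)); apply: eq_matmul => // u v; rewrite EV.
rewrite -matmulA; apply: eq_matmul => // {y} u v.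
rewrite matmulA -[RHS](matmul1l dM); transitivity (matmul V (matmul E dM) u v).
  exact: eq_matmul.
by rewrite -matmulA; apply: eq_matmul => // {}u {}v; rewrite VE.
Qed.

Lemma conj_complex : is_complex (Precomplex dX).
Proof.
apply: (is_complex_matrix dXE degM) => x y.
rewrite -[LHS](matmul1r (matmul M M)).
transitivity (matmul (matmul M M) (matmul E V) x y); first by apply:
  eq_matmul => // u v; rewrite EV.
rewrite -matmulA; transitivity (matmul (fun _ _ => 0 : R) V x y); last exact: matmul0l.
apply: eq_matmul => // u v; rewrite matmulA.
transitivity (matmul M (matmul E dM) u v); first exact: eq_matmul.
rewrite -matmulA; transitivity (matmul (matmul E dM) dM u v); first exact: eq_matmul.
rewrite matmulA; transitivity (matmul E (fun _ _ => 0 : R) u v); last exact: matmul0r.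
exact: eq_matmul.
Qed.

Let P (x : X) (g : G) : R := (x == val g)%:R.
Let Q (g : G) (x : X) : R := (val g == x)%:R.

Lemma matmulP (Y : finType) (F : Y -> X -> R) y g : matmul F P y g = F y (val g).
Proof.
rewrite /matmul (bigD1 (val g)) //= /P eqxx mulr1 big1 ?addr0 // => x /negPf->.
by rewrite mulr0.
Qed.

Lemma matmulQ (Y : finType) (F : X -> Y -> R) g y : matmul Q F g y = F (val g) y.
Proof.
rewrite /matmul (bigD1 (val g)) //= /Q eqxx mul1r big1 ?addr0 // => x.
by rewrite eq_sym => /negPf->; rewrite mul0r.
Qed.

Lemma matmulPQ x y : matmul P Q x y = (x == y)%:R * (survivor x)%:R.
Proof.
rewrite /matmul /P /Q; case: (boolP (survivor x)) => gx; last first.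
  rewrite mulr0 big1 // => g _; case: eqP => [xg|_]; last by rewrite mul0r.
  by rewrite xg (valP g) in gx.
rewrite mulr1 (bigD1 (exist _ x gx : G)) //= eqxx mul1r big1 ?addr0 // => g.
by rewrite -val_eqE /= eq_sym => /negPf->; rewrite mul0r.
Qed.

(** The inclusion and projection of the surviving basis vectors, composed with
    the changes of basis, are chain maps because [dM] vanishes into and out of
    the survivors; the homotopy is, up to sign, the conjugate of [hM] by [E]. *)
Lemma conj_contraction : homotopy_equivalent (Precomplex dX)
  (Precomplex (fun i => blockl hG hG N i (i + 1))).
Proof.
pose F := matmul E P; pose W := matmul Q V.
pose H x y : R := - matmul (matmul E hM) V x y.
have degP : degree hX hG 0 P.
  by move=> x g hg; rewrite /P; case: eqP => // xg; rewrite xg addr0 eqxx in hg.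
have degQ : degree hG hX 0 Q.
  by move=> g x hg; rewrite /Q; case: eqP => // xg; rewrite -xg addr0 eqxx in hg.
have degN : degree hG hG 1 N by [].
have degF : degree hX hG 0 F by have := degree_matmul degE degP; rewrite addr0.
have degW : degree hG hX 0 W by have := degree_matmul degQ degV; rewrite addr0.
have degH : degree hX hX (-1) H.
  move=> x y hxy; rewrite /H.
  have dd := degree_matmul (degree_matmul degE degh) degV.
  by rewrite add0r addr0 in dd; rewrite dd ?oppr0.
have degK : degree hG hG (-1) N by [].
apply: (homotopy_equivalent_matrix dXE (fun i f => erefl) degM degN degF degW
  degH degK).
- move=> x g; rewrite matmul0r /F -matmulA matmulP ME /matmul big1 // => y _.
  by rewrite dM_survivor_r ?mulr0 // (valP g).
- move=> g x; rewrite matmul0l /W matmulA matmulQ conj_inv_comm /matmul big1 // => y _.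
  by rewrite dM_survivor_l ?mul0r // (valP g).
- move=> x y; rewrite /F /W matmulA.
  transitivity (matmul E (matmul (fun u v => (u == v)%:R - (matmul hM dM u v +
    matmul dM hM u v)) V) x y).
    apply: eq_matmul => // u v; rewrite -matmulA; apply: eq_matmul => // {}u {}v.
    by rewrite matmulPQ hdM opprB addrC subrK.
  transitivity (matmul E (fun u v => V u v - (matmul (matmul hM dM) V u v +
    matmul (matmul dM hM) V u v)) x y).
    by apply: eq_matmul => // u v; rewrite matmulBl matmul1l matmulDl.
  rewrite matmulBr EV matmulDr opprD; congr (_ + (_ + _)).
    rewrite /H matmulNl; congr (- _); transitivity (matmul E (matmul hM (matmul
      dM V)) x y).
      by apply: eq_matmul => // u v; exact: matmulA.
    rewrite (matmulA (matmul E hM) V M) (matmulA E hM (matmul V M)).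
    by apply: eq_matmul => // u v; apply: eq_matmul => // {}u {}v;
      rewrite conj_inv_comm.
  rewrite /H matmulNr; congr (- _); transitivity (matmul (matmul (matmul E dM)
    hM) V x y).
    rewrite (matmulA (matmul E dM) hM V) (matmulA E dM (matmul hM V)).
    by apply: eq_matmul => // u v; exact: matmulA.
  rewrite -(matmulA M (matmul E hM) V); apply: eq_matmul => // u v.
  by rewrite -(matmulA M E hM); apply: eq_matmul.
- move=> g g'; have -> : matmul N N g g' = 0 by exact: matmul0r.
  by rewrite /W /F -matmulA matmulP matmulA matmulQ VE !addr0 -val_eqE.
Qed.

End ChangeOfBasis.

(** * Complexes with zero differential *)

Section ZeroComplexes.
Variables (R : comPzRingType) (X Y : finType) (hX : X -> int) (hY : Y -> int).
Hypothesis eq_card : forall i, #|[set x | hX x == i]| = #|[set y | hY y == i]|.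

Let sX i := enum [set x | hX x == i].
Let sY i := enum [set y | hY y == i].

(** A bijection of the bases in each degree, read off their enumerations. *)
Let paired x y : bool :=
  (hX x == hY y) && (index x (sX (hX x)) == index y (sY (hY y))).

Let paired_injl x x' y : paired x y -> paired x' y -> x = x'.
Proof.
move=> /andP[/eqP h1 /eqP i1] /andP[/eqP h2 /eqP i2].
have mem z : z \in sX (hX z) by rewrite mem_enum inE.
rewrite -(nth_index x (mem x)) i1 -i2 h2 -h1 nth_index //.
by rewrite h1 -h2.
Qed.

Let paired_injr x y y' : paired x y -> paired x y' -> y = y'.
Proof.
move=> /andP[/eqP h1 /eqP i1] /andP[/eqP h2 /eqP i2].
have mem z : z \in sY (hY z) by rewrite mem_enum inE.
rewrite -(nth_index y (mem y)) -i1 i2 -h1 h2 nth_index //.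
Qed.

Let paired_surjl x : exists y, paired x y.
Proof.
have : (index x (sX (hX x)) < size (sY (hX x)))%N.
  by rewrite -cardE -eq_card cardE index_mem mem_enum inE.
case E: (sY (hX x)) => [|y0 r] // lt_i.
pose y := nth y0 (sY (hX x)) (index x (sX (hX x))).
have : y \in sY (hX x) by rewrite mem_nth // E.
rewrite mem_enum inE => /eqP hy; exists y; rewrite /paired hy eqxx /=.
by rewrite index_uniq ?E ?enum_uniq // -E enum_uniq.
Qed.

Let paired_surjr y : exists x, paired x y.
Proof.
have : (index y (sY (hY y)) < size (sX (hY y)))%N.
  by rewrite -cardE eq_card cardE index_mem mem_enum inE.
case E: (sX (hY y)) => [|x0 r] // lt_i.
pose x := nth x0 (sX (hY y)) (index y (sY (hY y))).
have : x \in sX (hY y) by rewrite mem_nth // E.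
rewrite mem_enum inE => /eqP hx; exists x; rewrite /paired hx eqxx /=.
by rewrite index_uniq ?E ?enum_uniq // -E enum_uniq.
Qed.

Lemma zero_complexes_equivalent : homotopy_equivalent
  (Precomplex (fun i => blockl hX hX (fun _ _ => 0 : R) i (i + 1)))
  (Precomplex (fun i => blockl hY hY (fun _ _ => 0 : R) i (i + 1))).
Proof.
pose F x y : R := (paired x y)%:R; pose G y x : R := (paired x y)%:R.
have degF : degree hX hY 0 F.
  by move=> x y; rewrite addr0 eq_sym => /negPf hxy; rewrite /F /paired hxy.
have degG : degree hY hX 0 G.
  by move=> y x; rewrite addr0 => /negPf hxy; rewrite /G /paired hxy.
apply: (homotopy_equivalent_matrix (M := fun _ _ => 0) (N := fun _ _ => 0)
  (H := fun _ _ => 0) (K := fun _ _ => 0) _ _ _ _ degF degG) => //.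
- by move=> x y; rewrite matmul0l matmul0r.
- by move=> y x; rewrite matmul0l matmul0r.
- move=> x x'; rewrite !matmul0l !addr0 /matmul.
  have [y xy] := paired_surjl x; rewrite (bigD1 y) //= {1}/F xy mul1r big1 ?addr0.
    rewrite /G; have [<-|neq] := eqVneq x x'; first by rewrite xy.
    by case: (boolP (paired x' y)) => // /(paired_injl xy) eqx; rewrite eqx eqxx in neq.
  move=> z neq; rewrite /F; case: (boolP (paired x z)); last by rewrite mul0r.
  by move/(paired_injr xy) => eqy; rewrite eqy eqxx in neq.
- move=> y y'; rewrite !matmul0l !addr0 /matmul.
  have [x xy] := paired_surjr y; rewrite (bigD1 x) //= {1}/G xy mul1r big1 ?addr0.
    rewrite /F; have [<-|neq] := eqVneq y y'; first by rewrite xy.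
    by case: (boolP (paired x y')) => // /(paired_injr xy) eqy; rewrite eqy eqxx in neq.
  move=> z neq; rewrite /G; case: (boolP (paired z y)); last by rewrite mul0r.
  by move/(paired_injl xy) => eqx; rewrite eqx eqxx in neq.
Qed.

End ZeroComplexes.

(** * Rows of points, and graphs of degree at most two *)

Section Rows.
Variable T : Type.

(** A slice keeps the points on its left and shifts those on its right, so two
    successive rows of labelled points differ in a window only. *)
Lemma row_split (r r' : nat -> T) (m m' p ni no : nat) :
  (p + ni <= m)%N -> (m + no = m' + ni)%N ->
  (forall i, (i < p)%N -> r i = r' i) ->
  (forall i, (i < m - p - ni)%N -> r (p + ni + i)%N = r' (p + no + i)%N) ->
  exists A B, [/\ size A = p,
    mkseq r m = A ++ mkseq (fun j => r (p + j)%N) ni ++ B &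
    mkseq r' m' = A ++ mkseq (fun j => r' (p + j)%N) no ++ B].
Proof.
move=> le_m eq_m rl rr.
have mkseqD (f : nat -> T) a b :
    mkseq f (a + b) = mkseq f a ++ mkseq (fun j => f (a + j)%N) b.
  by rewrite /mkseq iotaD map_cat -[(0 + a)%N]/(0 + a)%N addnC iotaDl -map_comp.
exists (mkseq r p), (mkseq (fun j => r (p + ni + j)%N) (m - p - ni)).
split; first by rewrite size_mkseq.
  have {1}-> : m = (p + (ni + (m - p - ni)))%N by lia.
  rewrite !mkseqD; do 2!congr (_ ++ _).
  by apply: eq_map => j; rewrite addnA.
have {1}-> : m' = (p + (no + (m - p - ni)))%N by lia.
rewrite !mkseqD; congr (_ ++ (_ ++ _)).
  by apply/eq_in_map => i; rewrite mem_iota => /andP[_ /rl].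
by apply/eq_in_map => i; rewrite mem_iota addnA => /andP[_ /rr].
Qed.

End Rows.

Section Intersection.

(** Parity of the number of pairs formed by a point with the first mark and,
    further to the right, a point with the second mark. When the marks follow
    two curves upwards, it changes where the curves intersect. *)
Fixpoint inversions (l : seq (bool * bool)) : bool :=
  if l is x :: l' then inversions l' (+) (x.1 && odd (count snd l'))
  else false.

Lemma inversions_cat A B : inversions (A ++ B) =
  inversions A (+) inversions B (+) (odd (count fst A) && odd (count snd B)).
Proof.
elim: A => [|x A /= ->]; first by rewrite addbF.
rewrite count_cat !oddD; case: (inversions A); case: (inversions B);
by case: (x.1); case: (odd _); case: (odd _); case: (odd _).
Qed.

(** No point has both marks, so two points with different marks are in order
    for exactly one of the two readings of the row. *)
Lemma inversions_rev l : all (fun x => ~~ (x.1 && x.2)) l ->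
  inversions (rev l) (+) inversions l = odd (count fst l) && odd (count snd l).
Proof.
elim: l => // x l IH /= /andP[x12 /IH{}IH].
rewrite rev_cons -cats1 inversions_cat /= !oddD !addbF !count_rev !oddb.
move: IH x12; case: (inversions _); case: (inversions _);
by case: x => [[] []]; case: (odd _); case: (odd _).
Qed.

End Intersection.

Section Leaves.
Variables (T : finType) (e : rel T).
Hypothesis e_sym : symmetric e.
Hypothesis e_deg2 : forall x y1 y2 y3, e x y1 -> e x y2 -> e x y3 ->
  [|| y1 == y2, y1 == y3 | y2 == y3].

Definition leaf x := forall y1 y2, e x y1 -> e x y2 -> y1 = y2.

(** An inner vertex of the path already has its two neighbours on the path,
    and a leaf has its only one. *)
Lemma path_closed x p : leaf x -> leaf (last x p) -> p != [::] ->
  path e x p -> uniq (x :: p) -> closed e [in x :: p].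
Proof.
move=> lx ll p0 ep up; apply: (intro_closed (sym_connect_sym e_sym)) => u v euv.
move/(nthP x) => [i]; rewrite /= ltnS => lt_i def_u; apply/(nthP x).
have nthe j : (j < size p)%N -> e (nth x (x :: p) j) (nth x (x :: p) j.+1).
  by move=> ltj; exact: (pathP x ep).
have neq j k : (j <= size p)%N -> (k <= size p)%N -> j != k ->
    nth x (x :: p) j != nth x (x :: p) k.
  by move=> ltj ltk; rewrite nth_uniq.
(* u is the i-th vertex: the first one, the last one or an inner one *)
have [i0|i_gt0] := posnP i.
  subst i; exists 1%N; rewrite /= ?ltnS ?lt0n ?size_eq0 //.
  have := nthe 0%N; rewrite lt0n size_eq0 p0 /= => /(_ isT) e1.
  by apply: (lx) => //; rewrite -def_u in euv.
have [i_eq|i_neq] := eqVneq i (size p).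
  exists i.-1; first by rewrite /= ltnS; lia.
  have := nthe i.-1; rewrite prednK // i_eq => /(_ ltac:(lia)) e1.
  apply: (ll); last by rewrite (last_nth x) -i_eq def_u.
  by rewrite (last_nth x) e_sym.
have lt2 : (i < size p)%N by lia.
have e1 := nthe i lt2; have := nthe i.-1; rewrite prednK // => /(_ ltac:(lia)) e2.
rewrite def_u in e1 e2; rewrite e_sym in e2.
have n12 : nth x (x :: p) i.+1 != nth x (x :: p) i.-1 by apply: neq; lia.
have := e_deg2 e1 e2 euv; rewrite (negPf n12) orFb.
case/orP=> /eqP <-; first by exists i.+1.
by exists i.-1; rewrite //= ltnS (leq_trans (leq_pred i)).
Qed.

(** A path from [u] to [v] is a whole component, and only its ends can be
    leaves. *)
Lemma three_leaves u v w : leaf u -> leaf v -> leaf w ->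
  u != v -> u != w -> v != w -> connect e u v -> ~~ connect e u w.
Proof.
move=> lu lv lw uv uw vw /connectP[p0 ep0 defv]; apply/negP => cuw.
move: defv; case: (shortenP ep0) => p ep up _ defv.
have p_n0 : p != [::] by apply/eqP => p0'; rewrite defv p0' eqxx in uv.
have cl : closed e [in u :: p] by apply: path_closed => //; rewrite -defv.
have : w \in u :: p by rewrite -(closed_connect cl cuw) /= mem_head.
case/(nthP u) => i; rewrite /= ltnS => lt_i def_w.
have i_gt0 : (0 < i)%N by case: (i) def_w uw => //= <-; rewrite eqxx.
have i_neq : i != size p.
  by apply: contraNneq vw => i_eq; rewrite defv (last_nth u) -i_eq def_w.
have lt2 : (i < size p)%N by rewrite ltn_neqAle i_neq.
have e1 : e w (nth u (u :: p) i.+1) by rewrite -def_w; exact: (pathP u ep).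
have e2 : e w (nth u (u :: p) i.-1).
  rewrite e_sym -def_w -{2}(prednK i_gt0) /=.
  by apply: (pathP u ep); lia.
have /eqP := lw _ _ e1 e2; rewrite nth_uniq //=; lia.
Qed.

End Leaves.

(** * Nodes, arcs and labels of a diagram *)

Lemma n_inE s : n_in s = if is_cup s then 0%N else 2%N.
Proof. by []. Qed.

Lemma n_outE s : n_out s = if is_cap s then 0%N else 2%N.
Proof. by []. Qed.

Section Geometry.
Variable D : diagram.
Implicit Types (u v : node D) (c : crossing D) (a : smoothing D).

Local Notation sz t := (size (level_at D t)).
Local Notation len := (size (word D)).

Lemma level_at0 : level_at D 0 = bottom D.
Proof. by rewrite /level_at take0. Qed.

Lemma level_at_top : level_at D len = rev (bottom D).
Proof. by rewrite /level_at take_size (eqP (diagramP D)). Qed.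

Lemma slice_bounds t : (t < len)%N ->
  (pos (slice_at D t) + n_in (slice_at D t) <= sz t)%N /\
  (sz t + n_out (slice_at D t) = sz t.+1 + n_in (slice_at D t))%N.
Proof.
move=> /step_at; move: (level_at D t) (level_at D t.+1) => l l'.
have drop2 i x y r : drop i l = [:: x, y & r] ->
    (i + 2 <= size l /\ size r + 2 + i = size l)%N.
  by move=> E; have := size_drop i l; rewrite E /=; lia.
case: (slice_at D t) => [i b|i|i o] /=.
- case: leqP => // le_i [<-]; rewrite size_cat /= size_drop size_takel //.
  by rewrite n_inE n_outE /=; lia.
- case E: (drop i l) => [|x [|y r]] //=; case: eqP => // _ [<-].
  have [h1 h2] := drop2 _ _ _ _ E.
  by rewrite n_inE n_outE /= size_cat /= size_takel; lia.
- case E: (drop i l) => [|x [|y r]] //= [<-].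
  have [h1 h2] := drop2 _ _ _ _ E.
  by rewrite n_inE n_outE /= size_cat /= size_takel; lia.
Qed.

Lemma node_coord_inj : injective (@node_coord D).
Proof.
move=> [t i] [t' i'] [/= /val_inj eq_t]; case: t' / eq_t i' => i'.
by move/val_inj->.
Qed.

Lemma node_coordP u : ((node_coord u).1 <= len)%N /\
  ((node_coord u).2 < sz (node_coord u).1)%N.
Proof. by case: u => t i /=; rewrite -ltnS !ltn_ord. Qed.

Lemma node_at t i : (t <= len)%N -> (i < sz t)%N ->
  exists u, node_coord u = (t, i).
Proof.
rewrite -ltnS => lt_t lt_i.
by exists (existT _ (Ordinal lt_t) (Ordinal (lt_i : (i < sz (Ordinal lt_t))%N))).
Qed.

(** Labels are extended by [false] to the coordinates that carry no node, so
    that rows can be manipulated as functions of integers. *)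
Definition label (f : node D -> bool) (t i : nat) : bool :=
  [exists u, (node_coord u == (t, i)) && f u].

Lemma label_coord f u : label f (node_coord u).1 (node_coord u).2 = f u.
Proof.
apply/existsP/idP => [[v]|fu].
  by rewrite -surjective_pairing (inj_eq node_coord_inj) => /andP[/eqP->].
by exists u; rewrite -surjective_pairing eqxx.
Qed.

(** The arcs of a slice that do not depend on the smoothing; those inside a
    crossing are given by [cross_arc]. *)
Definition base_arc t (u v : nat * nat) : bool :=
  let s := slice_at D t in
  let p := pos s in
  [|| [&& u.1 == t, v.1 == t.+1 &
         (u.2 < p)%N && (v.2 == u.2) ||
         (p + n_in s <= u.2)%N && (v.2 + n_in s == u.2 + n_out s)%N],
      [&& is_cap s, u == (t, p) & v == (t, p.+1)] |
      [&& is_cup s, u == (t.+1, p) & v == (t.+1, p.+1)]].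

Definition cross_arc t (vert : bool) (u v : nat * nat) : bool :=
  let p := pos (slice_at D t) in
  if vert then (u == (t, p)) && (v == (t.+1, p)) ||
               (u == (t, p.+1)) && (v == (t.+1, p.+1))
  else (u == (t, p)) && (v == (t, p.+1)) ||
       (u == (t.+1, p)) && (v == (t.+1, p.+1)).

Lemma slice_arcE t vert (u v : nat * nat) : slice_arc D t vert u v =
  base_arc t u v || is_cross (slice_at D t) && cross_arc t vert u v.
Proof.
case: u v => [u1 u2] [v1 v2]; rewrite /slice_arc /base_arc /cross_arc.
rewrite !xpair_eqE /= n_inE n_outE.
case: (slice_at D t) => [i b|i|i o] /=; case: vert => /=; rewrite ?inE; lia.
Qed.

Definition se c : node D :=
  existT _ (widen_ord (leqnSn _) (val c)) (Ordinal (proj1 (crossing_bounds c))).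

Lemma nw_subproof c :
  (pos (crossing_slice c) <
   size (level_at D (lift ord0 (val c) : 'I_len.+1)))%N.
Proof. exact: ltnW (ne_subproof c). Qed.

Definition nw c : node D := existT _ _ (Ordinal (nw_subproof c)).

Lemma node_coord_sw c :
  node_coord (sw c) = (val (val c), pos (crossing_slice c)).
Proof. by []. Qed.
Lemma node_coord_se c :
  node_coord (se c) = (val (val c), (pos (crossing_slice c)).+1).
Proof. by []. Qed.
Lemma node_coord_nw c :
  node_coord (nw c) = ((val (val c)).+1, pos (crossing_slice c)).
Proof. by []. Qed.
Lemma node_coord_ne c :
  node_coord (ne c) = ((val (val c)).+1, (pos (crossing_slice c)).+1).
Proof. by []. Qed.

Definition uncrossed_arc u v : bool :=
  boundary_arc D (node_coord u) (node_coord v) ||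
  [exists t : 'I_len, base_arc t (node_coord u) (node_coord v)].

Definition resolution_arc c (vert : bool) u v : bool :=
  if vert then (u == sw c) && (v == nw c) || (u == se c) && (v == ne c)
  else (u == sw c) && (v == se c) || (u == nw c) && (v == ne c).

Lemma resolution_arcE c vert u v :
  resolution_arc c vert u v = cross_arc (val c) vert (node_coord u) (node_coord v).
Proof.
rewrite /resolution_arc /cross_arc -!(inj_eq node_coord_inj).
by rewrite node_coord_sw node_coord_se node_coord_nw node_coord_ne.
Qed.

Definition vertical a c : bool := vertical_res D (val c) (a c).

Lemma vertical_flip a c c' :
  vertical (flip a c) c' = vertical a c' (+) (c' == c).
Proof.
rewrite /vertical /vertical_res /oriented_res ffunE.
by case: (c' == c); case: (a c'); case: (positive _ _); case: (parallel _ _).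
Qed.

(** An arc depends on the smoothing only inside a crossing, where all that
    matters is whether its resolution is vertical. *)
Lemma arcE a u v :
  arc a u v = uncrossed_arc u v || [exists c, resolution_arc c (vertical a c) u v].
Proof.
rewrite /arc /uncrossed_arc -orbA; congr (_ || _).
apply/existsP/orP => [[t]|[/existsP[t tuv]|/existsP[c cuv]]].
- rewrite slice_arcE => /orP[tuv|/andP[Xt tuv]].
    by left; apply/existsP; exists t.
  right; apply/existsP; exists (exist _ t Xt).
  by move: tuv; rewrite resolution_arcE /vertical /resolution /= insubT.
- by exists t; rewrite slice_arcE tuv.
- exists (val c); rewrite slice_arcE (valP c) /= /resolution valK /=.
  by move: cuv; rewrite resolution_arcE => ->; rewrite orbT.
Qed.

Definition constant_on (r : rel (node D)) (f : node D -> bool) :=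
  forall u v, r u v -> f u = f v.

Section Labels.
Variable f : node D -> bool.
Hypothesis inv_f : constant_on uncrossed_arc f.

Lemma label_base t i j : (t < len)%N ->
  (i.1 <= len)%N -> (i.2 < sz i.1)%N -> (j.1 <= len)%N -> (j.2 < sz j.1)%N ->
  base_arc t i j -> label f i.1 i.2 = label f j.1 j.2.
Proof.
case: i j => [i1 i2] [j1 j2] /= lt_t l1 l2 l3 l4.
have [u defu] := node_at l1 l2; have [v defv] := node_at l3 l4.
rewrite -defu -defv => tuv.
have := label_coord f u; have := label_coord f v; rewrite defu defv /= => -> ->.
apply: inv_f; apply/orP; right; apply/existsP.
by exists (Ordinal lt_t).
Qed.

Lemma label_boundary i j :
  (i + j).+1 = size (bottom D) -> label f len i = label f 0 j.
Proof.
move=> eq_ij.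
have l1 : (i < sz len)%N by rewrite level_at_top size_rev; lia.
have l2 : (j < sz 0)%N by rewrite level_at0; lia.
have [u defu] := node_at (leqnn _) l1; have [v defv] := node_at (leq0n _) l2.
have := label_coord f u; have := label_coord f v; rewrite defu defv /= => -> ->.
apply: inv_f; apply/orP; left.
by rewrite defu defv /boundary_arc /= !eqxx eq_ij eqxx.
Qed.

Variable t : nat.
Hypothesis lt_t : (t < len)%N.
Let s := slice_at D t.
Let p := pos s.

Lemma label_left i : (i < p)%N -> label f t i = label f t.+1 i.
Proof.
move=> lt_i; have [] := slice_bounds lt_t; rewrite -/s -/p => b1 b2.
apply: (label_base (t := t) (i := (t, i)) (j := (t.+1, i))) => //=; try lia.
by rewrite /base_arc /= -/s -/p !eqxx lt_i.
Qed.

Lemma label_right i : (i < sz t - p - n_in s)%N ->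
  label f t (p + n_in s + i) = label f t.+1 (p + n_out s + i).
Proof.
move=> lt_i; have [] := slice_bounds lt_t; rewrite -/s -/p => b1 b2.
apply: (label_base (t := t) (i := (t, _)) (j := (t.+1, _))) => //=; try lia.
rewrite /base_arc /= -/s -/p !eqxx leq_addr /=.
by apply/orP; left; apply/orP; right; apply/eqP; lia.
Qed.

Lemma label_cap : is_cap s -> label f t p = label f t p.+1.
Proof.
move=> Cs; have [] := slice_bounds lt_t; rewrite -/s -/p => b1 b2.
have ni : n_in s = 2%N by case: (s) Cs.
apply: (label_base (t := t) (i := (t, _)) (j := (t, _))) => //=; try lia.
by rewrite /base_arc /= -/s -/p !eqxx Cs orbT.
Qed.

Lemma label_cup : is_cup s -> label f t.+1 p = label f t.+1 p.+1.
Proof.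
move=> Cs; have [] := slice_bounds lt_t; rewrite -/s -/p => b1 b2.
have ni : n_in s = 0%N by case: (s) Cs.
have no : n_out s = 2%N by case: (s) Cs.
apply: (label_base (t := t) (i := (t.+1, _)) (j := (t.+1, _))) => //=; try lia.
by rewrite /base_arc /= -/s -/p !eqxx Cs !orbT.
Qed.

End Labels.

End Geometry.

(** * Intersection numbers modulo two in the projective plane *)

Lemma inversions_local A B I O :
  odd (count fst I) = odd (count fst O) ->
  odd (count snd I) = odd (count snd O) ->
  inversions (A ++ I ++ B) (+) inversions (A ++ O ++ B) =
  inversions I (+) inversions O.
Proof.
move=> eq1 eq2; rewrite !inversions_cat !count_cat !oddD eq1 eq2.
move: (inversions A) (inversions B) (inversions I) (inversions O).
move: (odd (count fst A)) (odd (count fst O)) (odd (count snd O)) (odd (count snd B)).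
by do 8!case.
Qed.

Lemma odd_count_local A B (x y : bool * bool) :
  odd (count fst (A ++ [:: x; y] ++ B)) =
  odd (count fst A) (+) odd (count fst B) (+) (x.1 (+) y.1).
Proof.
rewrite !count_cat !oddD !oddb addbF.
by case: (odd (count _ A)); case: (odd _); case: (x.1); case: (y.1).
Qed.

Section Parity.
Variable D : diagram.
Local Notation sz t := (size (level_at D t)).
Local Notation len := (size (word D)).

Lemma telescope (F : nat -> bool) n :
  F n = F 0%N (+) \big[addb/false]_(t < n) (F t (+) F t.+1).
Proof.
elim: n => [|n IH]; first by rewrite big_ord0 addbF.
rewrite big_ord_recr /= addbA -IH.
by case: (F n); case: (F n.+1).
Qed.

Lemma big_crossing (S : Type) (idx : S) (op : Monoid.com_law idx)
    (F : nat -> S) (G : crossing D -> S) :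
  (forall t, (t < len)%N -> ~~ is_cross (slice_at D t) -> F t = idx) ->
  (forall c, F (val (val c)) = G c) ->
  \big[op/idx]_(t < len) F t = \big[op/idx]_c G c.
Proof.
move=> F0 FG.
rewrite (bigID (fun t : 'I_len => is_cross (slice_at D t))) /=.
rewrite [X in op _ X]big1 ?Monoid.mulm1; last by move=> t /F0->.
rewrite (reindex_omap (val : crossing D -> 'I_len) insub); last first.
  by move=> i Xi; rewrite insubT.
apply: eq_big => [[i Xi]|c _]; first by rewrite /= insubT Xi eqxx.
exact: FG.
Qed.

Section Labels.
Variables f g : node D -> bool.
Hypotheses (inv_f : constant_on (@uncrossed_arc D) f) (inv_g :
  constant_on (@uncrossed_arc D) g).

Let row t := mkseq (fun i => (label f t i, label g t i)) (sz t).

Lemma row_step t (s := slice_at D t) (p := pos s) : (t < len)%N ->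
  exists A B,
    row t = A ++ mkseq (fun j => (label f t (p + j), label g t (p + j))) (n_in s)
              ++ B /\
    row t.+1 =
      A ++ mkseq (fun j => (label f t.+1 (p + j), label g t.+1 (p + j))) (n_out s)
        ++ B.
Proof.
move=> lt_t; have [b1 b2] := slice_bounds lt_t.
have [||A [B [_ eq1 eq2]]] := row_split (r := fun i => (label f t i, label g t i))
  (r' := fun i => (label f t.+1 i, label g t.+1 i)) b1 b2.
- by move=> i lt_i; rewrite (label_left inv_f lt_t) // (label_left inv_g lt_t).
- by move=> i lt_i; rewrite (label_right inv_f lt_t) // (label_right inv_g lt_t).
by exists A, B.
Qed.

Lemma row_rev : row len = rev (row 0).
Proof.
have e1 : sz len = size (bottom D) by rewrite level_at_top size_rev.
have e0 : sz 0 = size (bottom D) by rewrite level_at0.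
apply: (@eq_from_nth _ (false, false)); rewrite /row ?size_rev !size_mkseq ?e0 e1 //.
move=> i lt_i; rewrite nth_rev ?size_mkseq ?e0 // !nth_mkseq ?e1 ?e0 //; last lia.
by rewrite !(@label_boundary _ _ _ i (size (bottom D) - i.+1)) //; lia.
Qed.

Lemma handshake_pair :
  \big[addb/false]_c (f (sw c) (+) f (se c) (+) (f (nw c) (+) f (ne c))) = false.
Proof.
have := telescope (fun t => odd (count fst (row t))) len.
rewrite row_rev count_rev (@big_crossing _ _ _
  (fun t => odd (count fst (row t)) (+) odd (count fst (row t.+1)))
  (fun c => f (sw c) (+) f (se c) (+) (f (nw c) (+) f (ne c)))) /=.
- by case: (odd _); case: (\big[_/_]_c _).
- move=> t lt_t Xt; have [A [B [-> ->]]] := row_step lt_t.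
  rewrite n_inE n_outE /mkseq; case Ct: (is_cup _).
    rewrite (_ : is_cap _ = false); last by case: (slice_at _ _) Ct.
    rewrite [iota 0 2]/= [map _ [:: _; _]]/= odd_count_local !count_cat !oddD.
    rewrite addn0 addn1 (label_cup inv_f) //=.
  by case: (label _ _ _); case: (odd (count _ A)); case: (odd _).
  have Ct' : is_cap (slice_at D t) by case: (slice_at _ _) Ct Xt.
  rewrite Ct' [iota 0 2]/= [map _ [:: _; _]]/= odd_count_local !count_cat !oddD.
  rewrite addn0 addn1 (label_cap inv_f) //=.
  by case: (label _ _ _); case: (odd (count _ A)); case: (odd _).
- move=> c; have [A [B [-> ->]]] := row_step (ltn_ord (val c)).
  rewrite -!(label_coord f) node_coord_sw node_coord_se node_coord_nw node_coord_ne.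
  have -> : n_in (slice_at D (val (val c))) = 2%N by have := valP c; case:
    (slice_at _ _).
  have -> : n_out (slice_at D (val (val c))) = 2%N by have := valP c; case:
    (slice_at _ _).
  rewrite /mkseq [iota _ _]/= !odd_count_local addn0 addn1 /crossing_slice /=.
  by do 2!case: (odd _); do 4!case: (label _ _ _).
Qed.

Hypothesis disj : forall u, ~~ (f u && g u).

Lemma label_disj t i : ~~ (label f t i && label g t i).
Proof.
apply/andP => -[/existsP[u /andP[/eqP defu fu]] /existsP[v /andP[/eqP defv gv]]].
have eq_uv : u = v by apply: node_coord_inj; rewrite defu defv.
by have := disj u; rewrite fu {1}eq_uv gv.
Qed.

Hypothesis cross_f : forall c, f (sw c) (+) f (se c) = f (nw c) (+) f (ne c).
Hypothesis cross_g : forall c, g (sw c) (+) g (se c) = g (nw c) (+) g (ne c).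

(** The intersection form of the projective plane modulo 2. The class of a
    curve is the parity of its number of points on the boundary circle, so the
    left-hand side is the product of the classes of [f] and [g]. It is also
    the total change of [inversions] from the bottom row to the top one, which
    is its reverse, and this change takes place at the crossings. *)
Lemma intersection_parity : odd (count fst (row 0)) && odd (count snd (row 0)) =
  \big[addb/false]_c (f (sw c) && g (se c) (+) (f (nw c) && g (ne c))).
Proof.
have := telescope (fun t => inversions (row t)) len.
rewrite row_rev; have /inversions_rev <- : all (fun x => ~~ (x.1 && x.2)) (row 0).
  by apply/allP => x /mapP[i _ ->] /=; exact: label_disj.
rewrite (@big_crossing _ _ _
  (fun t => inversions (row t) (+) inversions (row t.+1))
  (fun c => f (sw c) && g (se c) (+) (f (nw c) && g (ne c)))) /=.
- by move->; case: (inversions _); case: (\big[_/_]_c _).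
- move=> t lt_t Xt; have [A [B [-> ->]]] := row_step lt_t.
  rewrite n_inE n_outE; case Ct: (is_cup _).
    rewrite (_ : is_cap _ = false); last by case: (slice_at _ _) Ct.
    rewrite /mkseq [iota 0 2]/= [iota 0 0]/= [map _ [:: _; _]]/= [map _ [::]]/=.
    rewrite addn0 addn1 (label_cup inv_f) // (label_cup inv_g) //.
    rewrite inversions_local /= ?addn0 ?addnn ?odd_double //.
    by rewrite ?andbF ?oddb ?addbF (negPf (label_disj _ _)).
  have Ct' : is_cap (slice_at D t) by case: (slice_at _ _) Ct Xt.
  rewrite Ct' /mkseq [iota 0 2]/= [iota 0 0]/= [map _ [:: _; _]]/= [map _ [::]]/=.
  rewrite addn0 addn1 (label_cap inv_f) // (label_cap inv_g) //.
  rewrite inversions_local /= ?addn0 ?addnn ?odd_double //.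
  by rewrite ?andbF ?oddb ?addbF (negPf (label_disj _ _)).
- move=> c; have [A [B [-> ->]]] := row_step (ltn_ord (val c)).
  have := cross_f c; have := cross_g c.
  rewrite -!(label_coord f) -!(label_coord g).
  rewrite node_coord_sw node_coord_se node_coord_nw node_coord_ne.
  have -> : n_in (slice_at D (val (val c))) = 2%N by have := valP c; case:
    (slice_at _ _).
  have -> : n_out (slice_at D (val (val c))) = 2%N by have := valP c; case:
    (slice_at _ _).
  rewrite /mkseq ![iota _ _]/= ![map _ _]/= addn0 addn1 /crossing_slice => cg cf.
  rewrite inversions_local /= ?addn0 ?oddD ?oddb ?andbF ?addbF //.
Qed.

End Labels.

(** From a row to the next the parity of the number of labelled points changes
    only at a crossing, by the labels of its four corners. The top row is the
    reverse of the bottom one, so the total change is even. *)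
Lemma handshake (f : node D -> bool) : constant_on (@uncrossed_arc D) f ->
  \big[addb/false]_c (f (sw c) (+) f (se c) (+) (f (nw c) (+) f (ne c))) = false.
Proof. by move=> const_f; exact: (handshake_pair const_f const_f). Qed.

End Parity.

(** * Circles of a smoothing *)

Section Circles.
Variable D : diagram.
Local Notation sz t := (size (level_at D t)).
Local Notation len := (size (word D)).
Implicit Types (u v : node D) (c : crossing D) (a : smoothing D).

Definition adjacent a u v := arc a u v || arc a v u.

Lemma adjacent_sym a : connect_sym (adjacent a).
Proof. by apply: sym_connect_sym => u v; rewrite /adjacent orbC. Qed.

Lemma circle_ofE a u v :
  (circle_of a u == circle_of a v) = connect (adjacent a) u v.
Proof.
rewrite -val_eqE /=; apply/eqP/idP => [eq_uv|cuv].
  have : v \in component a v by rewrite inE connect0.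
  by rewrite -eq_uv inE.
by apply/setP => w; rewrite !inE; apply: (same_connect (@adjacent_sym a)).
Qed.

Lemma adjacent_constant a (f : node D -> bool) :
  constant_on (arc a) f -> forall u v, connect (adjacent a) u v -> f u = f v.
Proof.
move=> inv_f u v; apply: (@closed_connect _ (adjacent a) f) => x y.
by case/orP => /inv_f.
Qed.

(** Common to both resolutions of [c]. *)
Definition arc_off a c u v :=
  uncrossed_arc u v || [exists c', (c' != c) && resolution_arc c' (vertical a c') u v].

Lemma arc_offE a c u v :
  arc a u v = arc_off a c u v || resolution_arc c (vertical a c) u v.
Proof.
rewrite arcE /arc_off -orbA; congr (_ || _).
apply/existsP/orP => [[c' auv]|[/existsP[c' /andP[_ auv]]|auv]]; last 2 first.
- by exists c'.
- by exists c.
have [<-|neq] := eqVneq c' c; first by right.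
by left; apply/existsP; exists c'; rewrite neq.
Qed.

Lemma arc_off_flip a c : arc_off (flip a c) c =2 arc_off a c.
Proof.
move=> u v; congr (_ || _); apply: eq_existsb => c'.
by rewrite vertical_flip; case: eqP => //= _; rewrite addbF.
Qed.

Definition adjacent_off a c u v := arc_off a c u v || arc_off a c v u.

Lemma adjacent_off_sym a c : symmetric (adjacent_off a c).
Proof. by move=> u v; rewrite /adjacent_off orbC. Qed.

(** At most one arc leaves a node upwards and at most one downwards. This is
    proved by recording where an arc lies: in a slice, or, for [None], in the
    identification of antipodal endpoints; [above] tells on which side of the
    node that is. *)
Section Places.
Variable a : smoothing D.

Definition joined (q : option 'I_len) (u v : nat * nat) : bool :=
  if q is Some t then
    let vt := vertical_res D t (resolution a t) in
    slice_arc D t vt u v || slice_arc D t vt v u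
  else boundary_arc D u v || boundary_arc D v u.

Definition above (q : option 'I_len) (u : nat * nat) : bool :=
  u.1 == (if q is Some t then val t else len).

Lemma slice_arc_level t vt (u v : nat * nat) : slice_arc D t vt u v ->
  ((u.1 == t) || (u.1 == t.+1)) && ((v.1 == t) || (v.1 == t.+1)).
Proof.
case/or3P => /and3P[]; first by move=> /eqP-> /eqP-> _; rewrite !eqxx orbT.
  by move=> _ /eqP-> /eqP->; rewrite !eqxx.
by move=> _ /eqP-> /eqP->; rewrite !eqxx orbT.
Qed.

Lemma joined_level (t : 'I_len) (u v : nat * nat) :
  joined (Some t) u v -> (u.1 == t) || (u.1 == t.+1).
Proof.
by case/orP => /slice_arc_level/andP[].
Qed.

Lemma slice_joined_inj (t : 'I_len) (u v w : nat * nat) :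
  joined (Some t) u v -> joined (Some t) u w -> v = w.
Proof.
case: u v w => [u1 u2] [v1 v2] [w1 w2].
rewrite /= /slice_arc !xpair_eqE !n_inE !n_outE /=.
move: (vertical_res _ _ _) => vt.
case: (slice_at D t) => [i b|i|i o] /=; rewrite ?inE => h1 h2.
- by congr (_, _); lia.
- by congr (_, _); lia.
- by case: vt h1 h2 => /= h1 h2; congr (_, _); lia.
Qed.

Lemma boundary_joined_inj (u v w : nat * nat) :
  joined None u v -> joined None u w -> v = w.
Proof.
case: u v w => [u1 u2] [v1 v2] [w1 w2]; rewrite /= /boundary_arc /= => h1 h2.
by congr (_, _); lia.
Qed.

Lemma joined_inj q q' (u v w : nat * nat) :
  joined q u v -> joined q' u w -> above q u = above q' u -> v = w.
Proof.
case: q q' => [t|] [t'|] h h'; rewrite /above.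
- move=> eq_side; have /orP hl := joined_level h; have /orP hl' := joined_level h'.
  have /val_inj eq_t : val t = val t' by move: eq_side hl hl' => /=; lia.
  by move: h'; rewrite -eq_t; apply: slice_joined_inj h.
- have := joined_level h; move: h'; rewrite /= /boundary_arc.
  by have := ltn_ord t; lia.
- have := joined_level h'; move: h; rewrite /= /boundary_arc.
  by have := ltn_ord t'; lia.
- by move=> _; exact: boundary_joined_inj h h'.
Qed.

Lemma adjacent_off_joined c u v : adjacent_off a c u v ->
  exists2 q, joined q (node_coord u) (node_coord v) &
    q = Some (val c) -> base_arc D (val c) (node_coord u) (node_coord v) ||
                        base_arc D (val c) (node_coord v) (node_coord u).
Proof.
have aux x y : arc_off a c x y -> exists2 q,
    joined q (node_coord x) (node_coord y) &
    q = Some (val c) -> base_arc D (val c) (node_coord x) (node_coord y).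
  case/orP => [/orP[bxy|/existsP[t txy]]|/existsP[c' /andP[neq cxy]]].
  - by exists None => //=; rewrite bxy.
  - exists (Some t); last by case=> eq_t; have <- : t = val c by [].
    by rewrite /= slice_arcE txy.
  - exists (Some (val c')); last by case=> /val_inj eq_c; rewrite eq_c eqxx in neq.
    move: cxy; rewrite resolution_arcE /= slice_arcE (valP c') /resolution valK
      /= => ->.
    by rewrite orbT.
case/orP => /aux[q h1 h2].
  by exists q => // /h2->.
exists q; last by move/h2->; rewrite orbT.
by case: q h1 {h2} => [t|] /=; rewrite orbC.
Qed.

Lemma adjacent_off_deg2 c u v1 v2 v3 :
  adjacent_off a c u v1 -> adjacent_off a c u v2 -> adjacent_off a c u v3 ->
  [|| v1 == v2, v1 == v3 | v2 == v3].
Proof.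
move=> /adjacent_off_joined[q1 j1 _] /adjacent_off_joined[q2 j2 _]
  /adjacent_off_joined[q3 j3 _].
(* two of the three arcs leave u on the same side *)
have [e12|n12] := eqVneq (above q1 (node_coord u)) (above q2 (node_coord u)).
  by rewrite (node_coord_inj (joined_inj j1 j2 e12)) eqxx.
have [e13|n13] := eqVneq (above q1 (node_coord u)) (above q3 (node_coord u)).
  by rewrite (node_coord_inj (joined_inj j1 j3 e13)) eqxx orbT.
rewrite (node_coord_inj (joined_inj j2 j3 _)) ?eqxx ?orbT //.
by move: n12 n13; do 3!case: above.
Qed.

Definition corner c u := u \in [:: sw c; se c; nw c; ne c].

Lemma corner_coord c u : corner c u ->
  (((node_coord u).1 == val (val c)) || ((node_coord u).1 == (val (val c)).+1))
  && (pos (slice_at D (val (val c))) <= (node_coord u).2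
      < pos (slice_at D (val (val c))) + 2)%N.
Proof.
rewrite /corner !inE => /or4P[] /eqP->.
- by rewrite node_coord_sw /= eqxx /crossing_slice /=; lia.
- by rewrite node_coord_se /= eqxx /crossing_slice /=; lia.
- by rewrite node_coord_nw /= eqxx orbT /crossing_slice /=; lia.
- by rewrite node_coord_ne /= eqxx orbT /crossing_slice /=; lia.
Qed.

Lemma base_arc_cross t (p := pos (slice_at D t)) (u v : nat * nat) :
  is_cross (slice_at D t) -> base_arc D t u v ->
  ~~ (p <= u.2 < p + 2)%N && ~~ (p <= v.2 < p + 2)%N.
Proof.
rewrite /base_arc /p n_inE n_outE; case: (slice_at D t) => //= i o _.
by rewrite !orbF => /and3P[_ _]; lia.
Qed.

(** The second arc at a corner would be the resolution of the crossing, which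
    has been removed. *)
Lemma corner_leaf c u : corner c u -> leaf (adjacent_off a c) u.
Proof.
move=> cu v w /adjacent_off_joined[q j h] /adjacent_off_joined[q' j' h'].
pose b := (node_coord u).1 != val (val c).
suff side q0 v0 : joined q0 (node_coord u) (node_coord v0) ->
    (q0 = Some (val c) -> base_arc D (val c) (node_coord u) (node_coord v0) ||
                          base_arc D (val c) (node_coord v0) (node_coord u)) ->
    above q0 (node_coord u) = b.
  apply: node_coord_inj; apply: (joined_inj j j' _).
  by rewrite (side _ _ j h) (side _ _ j' h').
have /= lt_c := ltn_ord (val c); have /andP[lu pu] := corner_coord cu.
rewrite /above /b; case: q0 => [t0|]; last first.
  move=> bd _; have {bd} : ((node_coord u).1 == len) || ((node_coord u).1 == 0%N).
    by case/orP: bd => /and3P[] /= b1 b2 _; rewrite ?b1 ?b2 ?orbT.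
  by move: lu => /=; clear -lt_c; lia.
move=> jt h0; have jl := joined_level jt.
have neq_t : val t0 != val (val c).
  apply/eqP => /val_inj eq_t; have := h0 (congr1 Some eq_t).
  by case/orP => /(base_arc_cross (valP c)); rewrite pu ?andbF.
by move: lu jl neq_t => /=; clear; lia.
Qed.

End Places.
End Circles.

(** * Changing the resolution of a crossing *)

Section Surgery.
Variable D : diagram.
Implicit Types (u v : node D) (c : crossing D) (a : smoothing D).

(** By the choice of the corners, [sw c] and [ne c] lie on the two arcs of
    either resolution. *)
Definition same_circle a c := circle_of a (sw c) == circle_of a (ne c).

Lemma flip_id a c : flip a c c = ~~ a c.
Proof. by rewrite ffunE eqxx. Qed.

Lemma flipK c : involutive (fun a => flip a c).
Proof. by move=> a; apply/ffunP => c'; rewrite !ffunE; case: eqP => //;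
  rewrite negbK. Qed.

Lemma flipC a c c' : flip (flip a c) c' = flip (flip a c') c.
Proof. by apply/ffunP => d; rewrite !ffunE; do 2!case: eqP. Qed.

Lemma corners_uniq c : uniq [:: sw c; se c; nw c; ne c].
Proof.
rewrite -(map_inj_uniq (@node_coord_inj D)) [map _ _]/=.
rewrite node_coord_sw node_coord_se node_coord_nw node_coord_ne.
by rewrite /= !inE !xpair_eqE; lia.
Qed.

(** Naming the resolutions of [c] by being vertical or not, and not by being 0
    or 1, separates the geometry from the orientations. *)
Definition resolve a c vt := if vertical a c == vt then a else flip a c.

Lemma arc_resolve a c vt u v :
  arc (resolve a c vt) u v = arc_off a c u v || resolution_arc c vt u v.
Proof.
rewrite /resolve (arc_offE _ c); case: eqP => [->//|/eqP neq].
rewrite arc_off_flip vertical_flip eqxx addbT; congr (_ || resolution_arc c _ _ _).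
by move: neq; case: vertical; case: vt.
Qed.

Lemma resolve_same_circle a c : same_circle a c -> same_circle (flip a c) c ->
  forall vt, same_circle (resolve a c vt) c.
Proof. by move=> h h' vt; rewrite /resolve; case: ifP. Qed.

Lemma resolveP a c : resolve a c (vertical a c) = a /\
  resolve a c (~~ vertical a c) = flip a c.
Proof. by rewrite /resolve eqxx; case: vertical. Qed.

Lemma resolution_connect a c vt u v : resolution_arc c vt u v ->
  connect (adjacent (resolve a c vt)) u v.
Proof. by move=> cuv; rewrite connect1 // /adjacent arc_resolve cuv orbT. Qed.

Lemma off_connect a c vt u v : connect (adjacent_off a c) u v ->
  connect (adjacent (resolve a c vt)) u v.
Proof.
apply: connect_sub => x y xy; rewrite connect1 // /adjacent !arc_resolve.
by case/orP: xy => ->; rewrite ?orbT.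
Qed.

Lemma off_constant a c u : constant_on (arc_off a c) (connect (adjacent_off a c) u).
Proof.
move=> x y axy; apply: same_connect1r; last by rewrite /adjacent_off axy.
exact/sym_connect_sym/adjacent_off_sym.
Qed.

Lemma arc_off_uncrossed a c f : constant_on (arc_off a c) f ->
  constant_on (@uncrossed_arc D) f.
Proof. by move=> inv_f u v uv; apply: inv_f; rewrite /arc_off uv. Qed.

Lemma arc_off_resolution a c f c' : c' != c -> constant_on (arc_off a c) f ->
  if vertical a c' then f (sw c') = f (nw c') /\ f (se c') = f (ne c')
  else f (sw c') = f (se c') /\ f (nw c') = f (ne c').
Proof.
move=> neq inv_f.
have H u v : resolution_arc c' (vertical a c') u v -> f u = f v.
  by move=> uv; apply: inv_f; apply/orP; right; apply/existsP; exists c'; rewrite neq.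
by move: H; case: (vertical a c') => H; split; apply: H;
  rewrite /resolution_arc !eqxx ?orbT.
Qed.

(** Away from [c] every crossing joins its corners in pairs, so only the
    corners of [c] count in [handshake]. *)
Lemma handshake_off a c f : constant_on (arc_off a c) f ->
  f (sw c) (+) f (se c) = f (nw c) (+) f (ne c).
Proof.
move=> inv_f; have := handshake (arc_off_uncrossed inv_f).
rewrite (bigD1 c) //= big1 => [|c' neq].
  by rewrite addbF; do 4!case: (f _).
have := arc_off_resolution neq inv_f.
by case: vertical => -[-> ->]; do 2!case: (f _).
Qed.

(** Away from [c] the corner [sw c] is linked to an odd number of the other
    corners. If it is linked to [ne c], both resolutions have a single circle
    at [c]; if it is linked to [se c] or to [nw c], the resolution that does
    not join these two corners has one. So an edge of the cube is a merge, a
    split or a Moebius band. *)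
Lemma same_circle_resolve_or a c : same_circle (resolve a c true) c ||
  same_circle (resolve a c false) c.
Proof.
rewrite /same_circle !circle_ofE.
set r := adjacent_off a c; have r_sym : connect_sym r :=
  sym_connect_sym (@adjacent_off_sym D a c).
have hs u := handshake_off (@off_constant a c u).
have [cn|ncn] := boolP (connect r (sw c) (ne c)); first by rewrite off_connect.
have := hs (sw c); rewrite connect0 (negPf ncn) addbF.
have [cse|ncse] := boolP (connect r (sw c) (se c)) => /= /esym h.
  have := hs (nw c); rewrite (r_sym _ (sw c)) h.
  rewrite (same_connect r_sym cse) in h.
  rewrite (r_sym _ (se c)) h connect0 /= => /esym/negbFE hne.
  apply/orP; left; apply: connect_trans (resolution_connect a (u := sw c) (v :=
    nw c) _) _.
    by rewrite /resolution_arc !eqxx.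
  exact: off_connect.
have := hs (se c); rewrite (r_sym _ (sw c)) (negPf ncse) connect0 /=.
rewrite (r_sym _ (nw c)) -(same_connect r_sym h) (negPf ncse) => /esym hne.
apply/orP; right; apply: connect_trans (resolution_connect a (u := sw c) (v :=
  se c) _) _.
  by rewrite /resolution_arc !eqxx.
exact: off_connect.
Qed.

Lemma same_circle_or a c : same_circle a c || same_circle (flip a c) c.
Proof.
have := same_circle_resolve_or a c; have [] := resolveP a c.
by case: vertical => /= -> ->; rewrite 1?orbC.
Qed.

(** For a Moebius band, the arcs away from [c] link [sw c] to [ne c] and [se
    c] to [nw c]; going straight through the crossing from [sw c] to [ne c]
    closes up the first link to a curve, which is marked by [f]. *)
Lemma virtual_curve a c : same_circle a c -> same_circle (flip a c) c ->
  exists f : node D -> bool, [/\ constant_on (arc_off a c) f,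
    [/\ f (sw c), f (ne c), ~~ f (se c) & ~~ f (nw c)] &
    forall u, f u -> circle_of a u == circle_of a (sw c)].
Proof.
move=> same1 same2; exists (connect (adjacent_off a c) (sw c)).
set r := adjacent_off a c; have r_sym : connect_sym r :=
  sym_connect_sym (@adjacent_off_sym D a c).
have inv_f := @off_constant a c (sw c); rewrite -/r in inv_f.
split=> // [|u ru]; last first.
  rewrite circle_ofE adjacent_sym; have [<- _] := resolveP a c; exact: off_connect.
have := handshake_off inv_f; rewrite connect0.
have lfs u : corner c u -> leaf r u := @corner_leaf D a c u.
have res vt : connect (adjacent (resolve a c vt)) (sw c) (ne c).
  by rewrite -circle_ofE -/(same_circle _ _) resolve_same_circle.
have invr vt : (forall u v, resolution_arc c vt u v -> connect r (sw c) u =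
  connect r (sw c) v) ->
    connect r (sw c) (ne c).
  move=> H; rewrite -(@adjacent_constant _ (resolve a c vt) _ _ _ _ (res vt)) // => u v.
  by rewrite arc_resolve => /orP[/inv_f|/H].
have [/and4P[]] := corners_uniq c; rewrite !inE !negb_or => /and3P[n1 n2 n3]
  /andP[n4 n5] n6 _.
case rse: (connect r (sw c) (se c)); case rnw: (connect r (sw c) (nw c));
  case rne: (connect r (sw c) (ne c)) => //= _.
(* sw c is linked to all three other corners, to se c only, or to nw c only;
   the last two contradict that the resolution which joins sw c to its partner
   has a single circle *)
- suff : ~~ connect r (sw c) (nw c) by rewrite rnw.
  apply: (@three_leaves _ r _ _ (sw c) (se c)) => //; try by apply: lfs;
    rewrite /corner !inE eqxx ?orbT.
    exact: adjacent_off_sym.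
  exact: adjacent_off_deg2.
- suff : false by []; rewrite -rne; apply: (invr false) => u v.
  by case/orP => /andP[/eqP-> /eqP->]; rewrite ?connect0 ?rse ?rnw ?rne.
- suff : false by []; rewrite -rne; apply: (invr true) => u v.
  by case/orP => /andP[/eqP-> /eqP->]; rewrite ?connect0 ?rse ?rnw ?rne.
Qed.

(** The homology class modulo 2 in the projective plane of the curves marked
    by [f]. *)
Definition boundary_odd (f : node D -> bool) :=
  odd (count id (mkseq (label f 0) (size (level_at D 0)))).

Lemma boundary_intersection f g :
  constant_on (@uncrossed_arc D) f -> constant_on (@uncrossed_arc D) g ->
    (forall u, ~~ (f u && g u)) ->
  (forall c, f (sw c) (+) f (se c) = f (nw c) (+) f (ne c)) ->
  (forall c, g (sw c) (+) g (se c) = g (nw c) (+) g (ne c)) ->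
  boundary_odd f && boundary_odd g =
  \big[addb/false]_c (f (sw c) && g (se c) (+) (f (nw c) && g (ne c))).
Proof.
move=> inv_f inv_g fg cf cg; rewrite -(intersection_parity inv_f inv_g fg cf cg).
by rewrite /boundary_odd !count_map.
Qed.

Lemma cross_parity a c f : constant_on (arc_off a c) f ->
  forall c', f (sw c') (+) f (se c') = f (nw c') (+) f (ne c').
Proof.
move=> inv_f c'; have [->|neq] := eqVneq c' c; first exact: handshake_off inv_f.
have := arc_off_resolution neq inv_f.
by case: vertical => -[-> ->]; do 2!case: (f _).
Qed.

(** The curve marked by [f] and the union of the other curves have a single
    transverse intersection, at [c], so the product of their classes is 1. *)
Lemma virtual_curve_odd a c f : constant_on (arc_off a c) f ->
    [/\ f (sw c), f (ne c), ~~ f (se c) & ~~ f (nw c)] -> boundary_odd f.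
Proof.
move=> inv_f [fsw fne fse fnw].
have inv_nf : constant_on (arc_off a c) (fun u => ~~ f u) by move=> u v /inv_f->.
(* the complement of f marks all the other curves *)
suff /andP[//] : boundary_odd f && boundary_odd (fun u => ~~ f u).
rewrite (boundary_intersection (arc_off_uncrossed inv_f) (arc_off_uncrossed inv_nf)).
- rewrite (bigD1 c) //= fsw fse (negPf fnw) big1 // => c' neq.
  by have := arc_off_resolution neq inv_f; case: vertical => -[-> ->]; do 2!case: (f _).
- by move=> u; case: (f u).
- exact: cross_parity inv_f.
- exact: cross_parity inv_nf.
Qed.

(** Whichever the resolution, each corner is joined to [sw c] or to [ne c]. *)
Lemma corner_circle a c u : corner c u ->
  (circle_of a u == circle_of a (sw c)) || (circle_of a u == circle_of a (ne c)).
Proof.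
have H x y : resolution_arc c (vertical a c) x y -> circle_of a x == circle_of a y.
  by move=> xy; rewrite circle_ofE connect1 // /adjacent (arc_offE _ c) xy orbT.
move: H; rewrite /corner !inE /resolution_arc; case: vertical => H /or4P[] /eqP->;
  rewrite ?eqxx ?orbT //; apply/orP.
- by right; apply: H; rewrite !eqxx orbT.
- by left; rewrite eq_sym; apply: H; rewrite !eqxx.
- by left; rewrite eq_sym; apply: H; rewrite !eqxx.
- by right; apply: H; rewrite !eqxx orbT.
Qed.

(** On distinct circles the two one-sided curves of [virtual_curve] would be
    disjoint. This is impossible in the projective plane. *)
Lemma no_two_mobius a c c' : same_circle a c -> same_circle (flip a c) c ->
  same_circle a c' -> same_circle (flip a c') c' ->
    circle_of a (sw c) == circle_of a (sw c').
Proof.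
move=> s1 s2 s1' s2'; apply/negPn/negP => neq.
have [f [inv_f cf subf]] := virtual_curve s1 s2.
have [g [inv_g cg subg]] := virtual_curve s1' s2'.
have fg u : ~~ (f u && g u).
  by apply: contraNN neq => /andP[/subf/eqP<- /subg].
have f0 u : corner c' u -> f u = false.
  move/(corner_circle a); rewrite -(eqP s1') orbb => cu.
  by apply: contraNF neq => /subf/eqP<-.
have g0 u : corner c u -> g u = false.
  move/(corner_circle a); rewrite -(eqP s1) orbb => /eqP cu.
  by apply: contraNF neq => /subg; rewrite cu.
have := boundary_intersection (arc_off_uncrossed inv_f) (arc_off_uncrossed inv_g) fg
  (cross_parity inv_f) (cross_parity inv_g).
rewrite (virtual_curve_odd inv_f cf) (virtual_curve_odd inv_g cg) big1 // => d _.
(* d is c, which g avoids, or c', which f avoids, or a resolved crossing,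
   where disjoint curves do not meet *)
have [->|nc] := eqVneq d c.
  by rewrite (g0 (se c)) ?(g0 (ne c)) ?andbF // /corner !inE eqxx ?orbT.
have [->|nc'] := eqVneq d c'.
  by rewrite (f0 (sw c')) ?(f0 (nw c')) // /corner !inE eqxx ?orbT.
have := arc_off_resolution nc inv_f; have := arc_off_resolution nc' inv_g.
case: vertical => -[e1 e2] [e3 e4]; first by rewrite e3 e2 addbb.
by rewrite e3 e4 (negPf (fg _)) (negPf (fg _)).
Qed.

Lemma component_away a c u :
  circle_of a u != circle_of a (sw c) -> circle_of a u != circle_of a (ne c) ->
  component (flip a c) u = component a u.
Proof.
rewrite !circle_ofE => nsw nne.
have off v : corner c v -> connect (adjacent a) u v = false.
  move/(corner_circle a); rewrite !circle_ofE => cv; apply/negP => uv.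
  by case/orP: cv => /(connect_trans uv); apply/negP.
have offc vt x y : resolution_arc c vt x y ->
    connect (adjacent a) u x = connect (adjacent a) u y.
  by rewrite /resolution_arc; case: vt => /orP[] /andP[/eqP-> /eqP->];
    rewrite !off // /corner !inE eqxx ?orbT.
have inv_u : constant_on (arc (flip a c)) (connect (adjacent a) u).
  move=> x y; rewrite (arc_offE _ c) arc_off_flip => /orP[xy|/offc//].
  apply: same_connect1r; first exact: adjacent_sym.
  by rewrite /adjacent (arc_offE _ c) xy.
have sub v : connect (adjacent (flip a c)) u v -> connect (adjacent a) u v.
  by move/(adjacent_constant inv_u) <-.
have inv_u' : constant_on (arc a) (connect (adjacent (flip a c)) u).
  move=> x y; rewrite (arc_offE _ c) => /orP[xy|].
    apply: same_connect1r; first exact: adjacent_sym.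
    by rewrite /adjacent (arc_offE _ c) arc_off_flip xy.
  have H v : corner c v -> connect (adjacent (flip a c)) u v = false.
    by move/off => uv; apply/negP => /sub; rewrite uv.
  by rewrite /resolution_arc; case: vertical => /orP[] /andP[/eqP-> /eqP->];
    rewrite !H // /corner !inE eqxx ?orbT.
apply/setP => v; rewrite !inE; apply/idP/idP => [/sub //|].
by move/(adjacent_constant inv_u') <-.
Qed.

End Surgery.

(** * States and the colour basis *)

Section States.
Variable D : diagram.
Implicit Types (u v : node D) (c : crossing D) (a b : smoothing D).
Implicit Types (x y z s : state D) (f : node D -> bool).

Lemma circle_arc a u v : arc a u v -> circle_of a u = circle_of a v.
Proof. by move=> auv; apply/eqP; rewrite circle_ofE connect1 // /adjacent auv. Qed.

Lemma constant_circle a f u v :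
  constant_on (arc a) f -> circle_of a u == circle_of a v -> f u = f v.
Proof. by move=> inv_f; rewrite circle_ofE => /(adjacent_constant inv_f). Qed.

Lemma circle_constant a v : constant_on (arc a) (fun u => circle_of a u ==
  circle_of a v).
Proof. by move=> u w /circle_arc->. Qed.

Lemma subscript_constant x : constant_on (arc (tag x)) (subscript x).
Proof. by move=> u v /circle_arc; rewrite /subscript => ->. Qed.

(** A state from a colouring of the nodes; it has the prescribed subscripts if
    the colouring is constant along the arcs. *)
Definition mk_state a (p : bool) f : state D :=
  existT _ a (p, [ffun C : circle a => [exists u, (circle_of a u == C) && f u]]).

Lemma superscript_mk a p f : superscript (mk_state a p f) = p.
Proof. by []. Qed.

Lemma subscript_mk a p f : constant_on (arc a) f -> subscript (mk_state a p f) =1 f.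
Proof.
move=> inv_f u; rewrite /subscript /= ffunE.
apply/existsP/idP => [[v /andP[/(constant_circle inv_f)->]] //|fu].
by exists u; rewrite eqxx.
Qed.

Lemma circle_of_surj a (C : circle a) : exists u, C = circle_of a u.
Proof.
case: C => C aC; have /imsetP[u _ defC] := aC.
by exists u; apply: val_inj.
Qed.

Lemma state_ext x y : tag x = tag y -> superscript x = superscript y ->
  subscript x =1 subscript y -> x = y.
Proof.
case: x y => [a [p f]] [b [q g]] /= eq_ab; case: b / eq_ab g => g.
rewrite /superscript /subscript /= => -> fg; have -> // : f = g.
by apply/ffunP => C; have [u ->] := circle_of_surj C.
Qed.

(** The condition under which the edge at [c] acts on a colouring, a
    restriction only where two circles meet. *)
Definition monochrome c x := subscript x (sw c) == subscript x (ne c).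

Lemma corner_const a c f u :
  constant_on (arc a) f -> f (sw c) = f (ne c) -> corner c u -> f u = f (sw c).
Proof.
by move=> inv_f eq_f /(corner_circle a)/orP[] /(constant_circle inv_f) ->.
Qed.

(** All four corners of a monochrome crossing have one colour, so the other
    resolution joins equal colours too. *)
Lemma constant_flip a c f :
  constant_on (arc a) f -> f (sw c) = f (ne c) -> constant_on (arc (flip a c)) f.
Proof.
move=> inv_f eq_f u v; rewrite (arc_offE _ c) arc_off_flip => /orP[uv|].
  by apply: inv_f; rewrite (arc_offE _ c) uv.
have H w : corner c w -> f w = f (sw c) := corner_const inv_f eq_f.
by rewrite /resolution_arc; case: vertical => /orP[] /andP[/eqP-> /eqP->];
  rewrite !H // /corner !inE eqxx ?orbT.
Qed.

Lemma through_flip a c u :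
  (circle_of a u == circle_of a (sw c)) || (circle_of a u == circle_of a (ne c)) =
  (circle_of (flip a c) u == circle_of (flip a c) (sw c)) ||
  (circle_of (flip a c) u == circle_of (flip a c) (ne c)).
Proof.
suff H a' : (circle_of (flip a' c) u == circle_of (flip a' c) (sw c)) ||
   (circle_of (flip a' c) u == circle_of (flip a' c) (ne c)) ->
   (circle_of a' u == circle_of a' (sw c)) || (circle_of a' u == circle_of a' (ne c)).
  apply/idP/idP => [|/H //]; have := H (flip a c); rewrite (flipK c a); exact.
apply: contraTT; rewrite !negb_or => /andP[h1 h2].
have := component_away h1 h2; move: h1 h2.
rewrite !circle_ofE => h1 h2 /setP eq_comp.
have := eq_comp (sw c); have := eq_comp (ne c); rewrite !inE.
by rewrite -!/(adjacent _ _ _) => -> ->; rewrite h1 h2.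
Qed.

(** Multiplication by x = v_- on the circle of [u], which exchanges v_+ and
    v_-. *)
Definition flipsub u x : state D :=
  mk_state (tag x) (superscript x) (fun v => subscript x v (+)
    (circle_of (tag x) v == circle_of (tag x) u)).

Lemma flipsub_constant u x : constant_on (arc (tag x)) (fun v => subscript x v (+)
    (circle_of (tag x) v == circle_of (tag x) u)).
Proof. by move=> v w vw; rewrite (subscript_constant vw) (circle_constant u vw). Qed.

Lemma subscript_flipsub u x v : subscript (flipsub u x) v =
  subscript x v (+) (circle_of (tag x) v == circle_of (tag x) u).
Proof. exact/subscript_mk/flipsub_constant. Qed.

Lemma flipsubK u : involutive (flipsub u).
Proof.
by move=> x; apply: state_ext => // v; rewrite !subscript_flipsub -addbA addbb addbF.
Qed.

(** The string with all subscripts + generates the module of a smoothing under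
    the multiplications by v_- on circles. *)
Lemma state_flip_ind (P : state D -> Prop) :
  (forall a p, P (mk_state a p xpredT)) ->
  (forall u x, P x -> P (flipsub u x)) -> forall x, P x.
Proof.
move=> P0 PS x.
(* induction on the number of nodes that carry the subscript - *)
have [n] := ubnP #|[pred u | ~~ subscript x u]|.
elim: n x => // n IH x lt_n.
have [u /= xu|x0] := pickP [pred u | ~~ subscript x u]; last first.
  rewrite (_ : x = mk_state (tag x) (superscript x) xpredT) //.
  apply: state_ext => // u; rewrite subscript_mk //.
  by have /negbFE -> := x0 u.
rewrite -(flipsubK u x); apply/PS/IH; rewrite -ltnS; apply: leq_trans lt_n.
rewrite ltnS; apply: proper_card; apply/properP; split.
  apply/subsetP => v; rewrite !inE subscript_flipsub.
  case: eqP => [/eqP|_]; last by rewrite addbF.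
  by move/(constant_circle (@subscript_constant x)) ->; rewrite (negPf xu).
by exists u; rewrite !inE ?subscript_flipsub ?eqxx // (negPf xu).
Qed.

End States.

Lemma circle_of_component (D : diagram) (a : smoothing D) u v :
  (circle_of a u == circle_of a v) = (component a u == component a v).
Proof. by rewrite -val_eqE. Qed.

Opaque circle_of.

Definition mobius (D : diagram) (a : smoothing D) c :=
  same_circle a c && same_circle (flip a c) c.

(** The target of the edge at [c] in the colour basis: the colouring is kept.
    Flips in either direction are allowed, so that [switch c] is an involution
    on the states monochrome at [c]. *)
HB.lock Definition switch (D : diagram) (c : crossing D) (x : state D) : state D :=
  mk_state (flip (tag x) c) (superscript x (+) mobius (tag x) c) (subscript x).

Lemma tag_switch (D : diagram) c (x : state D) : tag (switch c x) = flip (tag x) c.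
Proof. by rewrite switch.unlock. Qed.

Lemma superscript_switch (D : diagram) c (x : state D) :
  superscript (switch c x) = superscript x (+) mobius (tag x) c.
Proof. by rewrite switch.unlock. Qed.

Lemma subscript_switch (D : diagram) c (x : state D) :
  monochrome c x -> subscript (switch c x) =1 subscript x.
Proof.
move=> bx; rewrite switch.unlock.
exact/subscript_mk/(constant_flip (@subscript_constant _ x))/eqP.
Qed.

Section ColourBasis.
Variables (R : comPzRingType) (D : diagram).
Implicit Types (u v : node D) (c : crossing D) (a b : smoothing D).
Implicit Types (x y z s : state D) (f : node D -> bool).

Definition colour_sign (b : bool) : R := if b then 1 else -1.

Lemma colour_signM (b : bool) : colour_sign b * colour_sign b = 1.
Proof. by case: b; rewrite /colour_sign ?mulrNN mulr1. Qed.

(** The factor 2k occurs in a split and in a Moebius band from the lower to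
    the upper superscript. *)
Definition weight_exp c x : nat :=
  ~~ same_circle (flip (tag x) c) c + (mobius (tag x) c && ~~ superscript x).

(** On the idempotent of colour k, Delta' is multiplication by 2k since it
    sends 1 to x # 1 + 1 # x, and eta' from the shifted copy is multiplication
    by 2k since it is 2x. *)
Definition edge_weight c x : R := (2%:R * colour_sign (subscript x (sw c))) ^+
  weight_exp c x.

(** The value of the string [x] at the colouring [y], the variable v_- of a
    circle being evaluated at the sign of its colour. The subscripts + and -
    are identified with the colours 1 and -1. *)
Definition character x y : R :=
  \prod_(C in circles (tag x))
     (-1) ^+ [exists u in C, ~~ subscript x u && ~~ subscript y u].

(** Coefficients of the strings in the basis of idempotents of the colourings. *)
Definition char_mat x y : R :=
  if (tag x == tag y) && (superscript x == superscript y) then character x y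
  else 0.

Lemma char_mat_sym x y : char_mat x y = char_mat y x.
Proof.
rewrite /char_mat (eq_sym (tag x)) (eq_sym (superscript x)).
case: andP => // -[/eqP eq_tag _]; rewrite /character eq_tag.
by apply: eq_bigr => C _; under eq_existsb do rewrite [X in _ && X]andbC.
Qed.

Lemma char_mat_mk_plus a p x : char_mat (mk_state a p xpredT) x =
  ((a == tag x) && (p == superscript x))%:R.
Proof.
rewrite /char_mat /superscript /=; case: ifP => // _; rewrite /character /=.
rewrite big1 // => C _; case: existsP => // -[u].
by rewrite subscript_mk //= andbF.
Qed.

Lemma char_mat_flipsub u x y : char_mat (flipsub u x) y =
  colour_sign (subscript y u) * char_mat x y.
Proof.
rewrite /char_mat /superscript /= -/(superscript x) -/(superscript y).
case: ifP => [/andP[/eqP eq_tag _]|_]; last by rewrite mulr0.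
rewrite /character /=.
have uC : component (tag x) u \in circles (tag x) by apply: imset_f.
rewrite (bigD1 _ uC) /= [in RHS](bigD1 _ uC) /= mulrA; congr (_ * _); last first.
  apply: eq_bigr => C /andP[aC neqC]; congr (_ ^+ nat_of_bool _).
  apply: eq_existsb => v; case vC: (v \in C) => //=.
  rewrite subscript_flipsub (_ : (_ == _) = false) ?addbF //.
  apply: contraNF neqC; rewrite circle_of_component => /eqP <-.
  have /imsetP[w _ defC] := aC; rewrite defC in vC *.
  by rewrite inE -circle_ofE circle_of_component in vC.
have ex s : tag s = tag x ->
    [exists v in component (tag x) u, ~~ subscript s v && ~~ subscript y v] =
    ~~ subscript s u && ~~ subscript y u.
  move=> eq_s; apply/existsP/idP => [[v /andP[]]|]; last first.
    by exists u; rewrite inE connect0.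
  rewrite inE -circle_ofE => cuv; have cuv' := cuv.
  rewrite -eq_s in cuv; rewrite eq_tag in cuv'.
  by rewrite (constant_circle (@subscript_constant _ s) cuv) (constant_circle
    (@subscript_constant _ y) cuv').
rewrite !ex // subscript_flipsub eqxx addbT.
by rewrite /colour_sign; case: (subscript x u); case: (subscript y u);
  rewrite /= ?expr0 ?expr1 ?mulr1 ?mulrNN ?mulr1.
Qed.

Lemma tag_flipsub u x : tag (flipsub u x) = tag x.
Proof. by []. Qed.

Lemma superscript_flipsub u x : superscript (flipsub u x) = superscript x.
Proof. by []. Qed.

Lemma circle_sw_ne a c u :
  if same_circle a c
  then (circle_of a (sw c) == circle_of a u) = (circle_of a (ne c) == circle_of a u)
  else ~~ ((circle_of a (sw c) == circle_of a u) &&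
    (circle_of a (ne c) == circle_of a u)).
Proof.
rewrite /same_circle; case: ifP => [/eqP->//|neq]; apply: contraFN neq.
by move=> /andP[/eqP-> /eqP->].
Qed.

Lemma through_flip_sym a c u :
  (circle_of a (sw c) == circle_of a u) || (circle_of a (ne c) == circle_of a u) =
  (circle_of (flip a c) (sw c) == circle_of (flip a c) u) ||
  (circle_of (flip a c) (ne c) == circle_of (flip a c) u).
Proof.
exact: etrans (congr2 orb (eq_sym _ _) (eq_sym _ _))
  (etrans (through_flip a c u) (congr2 orb (eq_sym _ _) (eq_sym _ _))).
Qed.

(** The maps m', Delta' and eta' are linear over A, hence commute with the
    multiplication by v_- on a circle through [u]. *)
Lemma edge_flipsub c u x y : tag y = flip (tag x) c ->
  edge_coef R c (flipsub u x) (flipsub u y) = edge_coef R c x y.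
Proof.
move=> eq_y.
have [[tx px] sx] := (tag_flipsub u x, superscript_flipsub u x, subscript_flipsub u x).
have [[ty py] sy] := (tag_flipsub u y, superscript_flipsub u y, subscript_flipsub u y).
move: (flipsub u x) (flipsub u y) tx px sx ty py sy => x' y' tx px sx ty py sy.
rewrite /edge_coef tx ty px py !sx !sy.
have -> : agree_away c x' y' = agree_away c x y.
  apply: eq_forallb => v; rewrite sx sy tx.
  case: (boolP (circle_of (tag x) v != circle_of (tag x) (sw c))) => //= h1.
  case: (boolP (circle_of (tag x) v != circle_of (tag x) (ne c))) => //= h2.
  have := component_away h1 h2; rewrite -eq_y => /setP/(_ u).
  rewrite !inE -!circle_ofE => ->.
  by case: (circle_of _ _ == _); do 2!case: (subscript _ v).
case: ifP => // _.
(* a finite check once the incidences of the circle of u with the crossing,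
   before and after the flip, are recorded as booleans *)
have := through_flip_sym (tag x) c u; have := same_circle_or (tag x) c.
have := circle_sw_ne (tag x) c u; have := circle_sw_ne (tag y) c u.
clear x' y' tx px sx ty py sy; rewrite -eq_y /same_circle.
generalize (circle_of (tag x) (sw c) == circle_of (tag x) (ne c)) as sx.
generalize (circle_of (tag y) (sw c) == circle_of (tag y) (ne c)) as sy.
generalize (circle_of (tag x) (sw c) == circle_of (tag x) u) as b1.
generalize (circle_of (tag x) (ne c) == circle_of (tag x) u) as b2.
generalize (circle_of (tag y) (sw c) == circle_of (tag y) u) as b3.
generalize (circle_of (tag y) (ne c) == circle_of (tag y) u) as b4.
generalize (superscript x) (superscript y).
generalize (subscript x (sw c)) (subscript x (ne c)).
generalize (subscript y (sw c)) (subscript y (ne c)).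
move=> k1 k2 k3 k4 p q b4 b3 b2 b1 sy sx; clear.
case: sx; case: sy => //=; case: b1; case: b2 => //=; case: b3; case: b4 => //= _ _ _ _.
all: by case: k1; case: k2; case: k3; case: k4; case: p; case: q.
Qed.

(** The edge map at [c] followed by the change of basis; [colour_sum] is the
    change of basis followed by the edge map in terms of colours. *)
Definition edge_sum c s z : R :=
  \sum_(y | tag y == flip (tag s) c) edge_coef R c s y * char_mat y z.

Definition colour_sum c s z : R :=
  \sum_x char_mat s x * ((monochrome c x && (z == switch c x))%:R * edge_weight c x).

Lemma edge_sum_flipsub c u s z :
  edge_sum c (flipsub u s) z = colour_sign (subscript z u) * edge_sum c s z.
Proof.
rewrite /edge_sum mulr_sumr (reindex_inj (can_inj (@flipsubK D u))) /=.
apply: eq_bigr => y /eqP eq_y.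
by rewrite edge_flipsub // char_mat_flipsub mulrCA.
Qed.

Lemma colour_sum_flipsub c u s z :
  colour_sum c (flipsub u s) z = colour_sign (subscript z u) * colour_sum c s z.
Proof.
rewrite /colour_sum mulr_sumr; apply: eq_bigr => x _.
rewrite char_mat_flipsub -mulrA; case bx: (monochrome c x);
  last by rewrite !mul0r !mulr0.
case: eqP => [->|_]; last by rewrite !mul0r !mulr0.
by rewrite subscript_switch.
Qed.

End ColourBasis.

Lemma tag_mk (D : diagram) (a : smoothing D) p f : tag (mk_state a p f) = a.
Proof. by []. Qed.

Lemma same_circleE (D : diagram) (a : smoothing D) c :
  same_circle a c = (circle_of a (sw c) == circle_of a (ne c)).
Proof. by []. Qed.

Lemma monochromeE (D : diagram) (x : state D) c :
  monochrome c x = (subscript x (sw c) == subscript x (ne c)).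
Proof. by []. Qed.

Lemma agree_awayE (D : diagram) (c : crossing D) (x y : state D) :
  agree_away c x y = [forall u,
    (circle_of (tag x) u != circle_of (tag x) (sw c)) ==>
    (circle_of (tag x) u != circle_of (tag x) (ne c)) ==>
    (subscript x u == subscript y u)].
Proof. by []. Qed.

Opaque circle_of mk_state flipsub superscript subscript sw ne nw se same_circle flip.
Opaque agree_away.

(** * The edge maps in the colour basis *)

Section Intertwining.
Variables (R : comPzRingType) (D : diagram).
Implicit Types (u v : node D) (c : crossing D) (a b : smoothing D).
Implicit Types (x y z s : state D) (f : node D -> bool).

Lemma away_flip a c v :
  circle_of a v != circle_of a (sw c) -> circle_of a v != circle_of a (ne c) ->
  circle_of (flip a c) v != circle_of (flip a c) (sw c) /\
  circle_of (flip a c) v != circle_of (flip a c) (ne c).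
Proof.
have := through_flip a c v.
generalize (circle_of a v == circle_of a (sw c)).
generalize (circle_of a v == circle_of a (ne c)).
generalize (circle_of (flip a c) v == circle_of (flip a c) (sw c)).
generalize (circle_of (flip a c) v == circle_of (flip a c) (ne c)).
by do 4!case.
Qed.

Lemma through_ind a c v (P : Prop) :
  (circle_of a v != circle_of a (sw c) -> circle_of a v != circle_of a (ne c) -> P) ->
  (circle_of (flip a c) v == circle_of (flip a c) (sw c) -> P) ->
  (circle_of (flip a c) v == circle_of (flip a c) (ne c) -> P) -> P.
Proof.
have := through_flip a c v.
generalize (circle_of a v == circle_of a (sw c)).
generalize (circle_of a v == circle_of a (ne c)).
generalize (circle_of (flip a c) v == circle_of (flip a c) (sw c)).
generalize (circle_of (flip a c) v == circle_of (flip a c) (ne c)).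
by do 4!case; move=> //= _ H1 H2 H3; do ?[exact: H2 | exact: H3 | exact: H1].
Qed.

(** The target of an edge is determined by the superscript and by the
    subscripts of the circles through the crossing. *)
Lemma eq_state_through a c x y g :
  tag x = a -> tag y = flip a c -> tag g = flip a c ->
  (forall v, circle_of a v != circle_of a (sw c) ->
             circle_of a v != circle_of a (ne c) -> subscript g v = subscript x v) ->
  (y == g) = [&& superscript y == superscript g, agree_away c x y,
              subscript y (sw c) == subscript g (sw c) &
              subscript y (ne c) == subscript g (ne c)].
Proof.
move=> tx ty tg xg; apply/eqP/and4P => [->|[/eqP e1 e2 /eqP e3 /eqP e4]].
  split=> //; rewrite agree_awayE; apply/forallP => v; rewrite tx.
  by apply/implyP => h1; apply/implyP => h2; rewrite (xg v).
rewrite agree_awayE in e2; move/forallP: e2 => e2.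
apply: state_ext => [||v]; rewrite ?ty ?tg //.
have inv_y := @subscript_constant _ y; rewrite ty in inv_y.
have inv_g := @subscript_constant _ g; rewrite tg in inv_g.
apply: (@through_ind a c v) => [h1 h2|h|h].
- by rewrite (xg v h1 h2); move: (e2 v); rewrite tx h1 h2 => /eqP.
- by rewrite (constant_circle inv_y h) (constant_circle inv_g h).
- by rewrite (constant_circle inv_y h) (constant_circle inv_g h).
Qed.

Lemma mk_plus_sub a p v : subscript (mk_state a p xpredT) v.
Proof. by rewrite subscript_mk. Qed.

(** m'(1 # 1) = 1, Delta'(1) = x # 1 + 1 # x, eta'(1) = 1 from the upper and
    2x from the lower copy. *)
Lemma edge_coef_plus a c p y : tag y = flip a c ->
  edge_coef R c (mk_state a p xpredT) y =
  if ~~ same_circle a c then (y == mk_state (flip a c) p xpredT)%:R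
  else if ~~ same_circle (flip a c) c then
    (y == flipsub (sw c) (mk_state (flip a c) p xpredT))%:R +
    (y == flipsub (ne c) (mk_state (flip a c) p xpredT))%:R
  else if p then (y == mk_state (flip a c) false xpredT)%:R
  else 2%:R * (y == flipsub (sw c) (mk_state (flip a c) true xpredT))%:R.
Proof.
move=> ty.
have plusE q : (y == mk_state (flip a c) q xpredT) =
    [&& superscript y == q, agree_away c (mk_state a p xpredT) y,
        subscript y (sw c) & subscript y (ne c)].
  have H v : circle_of a v != circle_of a (sw c) ->
      circle_of a v != circle_of a (ne c) ->
      subscript (mk_state (flip a c) q xpredT) v = subscript (mk_state a p xpredT) v.
    by move=> _ _; transitivity true; rewrite mk_plus_sub.
  have h := eq_state_through (tag_mk a p xpredT) ty (tag_mk (flip a c) q xpredT) H.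
  by etransitivity; first exact h; rewrite superscript_mk !mk_plus_sub !eqb_id.
have minusE q w : corner c w -> (y == flipsub w (mk_state (flip a c) q xpredT)) =
    [&& superscript y == q, agree_away c (mk_state a p xpredT) y,
        subscript y (sw c) == (circle_of (flip a c) (sw c) != circle_of (flip a c) w) &
        subscript y (ne c) == (circle_of (flip a c) (ne c) != circle_of (flip a c) w)].
  move=> cw; have tf := tag_flipsub w (mk_state (flip a c) q xpredT).
  have sf v : subscript (flipsub w (mk_state (flip a c) q xpredT)) v =
      (circle_of (flip a c) v != circle_of (flip a c) w).
    by rewrite subscript_flipsub mk_plus_sub.
  have H v : circle_of a v != circle_of a (sw c) ->
      circle_of a v != circle_of a (ne c) ->
      subscript (flipsub w (mk_state (flip a c) q xpredT)) v =
        subscript (mk_state a p xpredT) v.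
    move=> h1 h2; rewrite sf mk_plus_sub; have [h3 h4] := away_flip h1 h2.
    apply/negP => h5; have := corner_circle (flip a c) cw.
    by rewrite -(eqP h5) (negPf h3) (negPf h4).
  have h := eq_state_through (tag_mk a p xpredT) ty tf H.
  by etransitivity; first exact h; rewrite superscript_flipsub superscript_mk !sf.
have csw : corner c (sw c) by rewrite /corner mem_head.
have cne : corner c (ne c) by rewrite /corner !inE eqxx !orbT.
have := plusE p; have := plusE false.
have := minusE p _ csw; have := minusE p _ cne; have := minusE true _ csw.
rewrite (eqxx (circle_of (flip a c) (sw c))) (eqxx (circle_of (flip a c) (ne c))).
rewrite (eq_sym (circle_of (flip a c) (ne c)) (circle_of (flip a c) (sw c))).
have : same_circle (flip a c) c -> subscript y (sw c) = subscript y (ne c).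
  by rewrite -ty => /(constant_circle (@subscript_constant _ y)).
have := same_circle_or a c.
rewrite /edge_coef tag_mk ty superscript_mk !mk_plus_sub !same_circleE.
generalize (y == mk_state (flip a c) p xpredT) (y == mk_state (flip a c) false xpredT).
generalize (y == flipsub (sw c) (mk_state (flip a c) p xpredT)).
generalize (y == flipsub (ne c) (mk_state (flip a c) p xpredT)).
generalize (y == flipsub (sw c) (mk_state (flip a c) true xpredT)).
generalize (circle_of a (sw c) == circle_of a (ne c)) as s1.
generalize (circle_of (flip a c) (sw c) == circle_of (flip a c) (ne c)) as s2.
generalize (agree_away c (mk_state a p xpredT) y) as aw.
generalize (subscript y (sw c)) as k1.
generalize (subscript y (ne c)) as k2.
generalize (superscript y) as q.
move=> q k2 k1 aw s2 s1 e1 e2 e3 e4 e5; clear => so sy -> -> -> -> ->.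
case: aw => //=; rewrite ?andbF /=; last first.
  by case: s1 so; case: s2 sy; case: p; rewrite /= ?addr0 ?mulr0.
case: s1 so; case: s2 sy => //= sy _.
- have {sy} <- := sy isT; by case: p; case: q; case: k1; rewrite //= ?mulr1 ?mulr0.
- by clear sy; case: p; case: q; case: k1; case: k2;
    rewrite //= ?mulr1 ?mulr0 ?mul1r ?mul0r ?addr0 ?add0r.
- have {sy} <- := sy isT; by case: p; case: q; case: k1; rewrite //= ?mulr1 ?mulr0.
Qed.

Lemma edge_sum_plus a c p z : tag z = flip a c ->
  edge_sum R c (mk_state a p xpredT) z =
  if ~~ same_circle a c then (p == superscript z)%:R
  else if ~~ same_circle (flip a c) c then
    (colour_sign R (subscript z (sw c)) + colour_sign R (subscript z (ne c))) *
    (p == superscript z)%:R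
  else if p then (false == superscript z)%:R
  else 2%:R * colour_sign R (subscript z (sw c)) * (true == superscript z)%:R.
Proof.
move=> tz; rewrite /edge_sum.
under eq_bigr => y /eqP ty do rewrite edge_coef_plus //.
have sum1 g : tag g = flip a c ->
    \sum_(y | tag y == flip a c) (y == g)%:R * char_mat R y z = char_mat R g z.
  move=> tg; rewrite (bigD1 g) /= ?tg ?eqxx // mul1r big1 ?addr0 // => y.
  by case/andP => _ /negPf->; rewrite mul0r.
have E1 q : char_mat R (mk_state (flip a c) q xpredT) z = (q == superscript z)%:R.
  by rewrite char_mat_mk_plus tz (eqxx (flip a c)).
have sumP q := etrans (sum1 _ (tag_mk (flip a c) q xpredT)) (E1 q).
have sumM q w : \sum_(y | tag y == flip a c)
    (y == flipsub w (mk_state (flip a c) q xpredT))%:R * char_mat R y z =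
    colour_sign R (subscript z w) * (q == superscript z)%:R.
  by rewrite (sum1 _ (tag_flipsub w (mk_state (flip a c) q xpredT)))
    char_mat_flipsub E1.
case: (~~ same_circle a c); first exact: sumP.
case: (~~ same_circle (flip a c) c).
  rewrite mulrDl -(sumM p (sw c)) -(sumM p (ne c)) -big_split.
  by apply: eq_bigr => y _; rewrite mulrDl.
case: p; first exact: sumP.
rewrite -mulrA -(sumM true (sw c)) mulr_sumr.
by apply: eq_bigr => y _; rewrite mulrA.
Qed.

Lemma colour_sum_plus a c p z : tag z = flip a c ->
  colour_sum R c (mk_state a p xpredT) z =
  if monochrome c z && (superscript z == p (+) mobius a c) then
    (2%:R * colour_sign R (subscript z (sw c))) ^+
      (~~ same_circle (flip a c) c + (mobius a c && ~~ p))
  else 0.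
Proof.
move=> tz; rewrite /colour_sum.
case: ifP => [/andP[bz /eqP pz]|nz]; last first.
  rewrite big1 // => x _; rewrite char_mat_mk_plus.
  case: andP => [[/eqP ta /eqP px]|_]; last by rewrite mul0r.
  case: andP => [[bx /eqP zx]|_]; last by rewrite mul0r mulr0.
  case/negP: nz; rewrite zx superscript_switch -ta px eqxx andbT.
  by rewrite monochromeE !(subscript_switch bx) -monochromeE.
have inv_z : constant_on (arc a) (subscript z).
  have := @subscript_constant _ z; rewrite tz => inv_z.
  by have := constant_flip inv_z (eqP bz); rewrite (flipK c a).
(* the only colouring whose switch is z *)
pose x1 := mk_state a p (subscript z).
have s1 : subscript x1 =1 subscript z by apply: subscript_mk.
have b1 : monochrome c x1 by move: bz; rewrite !monochromeE !s1.
have z1 : z = switch c x1.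
  apply: state_ext => [||u]; rewrite ?tag_switch ?superscript_switch ?tz ?pz //.
  by rewrite (subscript_switch b1) s1.
rewrite (bigD1 x1) //= big1 ?addr0 => [|x neq_x]; last first.
  rewrite char_mat_mk_plus; case: andP => [[/eqP ta /eqP px]|_]; last by rewrite mul0r.
  case: andP => [[bx /eqP zx]|_]; last by rewrite mul0r mulr0.
  case/eqP: neq_x; apply: state_ext => // u.
  by rewrite s1 zx (subscript_switch bx).
rewrite char_mat_mk_plus /x1 tag_mk superscript_mk !eqxx mul1r -/x1 b1 -z1 eqxx mul1r.
by rewrite /edge_weight s1 /weight_exp /x1 tag_mk superscript_mk.
Qed.

(** Both sides are multiplied by the same sign when [s] is multiplied by v_-
    on a circle, so the comparison is needed only when all subscripts of [s]
    are +. *)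
Lemma edge_sumE c s z : edge_sum R c s z = colour_sum R c s z.
Proof.
elim/state_flip_ind: s => [a p|u s IH]; last first.
  by rewrite edge_sum_flipsub colour_sum_flipsub IH.
have [tz|ntz] := eqVneq (tag z) (flip a c); last first.
  rewrite /edge_sum /colour_sum !big1 // => [x _|y /eqP ty].
    rewrite char_mat_mk_plus; case: andP => [[/eqP ta _]|_]; last by rewrite mul0r.
    case: (eqVneq z (switch c x)) => [zx|_]; last by rewrite andbF mul0r mulr0.
    by rewrite zx tag_switch -ta eqxx in ntz.
  rewrite /char_mat ty tag_mk eq_sym (negPf ntz) mulr0 //.
rewrite edge_sum_plus // colour_sum_plus // monochromeE /mobius.
have sz : same_circle (flip a c) c -> subscript z (sw c) = subscript z (ne c).
  by rewrite -tz => /(constant_circle (@subscript_constant _ z)).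
have := same_circle_or a c; move: sz.
generalize (same_circle a c) (same_circle (flip a c) c) (superscript z).
generalize (subscript z (sw c)) (subscript z (ne c)).
clear; move=> k1 k2 s1 s2 q sz.
case: s1; case: s2 sz => //= sz _.
- rewrite -(sz isT) eqxx; clear sz.
  by case: p; case: q; case: k1; rewrite /= ?mulr1 ?mulr0 ?expr1.
- clear sz; case: p; case: q; case: k1; case: k2;
    by rewrite /= /colour_sign ?mulr1 ?mulr0 ?expr1 ?addrN ?addNr ?mulrN1 ?mulr1
      -?opprD.
- rewrite -(sz isT) eqxx; clear sz.
  by case: p; case: q; case: k1; rewrite /= ?mulr1 ?mulr0 ?expr1.
Qed.

End Intertwining.

(** * Faces of the cube in the colour basis *)

Section Faces.
Variable D : diagram.
Implicit Types (u v : node D) (c : crossing D) (a b : smoothing D).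
Implicit Types (x y z s : state D) (f : node D -> bool).

(** A flip at [c] keeps these circles, which makes the numbers of circles
    comparable. *)
Definition away_circles a c : {set {set node D}} :=
  [set C in circles a | (sw c \notin C) && (ne c \notin C)].

Lemma mem_component a u v : (v \in component a u) = (circle_of a u == circle_of a v).
Proof. by rewrite inE circle_ofE. Qed.

Lemma away_circles_flip_sub a c : away_circles a c \subset away_circles (flip a c) c.
Proof.
apply/subsetP => C; rewrite /away_circles 2!in_set.
case/and3P => /imsetP[u _ ->]; rewrite !mem_component => h1 h2.
have eqc := component_away h1 h2.
by rewrite -{1}eqc component_circle h1 h2.
Qed.

Lemma away_circles_flip a c : away_circles (flip a c) c = away_circles a c.
Proof.
apply/eqP; rewrite eqEsubset away_circles_flip_sub andbT.
by have := away_circles_flip_sub (flip a c) c; rewrite (flipK c a).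
Qed.

Lemma card_circles a c : #|circles a| = (#|away_circles a c| +
  (~~ same_circle a c).+1)%N.
Proof.
have defC : circles a =
    away_circles a c :|: [set component a (sw c); component a (ne c)].
  apply/setP => C; rewrite /away_circles !inE; case: (boolP (C \in circles a)) => /=.
    case/imsetP => u _ ->; rewrite !mem_component !circle_of_component.
    by do 2!case: eqP.
  by move=> nC; symmetry; apply/norP; split; apply: contraNneq nC => ->;
    apply: component_circle.
rewrite defC cardsU (_ : _ :&: _ = set0) ?cards0 ?subn0 ?cards2.
  by rewrite same_circleE circle_of_component addnC addSn addnC.
apply/setP => C; rewrite /away_circles !inE; apply/negP => /andP[/and3P[_ n1 n2]].
by case/orP => /eqP defC'; move: n1 n2; rewrite defC' !mem_component eqxx.
Qed.

Lemma card_circles_flip a c :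
  (#|circles a| + ~~ same_circle (flip a c) c =
    #|circles (flip a c)| + ~~ same_circle a c)%N.
Proof. by rewrite !(card_circles _ c) away_circles_flip; lia. Qed.

(** A merge or a split changes the number of circles by one and a Moebius band
    keeps it. So the superscript of the end of a path in the cube depends on
    the ends only. *)
Lemma mobius_parity a c :
  mobius a c = ~~ (odd #|circles a| (+) odd #|circles (flip a c)|).
Proof.
have := card_circles_flip a c; have := same_circle_or a c; rewrite /mobius.
move/orP => so /(congr1 odd); rewrite !oddD.
by move: so; do 2!case: (same_circle _ c) => /=; do 2!case: (odd _) => //= -[].
Qed.

Lemma superscript_switchC c c' x :
  superscript (switch c' (switch c x)) = superscript (switch c (switch c' x)).
Proof.
rewrite superscript_switch.
rewrite superscript_switch.
rewrite tag_switch.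
rewrite [in RHS]superscript_switch.
rewrite [in RHS]superscript_switch.
rewrite [in RHS]tag_switch.
rewrite !mobius_parity.
rewrite (flipC _ c').
generalize (odd #|circles (flip (flip (tag x) c) c')|).
generalize (odd #|circles (flip (tag x) c)|).
generalize (odd #|circles (flip (tag x) c')|).
generalize (odd #|circles (tag x)|).
generalize (superscript x).
by do 5!case.
Qed.

(** The exponent of an edge is a coboundary up to a constant, so the two paths
    across a face have equal total exponents. *)
Lemma weight_expE c x :
  (2 * weight_exp c x + #|circles (tag x)| + superscript x =
   #|circles (tag (switch c x))| + superscript (switch c x) + 1)%N.
Proof.
have := card_circles_flip (tag x) c; have := same_circle_or (tag x) c.
rewrite tag_switch superscript_switch /weight_exp /mobius.
by do 2!case: (same_circle _ c) => //=; case: (superscript x) => /= _; lia.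
Qed.

Lemma monochrome_switch c c' x : monochrome c x -> monochrome c' (switch c x) =
  monochrome c' x.
Proof. by move=> bx; rewrite !monochromeE !(subscript_switch bx). Qed.

Lemma switchC c c' x : monochrome c x -> monochrome c' x ->
  switch c' (switch c x) = switch c (switch c' x).
Proof.
move=> bx bx'; apply: state_ext => [||u].
- by rewrite !tag_switch flipC.
- exact: superscript_switchC.
- by rewrite !subscript_switch // monochrome_switch.
Qed.

Lemma same_circle_flip_away a c c' f : constant_on (arc a) f ->
  f (sw c) = f (ne c) -> f (sw c') <> f (sw c) ->
  same_circle (flip a c) c' = same_circle a c'.
Proof.
move=> inv_f eq_f neq_f; rewrite !same_circleE !circle_of_component.
have n1 : circle_of a (sw c') != circle_of a (sw c).
  by apply/negP => /(constant_circle inv_f).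
have n2 : circle_of a (sw c') != circle_of a (ne c).
  by apply/negP => /(constant_circle inv_f); rewrite -eq_f.
by rewrite -!circle_of_component -!mem_component (component_away n1 n2).
Qed.

Lemma weight_exp_commute_eq c c' x :
  (weight_exp c x + weight_exp c' (switch c x) =
    weight_exp c' x + weight_exp c (switch c' x))%N.
Proof.
have := weight_expE c x; have := weight_expE c' (switch c x).
have := weight_expE c' x; have := weight_expE c (switch c' x).
rewrite (superscript_switchC c c') !tag_switch flipC; lia.
Qed.

(** The flip at [c] does not affect the circles through [c'], whose colour is
    different. It can affect the weight only by changing the superscript when
    both edges are Moebius bands, and then [no_two_mobius] makes the colours
    equal. *)
Lemma weight_exp_commute_neq c c' x : monochrome c x -> monochrome c' x ->
  subscript x (sw c) <> subscript x (sw c') -> weight_exp c' (switch c x) =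
    weight_exp c' x.
Proof.
rewrite !monochromeE => /eqP bx /eqP bx' neq.
have inv_x := @subscript_constant _ x.
have e1 : same_circle (flip (tag x) c) c' = same_circle (tag x) c'.
  by apply: (same_circle_flip_away inv_x bx) => /esym.
have e2 : same_circle (flip (flip (tag x) c) c') c' = same_circle (flip (tag x) c') c'.
  rewrite flipC; apply: (same_circle_flip_away (constant_flip inv_x bx') bx) =>
    /esym //.
rewrite /weight_exp superscript_switch tag_switch /mobius e1 e2.
case: (boolP (same_circle (tag x) c' && same_circle (flip (tag x) c') c')) => //=
  /andP[s1 s2].
case: (boolP (same_circle (tag x) c && same_circle (flip (tag x) c) c));
  last by rewrite addbF.
case/andP => s3 s4; case: neq.
exact/(constant_circle inv_x)/no_two_mobius.
Qed.

End Faces.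

(** * Contraction to the alternating states *)

Section Contraction.
Variables (R : comPzRingType) (D : diagram).
Hypothesis two_invertible : exists half : R, 2%:R * half = 1.
Implicit Types (u v : node D) (c : crossing D) (a b : smoothing D).
Implicit Types (x y z s : state D) (f : node D -> bool).

Definition state_height x : int := height (tag x).

Lemma height_flip a c : ~~ a c -> height (flip a c) = height a + 1.
Proof.
move=> nac; rewrite /height.
have -> : [set c0 | flip a c c0] = c |: [set c0 | a c0].
  apply/setP => d; rewrite !inE ffunE; case: eqP => [->|_] //.
by rewrite cardsU1 inE nac add1n -addn1 PoszD addrAC.
Qed.

Lemma state_height_switch c x : ~~ tag x c -> state_height (switch c x) =
  state_height x + 1.
Proof. by move=> nc; rewrite /state_height tag_switch height_flip. Qed.

Variable half : R.
Hypothesis halfE : 2%:R * half = 1.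
Variable e : smoothing D -> crossing D -> bool.
Hypothesis e_sign : sign_convention e.

Definition edge_unit c x : R := (-1) ^+ e (tag x) c * edge_weight R c x.
Definition edge_unit_inv c x : R :=
  (-1) ^+ e (tag x) c * (half * colour_sign R (subscript x (sw c))) ^+ weight_exp c x.

Lemma edge_unitK c x : edge_unit c x * edge_unit_inv c x = 1.
Proof.
rewrite /edge_unit /edge_unit_inv /edge_weight mulrACA -!exprMn mulrNN mulr1
  expr1n mul1r.
by rewrite mulrACA halfE mul1r colour_signM expr1n.
Qed.

Lemma set_switch c x : monochrome c x -> ~~ tag x c -> tag (switch c x) c.
Proof. by rewrite tag_switch flip_id. Qed.

Lemma set_switch_neq c d x : monochrome c x -> d != c -> tag (switch c x) d = tag x d.
Proof. by rewrite tag_switch ffunE => _ /negPf->. Qed.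

Lemma mobius_flip a c : mobius (flip a c) c = mobius a c.
Proof. by rewrite /mobius (flipK c a) andbC. Qed.

Lemma switchK c x : monochrome c x -> switch c (switch c x) = x.
Proof.
move=> bx; apply: state_ext => [||u].
- by rewrite !tag_switch (flipK c (tag x)).
- rewrite superscript_switch superscript_switch tag_switch mobius_flip.
  by rewrite -addbA addbb addbF.
- by rewrite !subscript_switch // monochrome_switch.
Qed.

Lemma switch_inj c x y : monochrome c x -> monochrome c y -> ~~ tag x c -> ~~ tag y c ->
  switch c x = switch c y -> x = y.
Proof. by move=> bx b_y _ _ eq_n; rewrite -(switchK bx) eq_n switchK. Qed.

Lemma switch_surj c x : monochrome c x -> tag x c ->
  exists x0, [/\ monochrome c x0, ~~ tag x0 c & switch c x0 = x].
Proof.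
move=> bx tx; exists (switch c x); split; first by rewrite monochrome_switch.
  by rewrite tag_switch flip_id negbK.
exact: switchK.
Qed.

Lemma edge_weight_switch c d x : monochrome c x ->
  edge_weight R d (switch c x) = (2%:R * colour_sign R (subscript x (sw d))) ^+
    weight_exp d (switch c x).
Proof. by move=> bx; rewrite /edge_weight (subscript_switch bx). Qed.

Lemma sign_face (b1 b2 b3 b4 : bool) : b1 (+) b2 (+) b3 (+) b4 ->
  (-1) ^+ b1 * (-1) ^+ b2 = - ((-1) ^+ b3 * (-1) ^+ b4) :> R.
Proof.
by case: b1; case: b2; case: b3; case: b4 => //= _;
  rewrite ?expr0 ?expr1 ?mulrNN ?mulr1 ?mul1r ?opprK.
Qed.

(** With equal colours the powers of the common 2k agree; with different
    colours each weight is unaffected by the other flip. The sign comes from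
    the sign convention. *)
Lemma edge_unitC c d x : c != d -> monochrome c x -> monochrome d x ->
  ~~ tag x c -> ~~ tag x d ->
  edge_unit c x * edge_unit d (switch c x) =
    - (edge_unit d x * edge_unit c (switch d x)).
Proof.
move=> neq bc bd tc td; rewrite /edge_unit !tag_switch.
have eqw : edge_weight R c x * edge_weight R d (switch c x) =
  edge_weight R d x * edge_weight R c (switch d x).
  rewrite (edge_weight_switch d bc) (edge_weight_switch c bd) /edge_weight.
  have [eq_k|neq_k] := eqVneq (subscript x (sw c)) (subscript x (sw d)).
    by rewrite eq_k -!exprD weight_exp_commute_eq.
  rewrite mulrC (weight_exp_commute_neq bc bd) ?(weight_exp_commute_neq bd bc) //.
    by move=> /esym/eqP; apply/negP.
  exact/eqP.
rewrite mulrACA eqw [X in _ = - X]mulrACA -[RHS]mulNr; congr (_ * _).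
have := e_sign neq tc td.
exact: sign_face.
Qed.

Definition colour_dif := matching_dif (fun x c => tag x c) (@monochrome D)
  (@switch D) edge_unit.
Definition colour_hty := matching_hty (fun x c => tag x c) (@monochrome D)
  (@switch D) edge_unit_inv.
(** The two arcs at each crossing have different colours, so that no direction
    is free. *)
Definition alternating x : bool := pivot (@monochrome D) x == None.

Local Notation EM := (@char_mat R D).
Definition char_mat_inv x y : R := EM x y * half ^+ #|circle (tag x)|.

Lemma char_mat_tag x y : tag x != tag y -> EM x y = 0.
Proof. by rewrite /char_mat => /negPf->. Qed.

(** Orthogonality of characters: if the subscripts of [x] and [y] differ at
    [u], multiplication by v_- on the circle of [u] reverses the sign of the
    sum. *)
Lemma char_mat_square x y : matmul EM EM x y = (x == y)%:R * 2%:R ^+ #|circle (tag x)|.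
Proof.
rewrite /matmul; have [<-|neq] := eqVneq x y.
  rewrite mul1r.
  pose g (k : {ffun circle (tag x) -> bool}) : state D :=
    existT _ (tag x) (superscript x, k).
  have g_inj : injective g.
    move=> k k' eq_g; apply/ffunP => C; have [u ->] := circle_of_surj C.
    exact: (congr1 (fun z => subscript z u) eq_g).
  have E2 z : EM x z * EM z x = if z \in codom g then 1 else 0.
    rewrite [EM z x]char_mat_sym /char_mat.
    case: andP => [[/eqP tz /eqP pz]|nz].
      have -> : z \in codom g.
        have : exists k, z = existT _ (tag z) (superscript z, k).
          by case: (z) => a [p k]; exists k.
        by rewrite -tz -pz => -[k defz]; apply/codomP; exists k.
      rewrite /character -big_split big1 //= => C _.
      by rewrite -exprD addnn -mul2n exprM sqrrN !expr1n.
    rewrite mulr0; case: ifP => // /codomP[k defz]; case: nz.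
    by rewrite defz.
  rewrite (eq_bigr _ (fun z _ => E2 z)) -big_mkcond /=.
  rewrite sumr_const card_codom // card_ffun card_bool -natrX //.
rewrite mul0r; apply: eq_opp_0 => //.
have [eq_t|neq_t] := eqVneq (tag x) (tag y); last first.
  rewrite big1 ?oppr0 // => z _.
  have [eq_z|/char_mat_tag->] := eqVneq (tag x) (tag z); last by rewrite mul0r.
  by rewrite [EM z y]char_mat_tag ?mulr0 // -eq_z.
have [eq_p|neq_p] := eqVneq (superscript x) (superscript y); last first.
  rewrite big1 ?oppr0 // => z _; rewrite /char_mat.
  case: andP => [[_ /eqP <-]|_]; last by rewrite mul0r.
  by rewrite (negPf neq_p) andbF mulr0.
have [u neq_u] : exists u, subscript x u != subscript y u.
  apply/existsP; rewrite -negb_forall; apply: contra neq => /forallP eq_k.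
  by apply/eqP; apply: state_ext => // u; apply/eqP.
(* multiplying z by v_- on the circle of u is an involution of the index set *)
rewrite {1}(reindex_inj (can_inj (@flipsubK D u))) /= -sumrN.
apply: eq_bigr => z _; rewrite char_mat_sym !char_mat_flipsub mulrACA
  -[RHS]mulN1r [EM z x]char_mat_sym.
congr (_ * _); move: neq_u; rewrite /colour_sign.
by case: (subscript x u); case: (subscript y u); rewrite //= ?mulr1 ?mul1r.
Qed.

Lemma char_matK x y : matmul EM char_mat_inv x y = (x == y)%:R.
Proof.
rewrite /matmul /char_mat_inv.
have [eq_t|neq_t] := eqVneq (tag x) (tag y); last first.
  rewrite (_ : (x == y) = false); last by apply: contraNF neq_t => /eqP->.
  rewrite big1 // => z _.
  have [eq_z|/char_mat_tag->] := eqVneq (tag x) (tag z); last by rewrite mul0r.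
  by rewrite [EM z y]char_mat_tag ?mul0r ?mulr0 // -eq_z.
transitivity (matmul EM EM x y * half ^+ #|circle (tag x)|).
  rewrite /matmul mulr_suml; apply: eq_bigr => z _; rewrite mulrA.
  have [eq_z|neq_z] := eqVneq (tag x) (tag z).
    by congr (_ * _ ^+ _); exact: (congr1 (fun a => #|circle a|) (esym eq_z)).
  by rewrite (char_mat_tag neq_z) !mul0r.
by rewrite char_mat_square -mulrA -exprMn halfE expr1n mulr1.
Qed.

Lemma char_matVK x y : matmul char_mat_inv EM x y = (x == y)%:R.
Proof.
transitivity (matmul EM EM x y * half ^+ #|circle (tag x)|).
  by rewrite /matmul mulr_suml; apply: eq_bigr => z _; rewrite /char_mat_inv mulrAC.
by rewrite char_mat_square -mulrA -exprMn halfE expr1n mulr1.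
Qed.

(** The change of basis turns the differential into one with a single unit
    entry for each edge of a cube. *)
Lemma intertwining : matmul (dif_coef R e) EM =2 matmul EM colour_dif.
Proof.
move=> s z.
have -> : matmul (dif_coef R e) EM s z =
    \sum_(c | ~~ tag s c) (-1) ^+ e (tag s) c * edge_sum R c s z.
  rewrite /matmul /dif_coef /edge_sum.
  under eq_bigr do rewrite mulr_suml big_mkcondr /=.
  rewrite exchange_big /=; apply: eq_bigr => c _.
  rewrite mulr_sumr [RHS]big_mkcond /=; apply: eq_bigr => y _.
  by case: ifP => // _; rewrite mulrA.
have -> : matmul EM colour_dif s z =
    \sum_(c | ~~ tag s c) (-1) ^+ e (tag s) c * colour_sum R c s z.
  rewrite /matmul /colour_dif /matching_dif /colour_sum.
  transitivity (\sum_(x : state D) \sum_(c | ~~ tag s c)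
    EM s x * ((-1) ^+ e (tag s) c * ((monochrome c x && (z == switch c x))%:R *
      edge_weight R c x))).
    apply: eq_bigr => x _.
    have [eq_t|/char_mat_tag->] := eqVneq (tag s) (tag x); last first.
      by rewrite mul0r big1 // => c _; rewrite mul0r.
    rewrite mulr_sumr big_mkcondr /= eq_t; apply: eq_bigr => c _.
    case: (monochrome c x) => /=; last by rewrite !mul0r !mulr0.
    by congr (_ * _); rewrite /edge_unit mulrCA.
  rewrite exchange_big /=; apply: eq_bigr => c _.
  by rewrite mulr_sumr; apply: eq_bigr => x _; rewrite mulrCA.
by apply: eq_bigr => c _; rewrite edge_sumE.
Qed.

End Contraction.

Section AlternatingComplex.
Variables (R : comPzRingType) (D : diagram).
Hypothesis two_invertible : exists half : R, 2%:R * half = 1.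
Variable e : smoothing D -> crossing D -> bool.
Hypothesis e_sign : sign_convention e.

Definition alternating_state : finType := {x : state D | alternating x}.
Definition alternating_height (g : alternating_state) : int := state_height (val g).
Definition alternating_complex : precomplex R := Precomplex
  (fun i => blockl alternating_height alternating_height (fun _ _ => 0 : R) i (i + 1)).

Lemma CDKh_complex_contraction :
  is_complex (CDKh' R e) /\ homotopy_equivalent (CDKh' R e) alternating_complex.
Proof.
have [half halfE] := two_invertible.
have degM : degree (@state_height D) (@state_height D) 1 (dif_coef R e).
  move=> x y hxy; rewrite /dif_coef big1 // => c /andP[nc /eqP ty].
  by rewrite /state_height ty height_flip // eqxx in hxy.
have degE : degree (@state_height D) (@state_height D) 0 (@char_mat R D).
  move=> x y; rewrite addr0 /state_height => hxy; apply: char_mat_tag.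
  by apply: contraNneq hxy => ->.
have degV : degree (@state_height D) (@state_height D) 0 (@char_mat_inv R D half).
  by move=> x y hxy; rewrite /char_mat_inv degE ?mul0r.
have degh : degree (@state_height D) (@state_height D) (-1) (colour_hty half e).
  move=> x y hxy; have [//|[c [_ _ _ nc eq_x]]] := matching_hty_neq0 (fun (x :
    state D) (c : crossing D) => tag x c) (edge_unit_inv half e)
    (@monochrome_switch D) x y.
  by rewrite eq_x state_height_switch // addrK eqxx in hxy.
have dif_alternating x y : alternating x || alternating y -> colour_dif R e x y = 0.
  move=> gxy; rewrite /colour_dif /matching_dif big1 // => c /andP[nc bx].
  case: eqP => [yx|_]; last by rewrite mul0r.
  have : ~~ alternating x by rewrite /alternating /pivot; case:
    pickP => // /(_ c); rewrite bx.
  move: gxy; rewrite yx /alternating (pivot_next (@monochrome_switch D)) // orbb => ->.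
  by [].
have hdM x y : matmul (colour_hty half e) (colour_dif R e) x y +
    matmul (colour_dif R e) (colour_hty half e) x y =
    (x == y)%:R - (x == y)%:R * (alternating x)%:R.
  apply: matching_contraction.
  - exact: set_switch.
  - exact: set_switch_neq.
  - exact: monochrome_switch.
  - exact: switchC.
  - exact: switch_inj.
  - exact: switch_surj.
  - exact: edge_unitK.
  - exact: edge_unitC.
have dM2 x y : matmul (colour_dif R e) (colour_dif R e) x y = 0.
  apply: matching_dif_square => //.
  - exact: set_switch.
  - exact: set_switch_neq.
  - exact: monochrome_switch.
  - exact: switchC.
  - exact: edge_unitC.
pose dd (i : int) : {linear graded_ffun R (@state_height D) i ->
  graded_ffun R (@state_height D) (i + 1)} := @CDKh_dif R D e i.
have ddE i f : dd i f = block (@state_height D) (dif_coef R e) (i + 1) f by [].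
split.
  exact: (conj_complex (char_matK two_invertible halfE) (intertwining R e) dM2
    degM ddE).
apply: (conj_contraction (char_matK two_invertible halfE) (char_matVK
  two_invertible halfE)
  (intertwining R e) hdM _ _ degM degE degV degh ddE) => x y gx;
  by rewrite dif_alternating ?gx ?orbT.
Qed.

End AlternatingComplex.

(** * Propagation of alternating colourings along a word *)

Section Words.
Local Open Scope nat_scope.
Implicit Types (L M T : seq (bool * bool)) (s t : slice) (w u v : seq slice).

(** A coloured level lists the orientations and the colours of the strands. A
    strand changes its colour at each crossing; the colour of a cup is
    arbitrary, and a cap requires equal colours. *)
Definition slice_act s M : seq (seq (bool * bool)) :=
  match s, M with
  | Cup _ b, _ => [:: (b, true) :: (~~ b, true) :: M;
                      (b, false) :: (~~ b, false) :: M]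
  | Cap _, p :: q :: r => if (p.1 != q.1) && (p.2 == q.2) then [:: r] else [::]
  | Cross _ _, p :: q :: r => [:: (q.1, ~~ q.2) :: (p.1, ~~ p.2) :: r]
  | _, _ => [::]
  end.

(** Contribution of a crossing to the height. The resolution joins equal
    colours, so it is vertical exactly when the two colours below the crossing
    differ, whereas the oriented one is vertical exactly when the strands are
    parallel. The oriented resolution contributes 0, as a 0-resolution of a
    positive crossing or a 1-resolution of a negative one; the other
    resolution contributes 1 at a positive crossing and -1 at a negative one. *)
Definition slice_wt s M : int :=
  match s, M with
  | Cross _ o, p :: q :: _ =>
      let par := p.1 == q.1 in
      (if (p.2 != q.2) == par then 0 else if o == par then 1 else -1)%R
  | _, _ => 0%R
  end.

Definition colour_step s L : seq (seq (bool * bool)) :=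
  if pos s <= size L then [seq take (pos s) L ++ M | M <- slice_act s (drop (pos s) L)]
  else [::].

Definition colour_wt s L : int := slice_wt s (drop (pos s) L).

(** Sum over all ways to propagate the coloured level [L] through the word
    [w]. The summand [f], a function of the last level and of the total
    weight, is a continuation, so that the sums for two words compose. *)
Fixpoint run_sum w L (f : seq (bool * bool) -> int -> nat) : nat :=
  if w is s :: w' then
    sumn [seq run_sum w' L' (fun T j => f T (colour_wt s L +
      j)%R) | L' <- colour_step s L]
  else f L 0%R.

Lemma sumn_map_eq (A : eqType) (F G : A -> nat) (l : seq A) :
  {in l, F =1 G} -> sumn [seq F x | x <- l] = sumn [seq G x | x <- l].
Proof. by move=> /eq_in_map->. Qed.

Lemma eq_run_sum0 w L f g : (forall T j, f T j = g T j) ->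
  run_sum w L f = run_sum w L g.
Proof.
elim: w L f g => [|s w IH] L f g fg /=; first exact: fg.
by apply: sumn_map_eq => L' _; apply: IH.
Qed.

Lemma run_sum_cat w1 w2 L f : run_sum (w1 ++ w2) L f =
  run_sum w1 L (fun M j => run_sum w2 M (fun T k => f T (j + k)%R)).
Proof.
elim: w1 L f => [|s w IH] L f /=.
  by apply: eq_run_sum0 => T j; rewrite add0r.
apply: sumn_map_eq => L' _; rewrite IH.
by apply: eq_run_sum0 => T j; apply: eq_run_sum0 => T' k; rewrite addrA.
Qed.

Definition orientations L : level := map fst L.

Lemma colour_step_step s L M : M \in colour_step s L -> step s (orientations L) =
  Some (orientations M).
Proof.
rewrite /colour_step; case: leqP => // le_p /mapP[N actN ->].
rewrite /orientations map_cat map_take.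
case: s le_p actN => [i b|i|i o] /= le_p.
- by rewrite !inE size_map le_p -map_drop => /orP[] /eqP->.
- rewrite -map_drop; case: (drop i L) => [|p [|q r]] //=.
  by case: (p.1 != q.1) => //=; case: ifP => // _; rewrite inE => /eqP->.
- rewrite -map_drop; case: (drop i L) => [|p [|q r]] //=.
  by rewrite inE => /eqP->.
Qed.

Lemma run_cons s w l : run (s :: w) l = obind (run w) (step s l).
Proof. by rewrite -cat1s run_cat. Qed.

Lemma eq_run_sum w L f g :
  (forall T j, run w (orientations L) = Some (orientations T) -> f T j = g T j) ->
  run_sum w L f = run_sum w L g.
Proof.
elim: w L f g => [|s w IH] L f g fg /=; first exact: fg.
apply: sumn_map_eq => L' /colour_step_step defL'; apply: IH => T j runT; apply: fg.
by rewrite run_cons defL'.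
Qed.

Lemma slice_act_cat s L T : n_in s <= size L ->
  slice_act s (L ++ T) = [seq M ++ T | M <- slice_act s L].
Proof.
rewrite n_inE; case: s => [i b|i|i o] //=.
- by case: L => [|p [|q r]] //= _; case: ifP.
- by case: L => [|p [|q r]].
Qed.

Lemma slice_wt_cat s L T : n_in s <= size L -> slice_wt s (L ++ T) = slice_wt s L.
Proof. by rewrite n_inE; case: s => [i b|i|i o] //=; case: L => [|p [|q r]]. Qed.

Lemma slice_act_shift k s : slice_act (slice_shift k s) =1 slice_act s.
Proof. by case: s => [i b|i|i o] [|p [|q r]]. Qed.

Lemma slice_wt_shift k s : slice_wt (slice_shift k s) =1 slice_wt s.
Proof. by case: s => [i b|i|i o] [|p [|q r]]. Qed.

Lemma pos_shift k s : pos (slice_shift k s) = k + pos s.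
Proof. by case: s. Qed.

Lemma colour_step_shift s A L :
  colour_step (slice_shift (size A) s) (A ++ L) = [seq A ++ M | M <- colour_step s L].
Proof.
rewrite /colour_step pos_shift size_cat leq_add2l; case: leqP => // le_p.
rewrite slice_act_shift drop_cat take_cat ltnNge leq_addr /= addKn -map_comp.
by apply: eq_map => M /=; rewrite catA.
Qed.

Lemma colour_wt_shift s A L : colour_wt (slice_shift (size A) s) (A ++ L) =
  colour_wt s L.
Proof.
by rewrite /colour_wt pos_shift slice_wt_shift drop_cat ltnNge leq_addr /= addKn.
Qed.

Lemma run_sum_shift w A L f :
  run_sum (map (slice_shift (size A)) w) (A ++ L) f =
  run_sum w L (fun M j => f (A ++ M) j).
Proof.
elim: w L f => // s w IH L f /=.
rewrite colour_step_shift -map_comp; apply: sumn_map_eq => M _ /=.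
by rewrite IH colour_wt_shift.
Qed.

Lemma step_bounds s l l' : step s l = Some l' -> pos s + n_in s <= size l.
Proof.
rewrite n_inE; case: s => [i b|i|i o] /=.
- by case: leqP => // le_i _; rewrite addn0.
- case E: (drop i l) => [|x [|y r]] // _.
  by have := size_drop i l; rewrite E /=; lia.
- case E: (drop i l) => [|x [|y r]] // _.
  by have := size_drop i l; rewrite E /=; lia.
Qed.

Lemma colour_step_cat s L T : pos s + n_in s <= size L ->
  colour_step s (L ++ T) = [seq M ++ T | M <- colour_step s L].
Proof.
move=> le_p; have le1 : pos s <= size L by apply: leq_trans le_p; apply: leq_addr.
rewrite /colour_step size_cat (leq_trans le1 (leq_addr _ _)) le1.
rewrite drop_cat take_cat; case: ltnP => [_|ge].
  rewrite slice_act_cat ?size_drop; last by rewrite leq_subRL.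
  by rewrite -!map_comp; apply: eq_map => M /=; rewrite catA.
have eq_p : pos s = size L by apply/eqP; rewrite eqn_leq le1.
rewrite eq_p subnn drop0 take0 cats0 drop_size take_size.
have n0 : n_in s = 0 by move: le_p; rewrite eq_p; lia.
rewrite -[T in slice_act s T]cat0s slice_act_cat ?n0 //.
by rewrite -!map_comp; apply: eq_map => M /=; rewrite catA.
Qed.

Lemma colour_wt_cat s L T : pos s + n_in s <= size L -> colour_wt s (L ++ T) =
  colour_wt s L.
Proof.
move=> le_p; have le1 : pos s <= size L by apply: leq_trans le_p; apply: leq_addr.
rewrite /colour_wt drop_cat; case: ltnP => [_|ge].
  by rewrite slice_wt_cat // size_drop leq_subRL.
have eq_p : pos s = size L by apply/eqP; rewrite eqn_leq le1.
rewrite eq_p subnn drop0 drop_size -[T]cat0s slice_wt_cat //.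
by move: le_p; rewrite eq_p /=; lia.
Qed.

Lemma size_orientations L : size (orientations L) = size L.
Proof. exact: size_map. Qed.

(** A word that can be run on the levels of [L] alone does not reach the
    strands on their right. *)
Lemma run_sum_right w L T f l : run w (orientations L) = Some l ->
  run_sum w (L ++ T) f = run_sum w L (fun M j => f (M ++ T) j).
Proof.
elim: w L f => // s w IH L f; rewrite run_cons /=.
case E: (step s (orientations L)) => [l1|] //= runw.
have := step_bounds E; rewrite size_orientations => le_p.
rewrite colour_step_cat // colour_wt_cat // -map_comp; apply: sumn_map_eq => M sM /=.
by apply: IH; have := colour_step_step sM; rewrite E => -[<-].
Qed.

End Words.

(** * Invariance of the number of alternating colourings *)

Section LocalMoves.
Local Open Scope nat_scope.
Implicit Types (L M T : seq (bool * bool)) (s t : slice) (w u v : seq slice).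

Lemma step_shift s (A l : level) :
  step (slice_shift (size A) s) (A ++ l) = omap (cat A) (step s l).
Proof.
case: s => [i b|i|i o] /=.
- rewrite size_cat leq_add2l; case: leqP => // _ /=.
  by rewrite take_cat drop_cat ltnNge leq_addr /= addKn catA.
- rewrite drop_cat take_cat ltnNge leq_addr /= addKn.
  by case: (drop i l) => [|x [|y r]] //=; case: eqP => //= _; rewrite catA.
- rewrite drop_cat take_cat ltnNge leq_addr /= addKn.
  by case: (drop i l) => [|x [|y r]] //=; rewrite catA.
Qed.

Lemma run_shift w (A l : level) :
  run (map (slice_shift (size A)) w) (A ++ l) = omap (cat A) (run w l).
Proof.
elim: w l => // s w IH l; rewrite !run_cons step_shift.
by case: (step s l) => //= l'; rewrite IH.
Qed.

(** Both words have to be defined on the level: the word of one side of a move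
    may be defined on fewer levels than that of the other. *)
Definition run_sum_eq u v := forall L f,
  run u (orientations L) -> run v (orientations L) -> run_sum u L f = run_sum v L f.

(** The strands to the left of a move are carried along unchanged, so a local
    move may be taken to occur at the far left. *)
Lemma run_sum_eq_shift i u v : run_sum_eq u v ->
  run_sum_eq (map (slice_shift i) u) (map (slice_shift i) v).
Proof.
move=> uv L f; have [le_i|lt_i] := leqP i (size L); last first.
  have short s w : ~~ run (map (slice_shift i) (s :: w)) (orientations L).
    rewrite /= run_cons; case E: (step _ _) => [l|] //=.
    have := step_bounds E; rewrite pos_shift size_orientations; lia.
  by case: u v {uv} => [|s u] [|t v] // h1 h2;
    [have := short t v; rewrite h2 | have := short s u; rewrite h1 ..].
have sz : size (take i L) = i by rewrite size_takel.
rewrite -(cat_take_drop i L); move: (take i L) (drop i L) sz => A M <-.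
rewrite /orientations map_cat -/(orientations A) -/(orientations M) -[size
  A]size_orientations !run_shift.
rewrite size_orientations !run_sum_shift => h1 h2.
by apply: uv; [case: (run u _) h1 | case: (run v _) h2].
Qed.

Ltac expand := rewrite /colour_step /colour_wt /= ?take0 ?drop0 /= ?addn0.

Lemma zigzag_left_sum b : run_sum_eq [:: Cup 0 b; Cap 1] [::].
Proof.
move=> [|[b1 k1] L] f; rewrite /run /= ?take0 ?drop0 //=.
by case: b; case: b1; case: k1 => //= _ _; expand.
Qed.

Lemma zigzag_right_sum b : run_sum_eq [:: Cup 1 b; Cap 0] [::].
Proof.
move=> [|[b1 k1] L] f; rewrite /run /= ?take0 ?drop0 //=.
by case: b; case: b1; case: k1 => //= _ _; expand.
Qed.

Lemma slide_cup_sum b o :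
  run_sum_eq [:: Cup 0 b; Cross 1 o] [:: Cup 1 b; Cross 0 (~~ o)].
Proof.
move=> [|[b1 k1] L] f; rewrite /run /= ?take0 ?drop0 //= => _ _.
rewrite /colour_step /colour_wt /= ?take0 ?drop0 /=.
by case: b; case: b1; case: k1; case: o => //=; rewrite !addn0 addnC.
Qed.

Lemma slide_cap_sum o :
  run_sum_eq [:: Cross 1 o; Cap 0] [:: Cross 0 (~~ o); Cap 1].
Proof.
move=> [|[b1 k1] [|[b2 k2] [|[b3 k3] L]]] f; rewrite /run /= ?take0 ?drop0 //=.
by case: b1; case: b2; case: b3; case: k1; case: k2; case: k3; case:
  o => //= _ _; expand.
Qed.

(** One of the two colours of the cup is excluded by the cap; for the other
    one the resolution of the crossing is the oriented one. *)
Lemma R1_left_sum b o : run_sum_eq [:: Cup 0 b; Cross 1 o; Cap 0] [::].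
Proof.
move=> [|[b1 k1] L] f; rewrite /run /= ?take0 ?drop0 //=.
by case: b; case: b1; case: k1; case: o => //= _ _; expand.
Qed.

Lemma R1_right_sum b o : run_sum_eq [:: Cup 1 b; Cross 0 o; Cap 1] [::].
Proof.
move=> [|[b1 k1] L] f; rewrite /run /= ?take0 ?drop0 //=.
by case: b; case: b1; case: k1; case: o => //= _ _; expand.
Qed.

(** The second crossing restores the colours, and the weights cancel since the
    crossings have opposite signs. *)
Lemma R2_sum o : run_sum_eq [:: Cross 0 o; Cross 0 (~~ o)] [::].
Proof.
move=> [|[b1 k1] [|[b2 k2] L]] f; rewrite /run /= ?take0 ?drop0 //= => _ _.
by case: b1; case: b2; case: k1; case: k2; case: o; expand.
Qed.

(** On both sides every strand changes its colour twice and ends at the same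
    place, so only the total weights have to be compared. *)
Lemma R3_sum o1 o2 o3 : run_sum_eq [:: Cross 0 o1; Cross 1 o2; Cross 0 o3]
  [:: Cross 1 o3; Cross 0 o2; Cross 1 o1].
Proof.
move=> [|[b1 k1] [|[b2 k2] [|[b3 k3] L]]] f; rewrite /run /= ?take0 ?drop0 //= => _ _.
rewrite /colour_step /colour_wt /= ?take0 ?drop0 /= !addn0.
rewrite !negbK; congr (f _ _).
by case: b1; case: b2; case: b3; case: k1; case: k2; case: k3;
  case: o1; case: o2; case: o3.
Qed.

End LocalMoves.

Section Moves.
Local Open Scope nat_scope.
Implicit Types (L M T : seq (bool * bool)) (s t : slice) (w u v : seq slice).

Lemma slice_shift_add j k s : slice_shift j (slice_shift k s) = slice_shift (j + k) s.
Proof. by case: s => [i b|i|i o] /=; rewrite addnA. Qed.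

Lemma slice_shift0 s : slice_shift 0 s = s.
Proof. by case: s. Qed.

Definition base s : slice :=
  match s with Cup _ b => Cup 0 b | Cap _ => Cap 0 | Cross _ o => Cross 0 o end.

Lemma baseE s : s = slice_shift (pos s) (base s).
Proof. by case: s => [i b|i|i o] /=; rewrite addn0. Qed.

Lemma sumn_mapD (A : Type) (F G : A -> nat) (l : seq A) :
  sumn [seq F x + G x | x <- l] = sumn [seq F x | x <- l] + sumn [seq G x | x <- l].
Proof. by elim: l => //= x l ->; rewrite addnACA. Qed.

Lemma colour_step_shift2 t p q M :
  colour_step (slice_shift 2 t) (p :: q :: M) = [seq p :: q ::
    N | N <- colour_step t M].
Proof. exact: (colour_step_shift t [:: p; q]). Qed.

Lemma colour_wt_shift2 t p q M : colour_wt (slice_shift 2 t) (p :: q :: M) =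
  colour_wt t M.
Proof. exact: (colour_wt_shift t [:: p; q]). Qed.

Lemma colour_step_cup0 b L : colour_step (Cup 0 b) L =
  [:: [:: (b, true), (~~ b, true) & L]; [:: (b, false), (~~ b, false) & L]].
Proof. by rewrite /colour_step /= drop0 take0. Qed.

Lemma colour_step_cap0 p q L : colour_step (Cap 0) (p :: q :: L) =
  if (p.1 != q.1) && (p.2 == q.2) then [:: L] else [::].
Proof. by rewrite /colour_step /=; case: ifP. Qed.

Lemma colour_step_cross0 o p q L : colour_step (Cross 0 o) (p :: q :: L) =
  [:: [:: (q.1, ~~ q.2), (p.1, ~~ p.2) & L]].
Proof. by rewrite /colour_step /=. Qed.

Lemma colour_wt_nocross s L : ~~ is_cross s -> colour_wt s L = 0%R.
Proof. by rewrite /colour_wt; case: s => [i b|i|i o] //= _; case: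
  (drop _ _) => [|p [|q r]]. Qed.

Lemma run_short s w l : size l < pos s + n_in s -> run (s :: w) l = None.
Proof.
by move=> lt_l; rewrite run_cons; case E: (step s l) => //=; have := step_bounds E; lia.
Qed.

Lemma run_sum2 s t L f : run_sum [:: s; t] L f =
  sumn [seq sumn [seq f T (colour_wt s L +
    colour_wt t M)%R | T <- colour_step t M] | M <- colour_step s L].
Proof. by apply: sumn_map_eq => M _ /=; apply: sumn_map_eq => T _; rewrite addr0. Qed.

Lemma exchange_sum s t : pos s = 0 ->
  run_sum_eq [:: s; slice_shift (n_out s) t] [:: slice_shift (n_in s) t; s].
Proof.
move=> ps L f h1 h2.
have L2 : n_in s = 2 -> exists p q M, L = [:: p, q & M].
  move=> ni; case: L h1 {h2} => [|p [|q M]]; last by exists p, q, M.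
  - by rewrite run_short // ps ni.
  - by rewrite run_short // ps ni.
rewrite !run_sum2; case: s ps L2 {h1 h2} => [i b|i|i o] ps L2; rewrite /= in ps;
  subst i.
- rewrite n_outE n_inE [is_cup _]/= [is_cap _]/= slice_shift0 colour_step_cup0.
  rewrite [map _ [:: _; _]]/= !colour_step_shift2 !colour_wt_shift2 /= addn0 -!map_comp.
  rewrite -sumn_mapD; apply: sumn_map_eq => M _;
  by rewrite take0 drop0 /= addn0 !add0r !addr0.
- have [p [q [M ->]]] := L2 erefl.
  rewrite n_outE n_inE [is_cup _]/= [is_cap _]/= slice_shift0 colour_step_cap0.
  rewrite colour_step_shift2 colour_wt_shift2 -map_comp (@colour_wt_nocross (Cap 0)) //.
  case: ifP => c; rewrite /= ?addn0.
    apply: sumn_map_eq => N _; cbv beta delta [comp];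
      rewrite colour_step_cap0 c /= addn0.
    by rewrite add0r addr0.
  by elim: (colour_step t M) => //= N l <-; rewrite colour_step_cap0 c.
- have [p [q [M ->]]] := L2 erefl.
  rewrite n_outE n_inE [is_cup _]/= [is_cap _]/= colour_step_cross0 [map _ [:: _]]/=.
  rewrite !colour_step_shift2 !colour_wt_shift2 /= addn0 -!map_comp.
  apply: sumn_map_eq => N _; cbv beta delta [comp]; rewrite colour_step_cross0 /= addn0.
  by rewrite addrC.
Qed.

Lemma local_move_sum u v : local_move u v -> run_sum_eq u v.
Proof.
(* each move at position i is the shift by i of the move at position 0 *)
have sh i u0 v0 u' v' : run_sum_eq u0 v0 -> u' = map (slice_shift i) u0 ->
    v' = map (slice_shift i) v0 -> run_sum_eq u' v'.
  by move=> h -> ->; exact: run_sum_eq_shift.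
case=> [s t|i b|i b|i b o|i o|i b o|i b o|i o|i o1 o2 o3 _].
- apply: (sh (pos s) _ _ _ _ (@exchange_sum (base s) t _)).
  + by case: s.
  + by rewrite /= -baseE slice_shift_add; case: (s).
  + by rewrite /= -baseE slice_shift_add; case: (s).
- by apply: (sh i _ _ _ _ (@zigzag_left_sum b)); rewrite //= addn0 addn1.
- by apply: (sh i _ _ _ _ (@zigzag_right_sum b)); rewrite //= addn0 addn1.
- by apply: (sh i _ _ _ _ (@slide_cup_sum b o)); rewrite //= addn0 addn1.
- by apply: (sh i _ _ _ _ (@slide_cap_sum o)); rewrite //= addn0 addn1.
- by apply: (sh i _ _ _ _ (@R1_left_sum b o)); rewrite //= addn0 addn1.
- by apply: (sh i _ _ _ _ (@R1_right_sum b o)); rewrite //= addn0 addn1.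
- by apply: (sh i _ _ _ _ (@R2_sum o)); rewrite //= addn0.
- by apply: (sh i _ _ _ _ (@R3_sum o1 o2 o3)); rewrite //= addn0 addn1.
Qed.

Fixpoint colourings (l : level) : seq (seq (bool * bool)) :=
  if l is b :: l' then [seq (b, true) :: L | L <- colourings l'] ++
                       [seq (b, false) :: L | L <- colourings l']
  else [:: [::]].

Lemma mem_colourings l L : (L \in colourings l) = (orientations L == l).
Proof.
elim: l L => [|b l IH] [|[b1 k] L] //=.
  by rewrite mem_cat; apply/negP => /orP[] /mapP[].
rewrite mem_cat /orientations /= eqseq_cons -/(orientations L) -IH.
apply/orP/andP => [[] /mapP[M ML [-> _ ->]]|[/eqP-> lL]] //.
by case: k; [left | right]; apply/mapP; exists L.
Qed.

Lemma uniq_colourings l : uniq (colourings l).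
Proof.
elim: l => //= b l IH; rewrite cat_uniq !map_inj_uniq //; try by move=> ? ? [].
rewrite IH andbT /=; apply/hasPn => L /mapP[M _ ->].
by apply/negP => /mapP[].
Qed.

(** The number of coloured levels that return to their reverse, with total
    weight [i]: the end of a strand at the top is identified with the
    antipodal point at the bottom. *)
Definition colour_count l w (i : int) : nat :=
  \sum_(L <- colourings l) run_sum w L (fun T j => (T == rev L) && (j == i)).

Lemma colour_count_local l w1 u v w2 l1 l2 i : local_move u v ->
  run (w1 ++ u ++ w2) l = Some l1 -> run (w1 ++ v ++ w2) l = Some l2 ->
  colour_count l (w1 ++ u ++ w2) i = colour_count l (w1 ++ v ++ w2) i.
Proof.
move=> uv; rewrite !run_cat => r1 r2; rewrite /colour_count.
apply: eq_big_seq => L; rewrite mem_colourings => /eqP ori_L.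
rewrite !run_sum_cat; apply: eq_run_sum => T j; rewrite ori_L => r0.
rewrite r0 /= !run_cat in r1 r2; rewrite !run_sum_cat.
apply: (local_move_sum uv).
  by case: (run u _) r1.
by case: (run v _) r2.
Qed.

End Moves.

Section GlobalMoves.
Local Open Scope nat_scope.
Implicit Types (A B I L M T : seq (bool * bool)) (s t : slice) (w u v : seq slice).

Lemma colour_step_split s A I B : size A = pos s -> n_in s <= size I ->
  colour_step s (A ++ I ++ B) = [seq A ++ U ++ B | U <- slice_act s I].
Proof.
move=> sA sI; rewrite /colour_step -sA size_cat leq_addr take_size_cat //
  drop_size_cat //.
by rewrite slice_act_cat // -map_comp.
Qed.

Lemma colour_wt_split s A I B : size A = pos s -> n_in s <= size I ->
  colour_wt s (A ++ I ++ B) = slice_wt s I.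
Proof. by move=> sA sI; rewrite /colour_wt -sA drop_size_cat // slice_wt_cat. Qed.

Lemma split_level s L : pos s + n_in s <= size L -> exists A I B,
  [/\ L = A ++ I ++ B, size A = pos s & size I = n_in s].
Proof.
move=> le_p; exists (take (pos s) L), (take (n_in s) (drop (pos s) L)),
  (drop (n_in s) (drop (pos s) L)).
rewrite !cat_take_drop !size_takel ?size_drop //; first by rewrite leq_subRL; lia.
lia.
Qed.

Lemma pos_antipode s A I B : size A = pos s -> size I = n_in s ->
  pos (antipode (size (A ++ I ++ B)) s) = size B.
Proof.
by rewrite n_inE !size_cat; case: s => [i b|i|i o] /= -> ->; lia.
Qed.

Lemma n_in_antipode m s : n_in (antipode m s) = n_in s.
Proof. by case: s. Qed.

(** The rules for colours are symmetric under the reversal of left and right,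
    which is the effect of the antipodal map on a slice. *)
Lemma slice_act_antipode m s I : size I = n_in s ->
  slice_act (antipode m s) (rev I) = map rev (slice_act s I).
Proof.
rewrite n_inE; case: s => [i b|i|i o] /=.
- by case: I => // _; rewrite /rev /= negbK.
- case: I => [|p [|q []]] // _; rewrite /rev /= eq_sym [q.2 == _]eq_sym.
  by case: ifP.
- by case: I => [|p [|q []]].
Qed.

Lemma slice_wt_antipode m s I : size I = n_in s ->
  slice_wt (antipode m s) (rev I) = slice_wt s I.
Proof.
rewrite n_inE; case: s => [i b|i|i o] /=.
- by case: I.
- by case: I => [|p [|q []]].
- by case: I => [|p [|q []]] // _; rewrite /rev /= [q.2 == _]eq_sym [q.1 == _]eq_sym.
Qed.

Lemma colour_step_antipode s L : pos s + n_in s <= size L ->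
  colour_step (antipode (size L) s) (rev L) = map rev (colour_step s L).
Proof.
move=> /split_level[A [I [B [-> sA sI]]]].
rewrite (colour_step_split B sA) ?sI // !rev_cat -catA colour_step_split; first last.
- by rewrite n_in_antipode size_rev sI.
- by rewrite size_rev pos_antipode.
rewrite slice_act_antipode // -!map_comp; apply: eq_map => U /=.
by rewrite !rev_cat catA.
Qed.

Lemma colour_wt_antipode s L : pos s + n_in s <= size L ->
  colour_wt (antipode (size L) s) (rev L) = colour_wt s L.
Proof.
move=> /split_level[A [I [B [-> sA sI]]]].
rewrite (colour_wt_split B sA) ?sI // !rev_cat -catA colour_wt_split
  ?slice_wt_antipode //.
- by rewrite size_rev pos_antipode.
- by rewrite n_in_antipode size_rev sI.
Qed.

Lemma uniq_slice_act s M : uniq (slice_act s M).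
Proof.
case: s M => [i b|i|i o] [|p [|q M]] //=; try by rewrite !inE; case: b.
by case: ifP.
Qed.

Lemma uniq_colour_step s L : uniq (colour_step s L).
Proof.
rewrite /colour_step; case: ifP => // _; rewrite map_inj_uniq ?uniq_slice_act //.
by move=> x y /eqP; rewrite eqseq_cat // eqxx => /eqP.
Qed.

Lemma sumn_sub (K : eqType) (F : K -> nat) (l m : seq K) :
  uniq l -> uniq m -> {subset l <= m} ->
  sumn [seq F x | x <- l] = \sum_(x <- m) (x \in l) * F x.
Proof.
move=> ul um lm; rewrite sumnE big_map.
transitivity (\sum_(x <- [seq x <- m | x \in l]) F x); last first.
  rewrite big_filter big_mkcond; apply: eq_bigr => x _.
  by case: (x \in l); rewrite /= ?mul1n ?mul0n.
apply: perm_big; apply: uniq_perm; rewrite ?filter_uniq // => x.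
by rewrite mem_filter; case xl: (x \in l) => //=; rewrite lm.
Qed.

(** Lets a sum over initial levels pass into the summand, where the antipode
    of the first slice acts last. *)
Lemma run_sum_linear (K : Type) (r : seq K) (c : K -> nat) w L
    (f : K -> seq (bool * bool) -> int -> nat) :
  run_sum w L (fun T j => \sum_(k <- r) c k * f k T j) =
  \sum_(k <- r) c k * run_sum w L (f k).
Proof.
elim: w L f => // s w IH L f /=; rewrite sumnE big_map.
under eq_bigr do rewrite (IH _ (fun k T j => f k T (colour_wt s L + j)%R)).
rewrite exchange_big; apply: eq_bigr => k _ /=.
by rewrite sumnE big_map big_distrr.
Qed.

(** A closed propagation through [s :: w] starts at [L], reaches [L'] after
    [s] and ends at [rev L]. Started at [L'] instead, it runs through [w] to
    [rev L], where the antipode of [s] acts on [rev L] as [s] does on [L], and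
    ends at [rev L']. *)
Lemma colour_count_antipode l s w l' i :
  step s l = Some l' -> run w l' = Some (rev l) ->
  colour_count l (s :: w) i =
  colour_count l' (rcons w (antipode (size l) s)) i.
Proof.
move=> sl runw; rewrite /colour_count.
have le_p := step_bounds sl.
transitivity (\sum_(L <- colourings l) \sum_(L' <- colourings l') (L' \in
  colour_step s L) *
   run_sum w L' (fun T j => (T == rev L) && (colour_wt s L + j == i)%R)).
  apply: eq_big_seq => L; rewrite mem_colourings => /eqP oriL.
  apply: sumn_sub => [||L' sL]; rewrite ?uniq_colour_step ?uniq_colourings //.
  by rewrite mem_colourings; have := colour_step_step sL; rewrite oriL sl => -[->].
rewrite exchange_big; apply: eq_big_seq => L'; rewrite mem_colourings => /eqP oriL'.
rewrite -cats1 run_sum_cat.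
rewrite -(run_sum_linear _ (fun L => nat_of_bool (L' \in colour_step s L)) _ _
  (fun L T j => nat_of_bool ((T == rev L) && (colour_wt s L + j == i)%R))).
apply: eq_run_sum => M j; rewrite oriL' runw => -[oriM].
have szM : size l = size (rev M) by rewrite size_rev -size_orientations -oriM size_rev.
have colM : rev M \in colourings l by rewrite mem_colourings /orientations
  map_rev -/(orientations M) -oriM revK.
(* the final level M must be rev L, which determines L *)
rewrite (bigD1_seq (rev M)) ?uniq_colourings //= revK eqxx big1 ?addn0 => [|L
  neq]; last first.
  by rewrite (_ : (M == rev L) = false) ?muln0 //; apply: contraNF neq => /eqP->;
    rewrite revK.
rewrite szM in le_p.
rewrite -{3 4}(revK M) szM colour_step_antipode // colour_wt_antipode // -map_comp.
rewrite (@sumn_sub _ _ _ (colour_step s (rev M))) ?uniq_colour_step //.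
case: (boolP (L' \in colour_step s (rev M))) => inL; last first.
  rewrite mul0n big1_seq // => N /andP[_ sN] /=.
  rewrite (inj_eq (can_inj revK)) (_ : (N == L') = false) ?muln0 //.
  by apply: contraNF inL => /eqP<-.
rewrite (bigD1_seq L') ?uniq_colour_step //= inL eqxx big1 ?addn0 => [|N neq].
  by rewrite !mul1n addr0 addrC.
by rewrite (inj_eq (can_inj revK)) (negPf neq) muln0.
Qed.

Lemma big_colourings_cons b l (F : seq (bool * bool) -> nat) :
  \sum_(L <- colourings (b :: l)) F L =
  \sum_(L <- colourings l) (F ((b, true) :: L) + F ((b, false) :: L)).
Proof. by rewrite big_cat !big_map big_split. Qed.

Lemma big_colourings_rcons b l (F : seq (bool * bool) -> nat) :
  \sum_(L <- colourings (rcons l b)) F L =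
  \sum_(L <- colourings l) (F (rcons L (b, true)) + F (rcons L (b, false))).
Proof.
elim: l F => [|b1 l IH] F; first by rewrite big_colourings_cons !big_seq1.
rewrite rcons_cons !big_colourings_cons IH; apply: eq_bigr => L _ /=.
exact: addnACA.
Qed.

Lemma run_sum_zero w L : run_sum w L (fun _ _ => 0) = 0.
Proof.
elim: w L => //= s w IH L.
by elim: (colour_step s L) => //= M l ->; rewrite IH.
Qed.

(** The left branch of the new cup ends at the top left, antipodal to the
    endpoint at the bottom right, which forces the colour of the cup. The new
    cap joins the last strand of [w] to that endpoint. *)
Lemma colour_count_rotate x l w i : run w (x :: l) = Some (rev (x :: l)) ->
  colour_count (x :: l) w i =
  colour_count (rcons l (~~ x))
    (Cup 0 (~~ x) :: rcons (map (slice_shift 1) w) (Cap (size (x :: l)))) i.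
Proof.
move=> runw; rewrite /colour_count big_colourings_cons big_colourings_rcons.
apply: eq_big_seq => L; rewrite mem_colourings => /eqP oriL.
have key z y : run_sum
    (rcons (map (slice_shift 1) w) (Cap (size (x :: l))))
    ((~~ x, y) :: (x, y) :: rcons L (~~ x, z))
    (fun T j => (T == rev (rcons L (~~ x, z))) && (j == i)%R) =
    (y == z) * run_sum w ((x, z) :: L) (fun T j => (T == rev ((x, z) ::
      L)) && (j == i)).
  rewrite -cats1 run_sum_cat -cats1 -[_ :: _]/([:: (~~ x, y)] ++ (((x, y) ::
    L) ++ [:: (~~ x, z)])).
  rewrite (run_sum_shift w [:: _]) (run_sum_right _ _ (l := rev (x :: l))); last first.
    by rewrite /orientations /= -/(orientations L) oriL.
  pose g M j := nat_of_bool ((M == rev ((x, z) :: L)) && (j == i)).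
  transitivity (run_sum w ((x, y) :: L) (fun M j => (y == z) * g M j)).
    apply: eq_run_sum => M j; rewrite {1}/orientations /= -/(orientations L) oriL
      runw => -[].
    rewrite rev_cons; case/lastP: M => [|M [x' k]].
      by move/(congr1 size); rewrite size_rcons.
    rewrite /orientations map_rcons -/(orientations M) => /eqP;
      rewrite eqseq_rcons => /andP[/eqP oriM /eqP /= <-].
    have szM : size l = size M by rewrite -size_rev oriM size_orientations.
    have -> : (~~ x, y) :: rcons M (x, k) ++ [:: (~~ x, z)] =
      ((~~ x, y) :: M) ++ [:: (x, k); (~~ x, z)] ++ [::].
      by rewrite -cats1 /= -catA.
    have sA : size ((~~ x, y) :: M) = pos (Cap (size l).+1) by rewrite /= szM.
    rewrite (colour_step_split _ sA) // [slice_act _ _]/= !addr0 /g rev_cons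
      eqseq_rcons.
    rewrite xpair_eqE eqxx rev_cat /=.
    have -> : x != ~~ x by case: (x).
    case: (k == z); rewrite /= ?cats0 ?andbF ?muln0 ?addn0 //.
    by rewrite eqseq_cons xpair_eqE eqxx andbT /=; case: (y == z); rewrite /= ?mul1n.
  have [->|neq] := eqVneq y z; first by rewrite mul1n; apply: eq_run_sum0 => T j;
    rewrite mul1n.
  by rewrite mul0n -[RHS](run_sum_zero w ((x, y) :: L)); apply: eq_run_sum0 => T j.
(* of the two colours y of the cup only y = z contributes *)
have cupE z : run_sum
    (Cup 0 (~~ x) :: rcons (map (slice_shift 1) w) (Cap (size (x :: l))))
    (rcons L (~~ x, z)) (fun T j => (T == rev (rcons L (~~ x, z))) && (j == i)%R) =
    run_sum w ((x, z) :: L) (fun T j => (T == rev ((x, z) :: L)) && (j == i)).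
  rewrite [LHS]/= take0 drop0 negbK /=.
  have e0 y : run_sum (rcons [seq slice_shift 1 i | i <- w] (Cap (size l).+1))
      [:: (~~ x, y), (x, y) & rcons L (~~ x, z)]
      (fun T j => (T == rev (rcons L (~~ x, z))) && ((0 + j)%R == i)) =
      (y == z) * run_sum w ((x, z) :: L) (fun T j => (T == rev ((x, z) ::
        L)) && (j == i)).
    by rewrite -key; apply: eq_run_sum0 => T j; rewrite add0r.
  by rewrite !e0 addn0; case: z {e0}; rewrite /= ?mul1n ?mul0n ?addn0.
by rewrite !cupE.
Qed.

Lemma colour_count_move l w l' w' i : raw_move (l, w) (l', w') ->
  run w l = Some (rev l) -> run w' l' = Some (rev l') ->
  colour_count l w i = colour_count l' w' i.
Proof.
move E1: (l, w) => x; move E2: (l', w') => y m.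
case: m E1 E2 => {x y} [l1 w1 u v w2 uv|x l1 w1|l1 l2 s w1 _ sl|l1 l2 s w1 _ sl].
- by move=> [-> ->] [-> ->] r1 r2; apply: colour_count_local uv r1 r2.
- by move=> [-> ->] [-> ->] r1 _; apply: colour_count_rotate.
- move=> [-> ->] [-> ->]; rewrite run_cons sl /= => r1 _.
  exact: colour_count_antipode sl r1.
- move=> [-> ->] [-> ->]; rewrite run_cons sl /= => r1 _.
  exact: colour_count_antipode sl r1.
Qed.

Lemma colour_count_same_link (D D' : diagram) i : same_link D D' ->
  colour_count (bottom D) (word D) i = colour_count (bottom D') (word D') i.
Proof.
elim=> [E F m|//|E F _ ->//|E F G _ -> _ ->//].
exact: colour_count_move m (eqP (diagramP E)) (eqP (diagramP F)).
Qed.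

End GlobalMoves.

(** * Histories of colourings *)

Section Histories.
Local Open Scope nat_scope.
Implicit Types (A B I L M T : seq (bool * bool)) (s t : slice) (w u v : seq slice).

(** Propagations as explicit lists of levels, to be compared with colourings
    of the nodes. *)
Fixpoint histories w L : seq (seq (seq (bool * bool))) :=
  if w is s :: w' then [seq L :: h | L' <- colour_step s L, h <- histories w' L']
  else [:: [:: L]].

Fixpoint history_weight w (h : seq (seq (bool * bool))) : int :=
  match w, h with
  | s :: w', L :: h' => (colour_wt s L + history_weight w' h')%R
  | _, _ => 0%R
  end.

Lemma mem_histories w L h : (h \in histories w L) =
  [&& size h == (size w).+1, nth [::] h 0 == L &
      [forall t : 'I_(size w),
         nth [::] h t.+1 \in colour_step (nth (Cap 0) w t) (nth [::] h t)]].
Proof.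
elim: w L h => [|s w IH] L h /=.
  case: h => [|M [|N h]] //=; first by rewrite !inE eqseq_cons andbT; case:
    eqP => //= _;
    symmetry; apply/forallP => -[].
  by rewrite inE eqseq_cons andbF.
apply/allpairsPdep/and3P => [[L' [h' [sL' Hh' ->]]]|[]].
  move: Hh'; rewrite IH => /and3P[/eqP sz /eqP h0 /forallP H]; split=> //=.
    by rewrite sz.
  apply/forallP => -[[|t] lt_t] /=; first by rewrite h0.
  by have := H (Ordinal (lt_t : t < size w)).
case: h => [|M h] //= sz /eqP->; case: h sz => [|L' h] //= sz /forallP H.
exists L', (L' :: h); split=> //; first exact: (H ord0).
rewrite IH; apply/and3P; split=> //; apply/forallP => t.
by have := H (lift ord0 t).
Qed.

Lemma uniq_histories w L : uniq (histories w L).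
Proof.
elim: w L => //= s w IH L; apply: allpairs_uniq_dep => //.
  exact: uniq_colour_step.
move=> [L1 h1] [L2 h2] /allpairsPdep[x1 [y1 [_ H1 [-> ->]]]].
case/allpairsPdep => [x2 [y2 [_ H2 [-> ->]]]] /= [eq_y].
move: H1 H2; rewrite !mem_histories eq_y => /and3P[_ /eqP<- _] /and3P[_ /eqP<- _].
by [].
Qed.

Lemma run_sum_histories w L f :
  run_sum w L f = \sum_(h <- histories w L) f (last L h) (history_weight w h).
Proof.
elim: w L f => [|s w IH] L f /=; first by rewrite big_seq1.
rewrite sumnE big_map big_allpairs_dep /=; apply: eq_bigr => L' _.
rewrite IH; apply: eq_big_seq => h; rewrite mem_histories => /and3P[sz _ _].
by case: h sz.
Qed.

Lemma history_weightE w h : size w < size h ->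
  history_weight w h = (\sum_(t < size w) colour_wt (nth (Cap 0) w t) (nth [::] h t))%R.
Proof.
elim: w h => [|s w IH] [|L h] //=; rewrite ?big_ord0 // ltnS => lt_w.
by rewrite big_ord_recl /= IH.
Qed.

Definition closed_histories l w i := [seq h <- flatten [seq histories w L | L <-
  colourings l] |
  (last [::] h == rev (head [::] h)) && (history_weight w h == i)].

Lemma mem_closed_histories l w i h : (h \in closed_histories l w i) =
  [&& orientations (nth [::] h 0) == l, size h == (size w).+1,
     [forall t : 'I_(size w),
         nth [::] h t.+1 \in colour_step (nth (Cap 0) w t) (nth [::] h t)],
     nth [::] h (size w) == rev (nth [::] h 0) & history_weight w h == i].
Proof.
rewrite mem_filter andbC.
apply/andP/and5P => [[/flattenP[_ /mapP[L lL ->]]]|[h1 h2 h3 h4 h5]].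
  rewrite mem_histories => /and3P[sz /eqP h0 H] /andP[hl hi].
  rewrite mem_colourings in lL; rewrite h0; split=> //.
  by move: hl; rewrite -h0 -nth_last (eqP sz) nth0.
split; last by rewrite h5 andbT -nth_last (eqP h2) -nth0.
apply/flattenP; exists (histories w (nth [::] h 0)).
  by apply: map_f; rewrite mem_colourings.
by rewrite mem_histories h2 eqxx.
Qed.

Lemma uniq_closed_histories l w i : uniq (closed_histories l w i).
Proof.
apply: filter_uniq; elim: (colourings l) (uniq_colourings l) => //= L r IH /andP[Lr ur].
rewrite cat_uniq uniq_histories IH // andbT;
  apply/hasPn => h /flattenP[_ /mapP[M Mr ->]].
rewrite !mem_histories => /and3P[_ /eqP-> _]; apply/negP => /and3P[_ /eqP eqM _].
by rewrite -eqM Mr in Lr.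
Qed.

Lemma size_closed_histories l w i : size (closed_histories l w i) = colour_count l w i.
Proof.
rewrite size_filter count_flatten sumnE !big_map; apply: eq_bigr => L _.
rewrite run_sum_histories -sum1_count big_mkcond; apply: eq_big_seq => h.
rewrite mem_histories => /and3P[sz /eqP h0 _].
case: h sz h0 => // M h _ /= ->.
by case: (_ && _).
Qed.

Definition colour_at L i : bool := (nth (true, false) L i).2.

(** The colours of two successive levels, in the form of conditions along the
    arcs of the slice. *)
Definition colour_compatible s L L' : Prop := let p := pos s in
  [/\ forall i, i < p -> colour_at L i = colour_at L' i,
      forall i, i < size L - p - n_in s ->
        colour_at L (p + n_in s + i) = colour_at L' (p + n_out s + i),
      is_cup s -> colour_at L' p = colour_at L' p.+1,
      is_cap s -> colour_at L p = colour_at L p.+1 &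
      is_cross s -> colour_at L' p = ~~ colour_at L p.+1 /\ colour_at L' p.+1 =
        ~~ colour_at L p].

Lemma nth_mid (K : Type) (d : K) (A I B : seq K) :
  [/\ forall i, i < size A -> nth d (A ++ I ++ B) i = nth d A i,
      forall i, i < size I -> nth d (A ++ I ++ B) (size A + i) = nth d I i &
      forall i, nth d (A ++ I ++ B) (size A + size I + i) = nth d B i].
Proof.
split=> i.
- by move=> lt_i; rewrite nth_cat lt_i.
- by move=> lt_i; rewrite nth_cat ltnNge leq_addr /= addKn nth_cat lt_i.
- rewrite nth_cat ltnNge -addnA leq_addr /= addKn nth_cat ltnNge leq_addr /=.
  by rewrite addKn.
Qed.

Lemma size_slice_act s I U : size I = n_in s -> U \in slice_act s I -> size U = n_out s.
Proof.
rewrite n_inE n_outE; case: s => [i b|i|i o] /=.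
- by case: I => // _; rewrite !inE => /orP[] /eqP->.
- by case: I => [|p [|q []]] // _; case: ifP => // _; rewrite inE => /eqP->.
- by case: I => [|p [|q []]] // _; rewrite inE => /eqP->.
Qed.

Lemma colour_step_compatible s L L' : L' \in colour_step s L ->
  colour_compatible s L L'.
Proof.
move=> sL; have := step_bounds (colour_step_step sL); rewrite size_orientations => le_p.
have [A [I [B [defL sA sI]]]] := split_level le_p; subst L.
move: sL; rewrite (colour_step_split B sA) ?sI // => /mapP[U aU ->].
have sU := size_slice_act sI aU.
have [l1 l2 l3] := nth_mid (true, false) A I B.
have [r1 r2 r3] := nth_mid (true, false) A U B.
have r2' i : i < n_out s -> nth (true, false) (A ++ U ++ B) (pos s + i) =
  nth (true, false) U i.
  by rewrite -sA -sU; exact: r2.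
have l2' i : i < n_in s -> nth (true, false) (A ++ I ++ B) (pos s + i) =
  nth (true, false) I i.
  by rewrite -sA -sI; exact: l2.
have R0 : is_cap s = false -> nth (true, false) (A ++ U ++ B) (pos s) =
  nth (true, false) U 0 /\
    nth (true, false) (A ++ U ++ B) (pos s).+1 = nth (true, false) U 1.
  move=> nc; rewrite -[X in nth _ _ X = _ /\ _]addn0 -addn1 !r2' //;
  by rewrite n_outE nc.
have L0 : is_cup s = false -> nth (true, false) (A ++ I ++ B) (pos s) =
  nth (true, false) I 0 /\
    nth (true, false) (A ++ I ++ B) (pos s).+1 = nth (true, false) I 1.
  move=> nc; rewrite -[X in nth _ _ X = _ /\ _]addn0 -addn1 !l2' //;
  by rewrite n_inE nc.
rewrite /colour_compatible /colour_at; split.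
- by move=> i lt_i; rewrite l1 ?r1 ?sA.
- by move=> i _; rewrite -sA -sU -sI l3 r3.
- case: s aU R0 {L0 sI l2' r2' le_p sA sU} => [i b|i|i o] //= aU R0 _.
  by have [-> ->] := R0 erefl; move: aU; rewrite !inE => /orP[] /eqP->.
- case: s sI aU L0 {R0 l2' r2' le_p sA sU} => [i b|i|i o] //= sI aU L0 _.
  have [-> ->] := L0 erefl; rewrite n_inE in sI.
  by case: I sI aU {L0 l1 l2 l3} => [|p [|q []]] // _; case: andP => // -[_ /eqP].
- case: s sI aU L0 R0 {l2' r2' le_p sA sU} => [i b|i|i o] //= sI aU L0 R0 _.
  have [-> ->] := L0 erefl; have [-> ->] := R0 erefl; rewrite n_inE in sI.
  by case: I sI aU {L0 l1 l2 l3} => [|p [|q []]] // _; rewrite inE => /eqP->.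
Qed.

Lemma eq_levels L M : orientations L = orientations M ->
  (forall j, j < size L -> colour_at L j = colour_at M j) -> L = M.
Proof.
move=> eq_o eq_c; have sz : size L = size M by rewrite -size_orientations eq_o
  size_orientations.
apply: (@eq_from_nth _ (true, false)) => // j lt_j.
have := congr1 (nth true ^~ j) eq_o; rewrite /orientations !(nth_map (true,
  false)) -?sz // => e1.
by have := eq_c j lt_j; rewrite /colour_at; case:
  (nth _ L j) (nth _ M j) e1 => [? ?] [? ?] /= -> ->.
Qed.

Lemma compatible_colour_step s L L' : step s (orientations L) =
  Some (orientations L') ->
  colour_compatible s L L' -> L' \in colour_step s L.
Proof.
move=> sL; have := step_bounds sL; rewrite size_orientations => le_p.
have [A [I [B [defL sA sI]]]] := split_level le_p; subst L.
rewrite (colour_step_split B sA) ?sI // => -[c1 c2 c3 c4 c5].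
suff [U [oU aU cU]] : exists U, [/\ orientations L' =
  orientations A ++ orientations U ++ orientations B, U \in slice_act s I &
    forall j, j < n_out s -> colour_at L' (pos s + j) = colour_at U j].
  have sU := size_slice_act sI aU; apply/mapP; exists U => //.
  apply: eq_levels => [|j]; first by rewrite oU /orientations !map_cat.
  rewrite -size_orientations oU !size_cat !size_orientations sA sU => lt_j.
  have [l1 l2 l3] := nth_mid (true, false) A I B.
  have [r1 r2 r3] := nth_mid (true, false) A U B.
  have [lt1|ge1] := ltnP j (pos s).
    by rewrite -c1 // /colour_at l1 ?r1 ?sA.
  have [lt2|ge2] := ltnP (j - pos s) (n_out s).
    by rewrite -(subnKC ge1) cU // /colour_at -sA r2 // sU sA.
  have -> : j = pos s + n_out s + (j - pos s - n_out s) by lia.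
  rewrite -c2; last by rewrite !size_cat sA sI; lia.
  by rewrite /colour_at -sA -sI l3 -sU r3.
have sAo : size (orientations A) = pos s by rewrite size_orientations.
move: sL; rewrite /orientations !map_cat -!/(orientations _).
case: s sA sAo sI {le_p} c1 c2 c3 c4 c5 => [i b|i|i o] /= sA sAo sI c1 c2 c3 c4 c5;
  rewrite n_inE /= in sI.
- case: I sI c1 c2 c4 c5 => // _ _ _ _ _; rewrite size_cat sAo leq_addr.
  rewrite take_size_cat // drop_size_cat // => -[oL'].
  exists [:: (b, colour_at L' i); (~~ b, colour_at L' i)]; split=> //.
    by rewrite !inE; case: (colour_at L' i); rewrite eqxx ?orbT.
  move=> [|[|j]] //= _; first by rewrite addn0.
  by rewrite addn1 -c3.
- case: I sI c1 c2 c4 c5 => [|p [|q []]] //= _ _ _ c4 _;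
    rewrite take_size_cat // drop_size_cat //=.
  case: ifP => // pq [oL']; exists [::]; split=> //.
  have [_ l2 _] := nth_mid (true, false) A [:: p; q] B.
  have /= := l2 0 isT; have /= := l2 1 isT; have /= := c4 isT;
    rewrite sA addn0 addn1 /colour_at => c4' l21 l20.
  by move: c4'; rewrite l21 l20 /= => ->; rewrite eqxx inE.
- case: I sI c1 c2 c4 c5 => [|p [|q []]] //= _ _ _ _ c5;
    rewrite take_size_cat // drop_size_cat //=.
  move=> [oL']; exists [:: (q.1, ~~ q.2); (p.1, ~~ p.2)]; split=> //.
    by rewrite inE.
  have [_ l2 _] := nth_mid (true, false) A [:: p; q] B.
  have /= := l2 0 isT; have /= := l2 1 isT; have /= := c5 isT;
    rewrite sA addn0 addn1 /colour_at.
  move=> c5' l21 l20; move: c5'; rewrite l21 l20 /= => -[e1 e2].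
  by move=> [|[|j]] //= _; rewrite ?addn0 ?addn1.
Qed.

End Histories.

(** * Alternating states as closed histories *)

Section AlternatingStates.
Variable D : diagram.
Local Notation len := (size (word D)).
Local Notation sz t := (size (level_at D t)).
Implicit Types (u v : node D) (c : crossing D) (a b : smoothing D).
Implicit Types (x y z s : state D) (f : node D -> bool).

(** The strands of a diagram at a given height with the labels of their nodes
    as colours. *)
Definition coloured_level f t : seq (bool * bool) :=
  mkseq (fun i => (nth true (level_at D t) i, label f t i)) (sz t).

Definition history f : seq (seq (bool * bool)) := mkseq (coloured_level f) len.+1.

Lemma orientations_coloured_level f t : orientations (coloured_level f t) =
  level_at D t.
Proof.
apply: (@eq_from_nth _ true); rewrite size_orientations size_mkseq // => i lt_i.
by rewrite (nth_map (true, true)) ?size_mkseq // nth_mkseq.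
Qed.

Lemma colour_at_coloured_level f t i : (i < sz t)%N ->
  colour_at (coloured_level f t) i = label f t i.
Proof. by move=> lt_i; rewrite /colour_at nth_mkseq. Qed.

Lemma nth_history f t : (t <= len)%N -> nth [::] (history f) t = coloured_level f t.
Proof. by move=> lt_t; rewrite nth_mkseq. Qed.

Lemma alternatingP x : reflect (forall c,
  subscript x (sw c) != subscript x (ne c)) (alternating x).
Proof.
rewrite /alternating /pivot; case: pickP => [c bc|nb]; constructor.
  by move/(_ c); rewrite -monochromeE bc.
by move=> c; rewrite -monochromeE nb.
Qed.

Lemma resolution_constant a f c vt : constant_on (arc a) f -> vertical a c = vt ->
  if vt then f (sw c) = f (nw c) /\ f (se c) = f (ne c)
  else f (sw c) = f (se c) /\ f (nw c) = f (ne c).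
Proof.
move=> inv_f <-.
have H u v : resolution_arc c (vertical a c) u v -> f u = f v.
  by move=> uv; apply: inv_f; rewrite (arc_offE _ c) uv orbT.
by move: H; case: (vertical a c) => H; split; apply: H;
  rewrite /resolution_arc !eqxx ?orbT.
Qed.

(** The resolution joins corners of equal colour and its two arcs have
    different colours, so it is vertical exactly when the two lower corners
    differ, and opposite corners differ in any case. *)
Lemma alternating_corners x c : alternating x ->
  [/\ subscript x (nw c) = ~~ subscript x (se c),
      subscript x (ne c) = ~~ subscript x (sw c) &
      vertical (tag x) c = (subscript x (sw c) != subscript x (se c))].
Proof.
move=> /alternatingP/(_ c); have := resolution_constant (c :=
  c) (@subscript_constant _ x) erefl.
case: (vertical (tag x) c) => -[e1 e2].
  by rewrite -e1 -e2; do 2!case: (subscript x _).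
by rewrite e2 -e1; do 2!case: (subscript x _).
Qed.

Lemma corner_label f c :
  [/\ label f (val (val c)) (pos (crossing_slice c)) = f (sw c),
      label f (val (val c)) (pos (crossing_slice c)).+1 = f (se c),
      label f (val (val c)).+1 (pos (crossing_slice c)) = f (nw c) &
      label f (val (val c)).+1 (pos (crossing_slice c)).+1 = f (ne c)].
Proof.
by have := label_coord f (sw c); have := label_coord f (se c);
  have := label_coord f (nw c); have := label_coord f (ne c);
  rewrite node_coord_sw node_coord_se node_coord_nw node_coord_ne => /= -> -> -> ->.
Qed.

Lemma uncrossed_constant a f : constant_on (arc a) f ->
  constant_on (@uncrossed_arc D) f.
Proof. by move=> inv_f u v uv; apply: inv_f; rewrite arcE uv. Qed.

Lemma coloured_level_step x t : alternating x -> (t < len)%N ->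
  coloured_level (subscript x) t.+1 \in colour_step (slice_at D t)
    (coloured_level (subscript x) t).
Proof.
move=> gx lt_t; set f := subscript x.
have inv_f : constant_on (@uncrossed_arc D) f :=
  uncrossed_constant (@subscript_constant _ x).
have [b1 b2] := slice_bounds lt_t.
apply: compatible_colour_step; first by rewrite !orientations_coloured_level;
  exact: step_at.
have szl : size (coloured_level f t) = sz t by rewrite size_mkseq.
split; rewrite ?szl.
- move=> i lt_i; rewrite !colour_at_coloured_level; try lia.
  exact: label_left.
- move=> i lt_i; rewrite !colour_at_coloured_level; try lia.
  exact: label_right.
- move=> Cs; have no : n_out (slice_at D t) = 2%N by case: (slice_at D t) Cs.
  have ni : n_in (slice_at D t) = 0%N by case: (slice_at D t) Cs.
  rewrite !colour_at_coloured_level; try lia.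
  exact: label_cup.
- move=> Cs; have ni : n_in (slice_at D t) = 2%N by case: (slice_at D t) Cs.
  rewrite !colour_at_coloured_level; try lia.
  exact: label_cap.
move=> Xs; have ni : n_in (slice_at D t) = 2%N by case: (slice_at D t) Xs.
have no : n_out (slice_at D t) = 2%N by case: (slice_at D t) Xs.
have h1 : ((pos (slice_at D t)).+1 < sz t)%N by clear -b1 ni; lia.
have h2 : ((pos (slice_at D t)).+1 < sz t.+1)%N by clear -b2 ni no h1; lia.
rewrite (colour_at_coloured_level _ (ltnW h2)) (colour_at_coloured_level _ h1)
  (colour_at_coloured_level _ h2) (colour_at_coloured_level _ (ltnW h1)).
pose c : crossing D := exist _ (Ordinal lt_t) Xs.
have [g1 g2 _] := alternating_corners c gx; have [l1 l2 l3 l4] := corner_label f c.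
split; first exact: (etrans l3 (etrans g1 (congr1 negb (esym l2)))).
exact: (etrans l4 (etrans g2 (congr1 negb (esym l1)))).
Qed.

Lemma coloured_level_rev f : constant_on (@uncrossed_arc D) f ->
  coloured_level f len = rev (coloured_level f 0).
Proof.
move=> inv_f; apply: eq_levels.
  by rewrite /orientations map_rev -!/(orientations _)
    !orientations_coloured_level level_at_top level_at0.
have s0 : sz 0 = size (bottom D) by rewrite level_at0.
have s1 : sz len = size (bottom D) by rewrite level_at_top size_rev.
have z0 : size (coloured_level f 0) = size (bottom D) by rewrite size_mkseq s0.
move=> j; rewrite size_mkseq => lt_j; rewrite colour_at_coloured_level //
  /colour_at nth_rev ?z0 -?s1 //.
rewrite -/(colour_at _ _) s1 in lt_j *; rewrite colour_at_coloured_level;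
  last by rewrite s0; lia.
by apply: label_boundary => //; lia.
Qed.

Lemma history_weight_history f : history_weight (word D) (history f) =
  \sum_(t < len) colour_wt (slice_at D t) (coloured_level f t).
Proof.
rewrite history_weightE ?size_mkseq //; apply: eq_bigr => t _.
by rewrite nth_history // ltnW.
Qed.

Lemma slice_wt_cross (s : slice) p q r : is_cross s -> slice_wt s (p :: q :: r) =
  if (p.2 != q.2) == (p.1 == q.1) then 0
  else if over s == (p.1 == q.1) then 1 else -1.
Proof. by case: s. Qed.

(** The weight was defined by the colours; at an alternating state these
    determine the resolution. *)
Lemma crossing_wt x c : alternating x ->
  colour_wt (slice_at D (val (val c))) (coloured_level (subscript x) (val (val c))) =
  (tag x c)%:Z - (~~ positive D (val (val c)))%:Z.
Proof.
move=> gx; have [_ _ vert] := alternating_corners c gx.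
have [l1 l2 _ _] := corner_label (subscript x) c.
have [lt_c _] := crossing_bounds c.
rewrite /colour_wt (drop_nth (true, false)) ?size_mkseq; last exact: ltnW lt_c.
rewrite (drop_nth (true, false)) ?size_mkseq; last exact: lt_c.
rewrite (slice_wt_cross _ _ _ (valP c)) !nth_mkseq; [|exact: lt_c|exact: ltnW lt_c].
cbn [fst snd].
have -> : label (subscript x) (val (val c)) (pos (slice_at D (val (val c)))) =
  subscript x (sw c) := l1.
have -> : label (subscript x) (val (val c)) (pos (slice_at D (val (val c)))).+1 =
  subscript x (se c) := l2.
rewrite -vert /vertical /vertical_res /oriented_res /positive /parallel.
have -> : val (val c) = nat_of_ord (val c) by [].
generalize (tag x c) (over (slice_at D (nat_of_ord (val c)))).
generalize (nth true (level_at D (nat_of_ord (val c))) (pos (slice_at D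
  (nat_of_ord (val c))))).
generalize (nth true (level_at D (nat_of_ord (val c))) (pos (slice_at D
  (nat_of_ord (val c)))).+1).
by do 4!case.
Qed.

Lemma state_height_sum x : state_height x =
  \sum_c ((tag x c)%:Z - (~~ positive D (val (val c)))%:Z).
Proof.
have H (P : pred (crossing D)) : #|[set c | P c]|%:Z = \sum_c (P c)%:Z.
  rewrite -sum1_card big_mkcond (big_morph Posz PoszD (erefl 0%:Z)).
  by apply: eq_bigr => c _; rewrite inE; case: (P c).
by rewrite sumrB /state_height /height /n_minus !H.
Qed.

Lemma alternating_history x : alternating x ->
  history (subscript x) \in closed_histories (bottom D) (word D) (state_height x).
Proof.
move=> gx; have inv_f := uncrossed_constant (@subscript_constant _ x).
rewrite mem_closed_histories; apply/and5P; split.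
- by rewrite nth_history // orientations_coloured_level level_at0.
- by rewrite size_mkseq.
- apply/forallP => t; rewrite !nth_history //; last exact: ltnW.
  exact: coloured_level_step.
- by rewrite !nth_history // coloured_level_rev.
rewrite history_weight_history state_height_sum; apply/eqP.
apply: (@big_crossing D _ _ _ (fun t => colour_wt (slice_at D t) (coloured_level
  (subscript x) t))) => [t lt_t nX|c].
  exact: colour_wt_nocross.
exact: crossing_wt.
Qed.

Lemma vertical_inj a b c : vertical a c = vertical b c -> a c = b c.
Proof.
rewrite /vertical /vertical_res /oriented_res.
by case: (a c); case: (b c); case: (positive _ _); case: (parallel _ _).
Qed.

(** The colours determine the smoothing, by [alternating_corners]. *)
Lemma alternating_inj x y : alternating x -> alternating y ->
  superscript x = superscript y -> history (subscript x) =
    history (subscript y) -> x = y.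
Proof.
move=> gx gy eq_p eq_h.
have eq_k u : subscript x u = subscript y u.
  have [le_t lt_i] := node_coordP u.
  have := congr1 (fun h => colour_at (nth [::] h (node_coord u).1) (node_coord
    u).2) eq_h.
  by rewrite !nth_history // !colour_at_coloured_level // !label_coord.
apply: state_ext => //; apply/ffunP => c; apply: vertical_inj.
have [_ _ ->] := alternating_corners c gx; have [_ _ ->] := alternating_corners c gy.
by rewrite !eq_k.
Qed.

(** A closed history determines a colouring of the nodes; at a crossing the
    resolution is then the one that joins equal colours. *)
Section Realise.
Variables (i : int) (h : seq (seq (bool * bool))).
Hypothesis h_closed : h \in closed_histories (bottom D) (word D) i.

Let h0 : orientations (nth [::] h 0) = bottom D.
Proof. by move: h_closed; rewrite mem_closed_histories => /and5P[/eqP]. Qed.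

Let hS t : (t < len)%N -> nth [::] h t.+1 \in colour_step (slice_at D t) (nth [::] h t).
Proof.
move=> lt_t; move: h_closed; rewrite mem_closed_histories => /and5P[_ _ /forallP H _ _].
exact: (H (Ordinal lt_t)).
Qed.

Let h_rev : nth [::] h len = rev (nth [::] h 0).
Proof. by move: h_closed; rewrite mem_closed_histories => /and5P[_ _ _ /eqP]. Qed.

Let ori_h t : (t <= len)%N -> orientations (nth [::] h t) = level_at D t.
Proof.
elim: t => [|t IH] lt_t; first by rewrite h0 level_at0.
have := colour_step_step (hS lt_t); rewrite IH; last exact: ltnW.
by rewrite step_at // => -[].
Qed.

Let size_h t : (t <= len)%N -> size (nth [::] h t) = sz t.
Proof. by move=> le_t; rewrite -(ori_h le_t) size_orientations. Qed.

Let k (u : node D) : bool := colour_at (nth [::] h (node_coord u).1) (node_coord u).2.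

Let k_uncrossed : constant_on (@uncrossed_arc D) k.
Proof.
move=> u v /orP[|/existsP[t]].
  rewrite /boundary_arc /k => /and3P[/eqP e1 /eqP e2 /eqP e3].
  have [_ lt_u] := node_coordP u; have [_ lt_v] := node_coordP v.
  rewrite e1 e2 h_rev /colour_at in lt_u lt_v *.
  have s0 : size (nth [::] h 0) = size (bottom D) by rewrite size_h // level_at0.
  rewrite nth_rev s0; last by clear -e3; lia.
  by congr (nth _ _ _).2; clear -e3; lia.
have lt_t := ltn_ord t; have [c1 c2 c3 c4 _] := colour_step_compatible (hS lt_t).
have szt := size_h (ltnW lt_t); have [_ lt_u] := node_coordP u.
rewrite /base_arc /k => /or3P[/and3P[/eqP e1 /eqP e2]|/and3P[Cs /eqP eu /eqP
  ev]|/and3P[Cs /eqP eu /eqP ev]].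
- rewrite e1 e2 in lt_u *; case/orP => /andP[].
    by move=> lt_p /eqP->; apply: c1.
  move=> le_p /eqP e3; have := c2 ((node_coord u).2 - (pos (slice_at D t) +
    n_in (slice_at D t)))%N.
  rewrite szt subnKC // => ->; last by clear -le_p lt_u; lia.
  by congr (colour_at _ _); clear -le_p e3; lia.
- by rewrite eu ev; exact: c4.
- by rewrite eu ev; exact: c3.
Qed.

Let k_cross c : k (nw c) = ~~ k (se c) /\ k (ne c) = ~~ k (sw c).
Proof.
have [_ _ _ _ c5] := colour_step_compatible (hS (ltn_ord (val c))).
have [e1 e2] := c5 (valP c).
by rewrite /k node_coord_sw node_coord_se node_coord_nw node_coord_ne.
Qed.

Let a : smoothing D := [ffun c : crossing D =>
  ((k (sw c) != k (se c)) == parallel D (val (val c))) == ~~ positive D (val (val c))].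

Let vertical_a c : vertical a c = (k (sw c) != k (se c)).
Proof.
rewrite /vertical /vertical_res /oriented_res ffunE.
by case: (positive _ _); case: (parallel _ _); case: (_ != _).
Qed.

Let k_inv : constant_on (arc a) k.
Proof.
move=> u v; rewrite arcE => /orP[/k_uncrossed //|/existsP[c]].
have [e1 e2] := k_cross c.
rewrite /resolution_arc vertical_a; case: ifP => eq_k /orP[] /andP[/eqP-> /eqP->];
  rewrite ?e1 ?e2; move: eq_k; do 2!case: (k _); by [].
Qed.

Lemma realise p : exists x, [/\ alternating x, superscript x =
  p, history (subscript x) = h & state_height x = i].
Proof.
exists (mk_state a p k).
have sk := subscript_mk p k_inv.
have gx : alternating (mk_state a p k).
  apply/alternatingP => c; rewrite !sk; have [_ ->] := k_cross c.
  by case: (k _).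
have eq_h : history (subscript (mk_state a p k)) = h.
  have szh : size h = len.+1.
    by move: h_closed; rewrite mem_closed_histories => /and5P[_ /eqP].
  apply: (@eq_from_nth _ [::]); rewrite size_mkseq // => t lt_t.
  rewrite nth_history //; apply: eq_levels;
    first by rewrite orientations_coloured_level ori_h.
  move=> j; rewrite size_mkseq => lt_j; rewrite colour_at_coloured_level //.
  have [u eq_u] := node_at (lt_t : (t <= len)%N) lt_j.
  have := label_coord (subscript (mk_state a p k)) u; rewrite eq_u /= => ->.
  by rewrite sk /k eq_u.
split=> //.
have := alternating_history gx; rewrite eq_h mem_closed_histories => /and5P[_ _ _
  _ /eqP <-].
by move: h_closed; rewrite mem_closed_histories => /and5P[_ _ _ _ /eqP].
Qed.

End Realise.

Lemma alternating_val (g : alternating_state D) : alternating (val g).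
Proof. by case: g. Qed.

(** Alternating states with a given superscript correspond to closed
    histories; the factor 2 counts the superscripts. *)
Lemma card_alternating (i : int) :
  #|[set g : alternating_state D | alternating_height g == i]| =
  (2 * colour_count (bottom D) (word D) i)%N.
Proof.
rewrite -size_closed_histories.
pose Psi (g : alternating_state D) := (superscript (val g),
  history (subscript (val g))).
pose H := closed_histories (bottom D) (word D) i.
have -> : (2 * size H = size [seq (p, h) | p <- [:: true; false], h <- H])%N.
  by rewrite size_allpairs.
rewrite cardE -(size_map Psi); apply: perm_size; apply: uniq_perm.
- rewrite map_inj_in_uniq ?enum_uniq // => g g' _ _ eq_g.
  have eq_x : val g = val g' :> state D by exact:
    (alternating_inj (alternating_val g) (alternating_val g') (congr1 fst eq_g)
    (congr1 snd eq_g)).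
  case: g g' eq_x {eq_g} => [x gx] [y gy] /= eq_x; subst y.
  by rewrite (bool_irrelevance gx gy).
- by apply: allpairs_uniq => [||[p1 h1] [p2 h2] _ _ [-> ->]] //; exact:
    uniq_closed_histories.
move=> [p h]; apply/mapP/allpairsP => [[g]|[[q h'] [/= _ Hh [-> ->]]]].
  rewrite mem_enum inE => /eqP hg [-> ->].
  exists (superscript (val g), history (subscript (val g))); split=> //=.
    by case: (superscript _).
  by rewrite /H -hg; apply: alternating_history; apply: alternating_val.
have [x [gx sx hx ix]] := realise Hh q.
exists (exist _ x gx); first by rewrite mem_enum inE /alternating_height /= ix.
by rewrite /Psi /= sx hx.
Qed.

End AlternatingStates.

(** * Invariance *)

Theorem theorem4p2 (R : comPzRingType)
    (two_invertible : exists half : R, 2%:R * half = 1) (D : diagram) :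
  (forall e : smoothing D -> crossing D -> bool,
     sign_convention e -> is_complex (CDKh' R e)) /\
  (forall D' : diagram, same_link D D' ->
     forall (e : smoothing D -> crossing D -> bool)
            (e' : smoothing D' -> crossing D' -> bool),
       sign_convention e -> sign_convention e' ->
       homotopy_equivalent (CDKh' R e) (CDKh' R e')).
Proof.
split=> [e sign_e|D' DD' e e' sign_e sign_e'].
  by have [] := CDKh_complex_contraction two_invertible sign_e.
have [_ he] := CDKh_complex_contraction two_invertible sign_e.
have [_ he'] := CDKh_complex_contraction two_invertible sign_e'.
apply: homotopy_equivalent_trans he _.
apply: homotopy_equivalent_trans (homotopy_equivalent_sym he').
apply: zero_complexes_equivalent => i.
by rewrite !card_alternating (colour_count_same_link i DD').
Qed.
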